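(* Let $D^-(p,q;\tau;x)$ and $R^-(p,q;\tau;x)$ be as defined in the context, and let $\tau\in\mathbb{H}$. (1) For every $(p,q)\in V$ and every $x\in\mathbb{R}$ at which the sums are defined (i.e. $x$ is not a pole of the summands), $$D^-(p,q;\tau;x)=D^-(p,q+p;\tau;x),\qquad D^-(p,-q;\tau;x)=-D^-(p,q;\tau;x).$$ (2) For every $(p,q)\in U$ and every sufficiently small real number $x\neq0$, the following reciprocity law holds: $$D^-(p,q;\tau;x)+D^-(q,p;\tau;x)=R^-(p,q;\tau;x)+C(\tau),$$ where $C(\tau)$ is a constant with respect to $x$ (it may depend on $\tau$, $p$, $q$).
   Context: $\mathbb{H}=\{\tau\in\mathbb{C}: \operatorname{Im}\tau>0\}$; $V=\{(p,q)\in\mathbb{Z}^+\times\mathbb{Z}: \gcd(p,q)=1\}$; $U=\{(p,q)\in\mathbb{Z}^+\times\mathbb{Z}^+: \gcd(p,q)=1\}$. The Weierstrass functions, with $\gamma$ running over $(\mathbb{Z}\tau+\mathbb{Z})\setminus\{0\}$, are $$\sigma(z;\tau)=z\prod_\gamma\left(1-\frac z\gamma\right)\exp\left(\frac z\gamma+\frac12\left(\frac z\gamma\right)^2\right),\quad \zeta(z;\tau)=\frac1z+\sum_\gamma\left(\frac1{z-\gamma}+\frac1\gamma+\frac z{\gamma^2}\right),\quad \wp(z;\tau)=\frac1{z^2}+\sum_\gamma\left(\frac1{(z-\gamma)^2}-\frac1{\gamma^2}\right),$$ and $E_2(\tau)=2\zeta(2)+2(2\pi i)^2\sum_{k\ge1}\sigma_1(k)e^{2\pi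 ik\tau}$, with $\zeta(2)=\pi^2/6$, $\sigma_1(k)=\sum_{d\mid k}d$. For $(p,q)\in V$, $\tau\in\mathbb{H}$, $x\in\mathbb{R}$ (an empty sum being $0$): $$D^-(p,q;\tau;x)=\frac{1}{(2\pi i)^2p}\sum_{\substack{\lambda,\mu=0\\(\lambda,\mu)\ne(0,0)}}^{p-1}\left[\zeta\left(\frac{\lambda+\mu\tau}{p}-x;\tau\right)-E_2(\tau)\left(\frac{\lambda+\mu\tau}{p}-x\right)+2\pi i\frac{\mu}{p}\right]\left[\zeta\left(\frac{q(\lambda+\mu\tau)}{p};\tau\right)-E_2(\tau)\frac{q(\lambda+\mu\tau)}{p}+2\pi i\frac{q\mu}{p}\right].$$ For $(p,q)\in U$, $\tau\in\mathbb{H}$, $x\in\mathbb{R}$: $$\begin{aligned}R^-(p,q;\tau;x)=&-\frac{1}{(2\pi i)^2}\left[\zeta(px;\tau)-E_2(\tau)(px)\right]\left[\zeta(qx;\tau)-E_2(\tau)(qx)\right]\\&+\frac{q}{4\pi ip}\left[2\frac{\partial\log\sigma(px;\tau)}{\partial\tau}-\frac{\partial E_2(\tau)}{\partial\tau}(px)^2-\frac{1}{\pi i}E_2(\tau)\right]\\&+\frac{p}{4\pi iq}\left[2\frac{\partial\log\sigma(qx;\tau)}{\partial\tau}-\frac{\partial E_2(\tau)}{\partial\tau}(qx)^2-\frac{1}{\pi i}E_2(\tau)\right]\\&+\frac{1}{(2\pi i)^2pq}\left[\wp(x;\tau)+E_2(\tau)\right].\end{aligned}$$ *)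

(* Defs.v *)
From HB Require Import structures.
From mathcomp Require Import all_boot all_order all_algebra.
From mathcomp Require Import finmap.
From mathcomp Require Import all_classical all_reals all_analysis.
From mathcomp Require Import complex.
From mathcomp.analysis.showcase Require summability.

Set Implicit Arguments.
Unset Strict Implicit.
Unset Printing Implicit Defensive.

Import Order.TTheory GRing.Theory Num.Theory numFieldNormedType.Exports.

Local Open Scope classical_set_scope.
Local Open Scope ring_scope.

(* The complex numbers R[i], typed as a numClosedFieldType: MathComp-Analysis
   puts the topology and the normed module structure (hence lim and the complex
   derivative derive1) on such a structure, not on the bare type R[i]. *)
Definition Cplx (R : realType) : numClosedFieldType := complex R.

Section Definitions.
Context {R : realType}.
Implicit Types (tau z : Cplx R) (x : R).

Definition ofR x : Cplx R := Complex x 0.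
Definition iC : Cplx R := Complex 0 1.
Definition piC : Cplx R := ofR pi.

Definition cexp z : Cplx R :=
  ofR (expR (complex.Re z)) *
  (Complex (cos (complex.Im z)) (sin (complex.Im z)) : Cplx R).

Definition upper_half_plane : set (Cplx R) := [set tau | 0 < complex.Im tau].

(* For tau in the upper half plane the points m tau + n are pairwise distinct,
   so a sum over the nonzero lattice points is a sum over the pairs
   (m, n) <> (0, 0). *)
Definition lattice_pt tau (w : int * int) : Cplx R :=
  w.1%:~R * tau + w.2%:~R.

Definition lattice tau : set (Cplx R) := range (lattice_pt tau).

Definition nzpair := {w : int * int | w != (0, 0)}.

(* Unconditional sums and products: limits of the finite partial sums and
   products along the finite subsets of nzpair, ordered by inclusion. *)
Definition lattice_sum tau (f : Cplx R -> Cplx R) : Cplx R :=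
  summability.sum (fun w : nzpair => f (lattice_pt tau (val w))).

Definition lattice_prod tau (f : Cplx R -> Cplx R) : Cplx R :=
  lim ((fun A : {fset nzpair} => \prod_(w <- A) f (lattice_pt tau (val w)))
         @ summability.totally).

Definition wsigma z tau : Cplx R :=
  z * lattice_prod tau
        (fun g => (1 - z / g) * cexp (z / g + 1 / 2 * (z / g) ^+ 2)).

Definition wzeta z tau : Cplx R :=
  1 / z + lattice_sum tau (fun g => 1 / (z - g) + 1 / g + z / g ^+ 2).

Definition wp z tau : Cplx R :=
  1 / z ^+ 2 + lattice_sum tau (fun g => 1 / (z - g) ^+ 2 - 1 / g ^+ 2).

Definition sigma1 (k : nat) : nat := (\sum_(d <- divisors k) d)%N.

Definition zeta2 : Cplx R := piC ^+ 2 / 6.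

Definition E2 tau : Cplx R :=
  2 * zeta2
  + 2 * (2 * piC * iC) ^+ 2 *
    \big[+%R/0]_(1 <= k <oo)
      ((sigma1 k)%:R * cexp (2 * piC * iC * k%:R * tau)).

(* The partial derivative in tau of log sigma(z; tau), read as the logarithmic
   derivative: it is the derivative of every local branch of log sigma. *)
Definition dtau_log_sigma z tau : Cplx R :=
  derive1 (fun t : Cplx R => wsigma z t) tau / wsigma z tau.

Definition V (p : nat) (q : int) : Prop := (0 < p)%N /\ gcdz p%:Z q = 1.

Definition U (p q : nat) : Prop := [/\ (0 < p)%N, (0 < q)%N & gcdn p q = 1%N].

Definition nz_index (p : nat) (lm : 'I_p * 'I_p) : bool :=
  ((lm.1 : nat) != 0%N) || ((lm.2 : nat) != 0%N).

Definition torsion_pt (p : nat) (lm : 'I_p * 'I_p) tau : Cplx R :=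
  (lm.1%:R + lm.2%:R * tau) / p%:R.

Definition Dminus (p : nat) (q : int) tau x : Cplx R :=
  1 / ((2 * piC * iC) ^+ 2 * p%:R) *
  \sum_(lm : 'I_p * 'I_p | nz_index lm)
    (wzeta (torsion_pt lm tau - ofR x) tau
       - E2 tau * (torsion_pt lm tau - ofR x)
       + 2 * piC * iC * (lm.2%:R / p%:R)) *
    (wzeta (q%:~R * torsion_pt lm tau) tau
       - E2 tau * (q%:~R * torsion_pt lm tau)
       + 2 * piC * iC * (q%:~R * lm.2%:R / p%:R)).

(* When gcd(p, q) = 1, q (l + m tau) / p is never a lattice point, so only the
   first factor of a summand of Dminus can be evaluated at a pole. *)
Definition Dminus_defined (p : nat) tau x : Prop :=
  forall lm : 'I_p * 'I_p, nz_index lm ->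
    ~ lattice tau (torsion_pt lm tau - ofR x).

Definition Rminus (p q : nat) tau x : Cplx R :=
  let px := p%:R * ofR x in
  let qx := q%:R * ofR x in
  - (1 / (2 * piC * iC) ^+ 2) * (wzeta px tau - E2 tau * px)
                              * (wzeta qx tau - E2 tau * qx)
  + q%:R / (4 * piC * iC * p%:R) *
    (2 * dtau_log_sigma px tau - derive1 E2 tau * px ^+ 2
       - 1 / (piC * iC) * E2 tau)
  + p%:R / (4 * piC * iC * q%:R) *
    (2 * dtau_log_sigma qx tau - derive1 E2 tau * qx ^+ 2
       - 1 / (piC * iC) * E2 tau)
  + 1 / ((2 * piC * iC) ^+ 2 * p%:R * q%:R) * (wp (ofR x) tau + E2 tau).

End Definitions.

(* Main.v *)
Require Import Defs.
From HB Require Import structures.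
From mathcomp Require Import all_boot all_order all_algebra.
From mathcomp Require Import finmap.
From mathcomp Require Import all_classical all_reals all_analysis.
From mathcomp Require Import complex.
From mathcomp Require Import ring lra zify.
From mathcomp.analysis.showcase Require summability.
Import Order.TTheory GRing.Theory Num.Theory numFieldNormedType.Exports.
Set Implicit Arguments.
Unset Strict Implicit.
Unset Printing Implicit Defensive.
Local Open Scope classical_set_scope.
Local Open Scope ring_scope.

(** Everything follows from the addition law of the cotangent. Put C(z) = pi cot (pi z),
    named [eis1], and J = 2 pi i, named [tpi]. If a, b and a + b are not integers,
    C(a) C(b) = pi^2 + C(a + b) (C(a) + C(b)), see [eis1_add].

    By the partial fractions of C and of its first derivatives ([eis1_sum], [eis2_sum],
    [eis3_sum]) the sum of a Weierstrass series over a row m tau + Z of the lattice is an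
    expression in C(z + m tau). What remains is a series over m. Up to signs that make it
    converge, zeta(z) - E2 z is the sum of the C(z + m tau), called [qzeta]
    ([wzeta_qzeta], [E2_G2]); wp(z) + E2 is the sum of the C^2 + pi^2 at z + m tau, called
    [wpsum] ([wp_wpsum]); and the tau-derivative of log sigma(z) is, up to a constant and
    up to the term E2' z^2 / 2, the sum of the m C(z + m tau), called [qmom] ([dtau_log],
    [derive1_E2]). In [Rminus] the derivative of E2 therefore cancels.

    Summing the addition law at a + m tau and b + n tau over all m and n gives
    [qzeta_three]; the regularising signs make the first moments [qmom] appear
    ([three_term]). Adding suitable multiples of the real coordinate Im z / Im tau makes
    the functions periodic under the lattice, and the relation keeps its form:
      Z(a) Z(b) - Z(a + b) (Z(a) + Z(b)) = L(a) + L(b) + L(a + b) + pi^2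
    for the periodic functions Z = [ellZ] and L = [ellL], see [ellZ_three].

    The brackets in the definition of [Dminus] are values of Z. Since Z is odd and
    periodic, this proves the first part of the theorem, [Dminus_period]. For the second
    part let t run over the p-torsion and s over the q-torsion points. The distribution
    relation for Z ([ellZ_dist]) replaces q Z(q t) by the sum of Z(t + s) over s, and
    p Z(p s) by the sum of Z(t + s) over t; replacing t and s by their opposites in the
    second double sum, one finds
      J^2 p q (D(p, q) + D(q, p)) = sum over t and s of Z(t + s) (Z(t - x) + Z(s + x)).
    The three-term relation with a = t - x and b = s + x turns each summand into
    Z(t - x) Z(s + x) - L(t - x) - L(s + x) plus a constant, and the distribution
    relations collapse the sums to values at p x and q x. The pair t = s = 0, where a + b
    is a pole, is exceptional; it contributes Z(x)^2 + 2 L(x), which is wp(x) + E2 up to a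
    constant by the limiting case b = - a of the three-term relation ([wpsum_qzeta]). This
    is [reciprocity_sum], and [reciprocity] translates it into the notation of the
    theorem. *)

(** * Modulus and exponential of complex numbers *)

Section ModulusExponential.
Context {R : realType}.
Local Notation C := (Cplx R).
Implicit Types (z w : C) (x y : R).

(** The modulus as an element of [R]; the norm of [Cplx R] takes its values in
    [Cplx R]. *)
Definition cmod z : R := Normc.normc z.

Lemma cmodM z w : cmod (z * w) = cmod z * cmod w. Proof. exact: Normc.normcM. Qed.
Lemma cmodV z : cmod z^-1 = (cmod z)^-1. Proof. exact: Normc.normcV. Qed.
Lemma cmodD z w : cmod (z + w) <= cmod z + cmod w. Proof. exact: le_normcD. Qed.
Lemma cmodN z : cmod (- z) = cmod z. Proof. exact: normcN. Qed.
Lemma cmod0 : cmod 0 = 0. Proof. exact: Normc.normc0. Qed.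
Lemma cmod1 : cmod 1 = 1. Proof. exact: Normc.normc1. Qed.
Lemma cmod_eq0 z : (cmod z == 0) = (z == 0).
Proof. by apply/eqP/eqP => [/Normc.eq0_normc //|->]; rewrite cmod0. Qed.

Lemma cmod_ge0 z : 0 <= cmod z. Proof. by case: z => a b; exact: sqrtr_ge0. Qed.
Lemma cmod_gt0 z : (0 < cmod z) = (z != 0).
Proof. by rewrite lt_neqAle cmod_ge0 andbT eq_sym cmod_eq0. Qed.

Lemma normCE z : `|z| = ofR (cmod z). Proof. by rewrite normc_def; case: z. Qed.
Lemma cmod_ofR x : cmod (ofR x) = `|x|.
Proof. by rewrite /cmod /= expr0n addr0 sqrtr_sqr. Qed.

Lemma ofRD : {morph (@ofR R) : x y / x + y}.
Proof. by move=> x y; apply/eqP; rewrite complex.eq_complex /= addr0 !eqxx. Qed.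

Lemma ofRM : {morph (@ofR R) : x y / x * y}.
Proof. by move=> x y; apply/eqP; rewrite complex.eq_complex /= !mulr0 mul0r subr0 addr0 !eqxx. Qed.

Lemma ofRN : {morph (@ofR R) : x / - x}.
Proof. by move=> x; apply/eqP; rewrite complex.eq_complex /= oppr0 !eqxx. Qed.

Lemma Re_cmod z : `|complex.Re z| <= cmod z.
Proof.
case: z => a b; rewrite /cmod /= -sqrtr_sqr; rewrite ler_wsqrtr// ?lerDl ?lerDr ?sqr_ge0//.
Qed.

Lemma Im_cmod z : `|complex.Im z| <= cmod z.
Proof.
case: z => a b; rewrite /cmod /= -sqrtr_sqr; rewrite ler_wsqrtr// ?lerDl ?lerDr ?sqr_ge0//.
Qed.

Lemma cmod_ReIm z : cmod z <= `|complex.Re z| + `|complex.Im z|.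
Proof.
case: z => a b; rewrite /cmod /= -(@ger0_norm _ (`|a| + `|b|)) ?addr_ge0//.
rewrite -[leRHS]sqrtr_sqr ler_wsqrtr// sqrrD !real_normK ?num_real//.
by rewrite lerD2r lerDl mulrn_wge0// mulr_ge0.
Qed.

Lemma cmodX z n : cmod (z ^+ n) = cmod z ^+ n.
Proof. by elim: n => [|n IH]; rewrite ?expr0 ?cmod1// !exprS cmodM IH. Qed.

Lemma cmodB z w : cmod (z - w) <= cmod z + cmod w.
Proof. by rewrite -[in leRHS](cmodN w); exact: cmodD. Qed.

Lemma cmod_distC z w : cmod (z - w) = cmod (w - z).
Proof. by rewrite -cmodN opprB. Qed.

Lemma cmodBge z w : cmod z - cmod w <= cmod (z - w).
Proof. by rewrite lerBlDr; apply: le_trans (cmodD _ _); rewrite subrK. Qed.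

Lemma cmod_nat n : cmod n%:R = n%:R.
Proof.
elim: n => [|n IH]; first exact: cmod0.
suff -> : (n.+1%:R : C) = ofR n.+1%:R by rewrite cmod_ofR ger0_norm.
elim: n.+1 => // {IH}n IH; rewrite -!natr1 IH.
by apply/eqP; rewrite complex.eq_complex /= addr0 !eqxx.
Qed.

Lemma cmod_sum (I : Type) (s : seq I) (P : pred I) (f : I -> C) :
  cmod (\sum_(i <- s | P i) f i) <= \sum_(i <- s | P i) cmod (f i).
Proof.
elim/big_rec2: _ => [|i y x _ H]; first by rewrite cmod0.
by apply: le_trans (cmodD _ _) _; rewrite lerD2l.
Qed.

(** By the mean value theorem a bound for the derivative gives one of the next degree
    for the function. Iterated from [cos_max] and [expR_le4], this yields the Taylor
    estimates below. *)
Lemma taylor_step (f df : R -> R) (K : R) n : f 0 = 0 ->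
  (forall x : R, is_derive x 1 f (df x)) ->
  (forall x : R, `|x| <= 1 -> `|df x| <= K * `|x| ^+ n) ->
  forall x : R, `|x| <= 1 -> `|f x| <= K * `|x| ^+ n.+1.
Proof.
move=> f0 dfE Hdf.
have fc (a b : R) : {within `[a, b], continuous f}.
  apply: continuous_subspaceT => y.
  by apply: differentiable_continuous; apply/derivable1_diffP; case: (dfE y).
have K0 : 0 <= K.
  by have := Hdf 1; rewrite normr1 expr1n mulr1 => /(_ (lexx _)); exact: le_trans.
have key (x : R) : `|x| <= 1 -> exists2 c : R, `|c| <= `|x| & f x = df c * x.
  move=> x1; have [x0|x0] := leP 0 x.
    have [c cI E] := @MVT_segment _ f df 0 x x0 (fun y _ => dfE y) (fc _ _).
    move: cI; rewrite in_itv/= => /andP[c0 cx]; exists c; last by rewrite -[RHS]subr0 -[X in _ - X](mulr0 (df c)) -mulrBr -E f0 subr0.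
    by rewrite !ger0_norm.
  have [c cI E] := @MVT_segment _ f df x 0 (ltW x0) (fun y _ => dfE y) (fc _ _).
  move: cI; rewrite in_itv/= => /andP[cx c0]; exists c.
    by rewrite !ler0_norm ?(ltW x0)// lerN2.
  by move: E; rewrite f0 !sub0r mulrN => /oppr_inj.
move=> x x1; have [c cx ->] := key x x1.
rewrite normrM exprSr mulrA ler_wpM2r//.
apply: le_trans (Hdf c (le_trans cx x1)) _.
by rewrite ler_wpM2l// lerXn2r// nnegrE.
Qed.

Lemma sin_taylor1 x : `|x| <= 1 -> `|sin x| <= `|x|.
Proof.
move=> x1; have := @taylor_step sin cos 1 0 (sin0 _) _ _ x x1.
rewrite expr1 mul1r; apply.
by move=> y _; rewrite expr0 mulr1 cos_max.
Qed.

Lemma cos_taylor2 x : `|x| <= 1 -> `|cos x - 1| <= `|x| ^+ 2.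
Proof.
move=> x1; have := @taylor_step (fun x => cos x - 1) (fun x => - sin x) 1 1 _ _ _ x x1.
rewrite mul1r; apply.
- by rewrite cos0 subrr.
- by move=> y; apply: is_derive_eq; rewrite subr0.
- by move=> y y1; rewrite normrN mul1r expr1; exact: sin_taylor1.
Qed.

Lemma sin_taylor3 x : `|x| <= 1 -> `|sin x - x| <= `|x| ^+ 3.
Proof.
move=> x1; have := @taylor_step (fun x => sin x - x) (fun x => cos x - 1) 1 2 _ _ _ x x1.
rewrite mul1r; apply.
- by rewrite sin0 subrr.
- by move=> y y1; rewrite mul1r; exact: cos_taylor2.
Qed.

Lemma cos_taylor4 x : `|x| <= 1 -> `|cos x - 1 + x ^+ 2 / 2| <= `|x| ^+ 4.
Proof.
move=> x1; have := @taylor_step (fun x => cos x - 1 + x ^+ 2 / 2) (fun x => - (sin x - x)) 1 3 _ _ _ x x1.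
rewrite mul1r; apply.
- by rewrite cos0 subrr expr0n mul0r addr0.
- move=> y; apply: is_derive_eq; rewrite /GRing.scale /=; by field.
- by move=> y y1; rewrite normrN mul1r; exact: sin_taylor3.
Qed.

(** [expR (- 1 / 2) >= 1 / 2], so [expR 1], the square of [expR (1 / 2)], is at most
    4. *)
Lemma expR_le4 x : x <= 1 -> expR x <= 4.
Proof.
move=> x1; have : expR x <= expR 1 by rewrite ler_expR.
have h : expR (- (2^-1 : R)) >= 1 - 2^-1 by exact: expR_ge1Dx.
have h2 : expR (2^-1 : R) * expR (- (2^-1 : R)) = 1 by exact: expRxMexpNx_1.
have -> : expR 1 = expR (2^-1 : R) * expR (2^-1 : R).
  by rewrite -expRD; congr expR; by field.
have := expR_gt0 (2^-1 : R).
move: h h2; move: (expR 2^-1) (expR (- 2^-1)) => a b; nra.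
Qed.

Lemma expR_taylor1 x : `|x| <= 1 -> `|expR x - 1| <= 4 * `|x|.
Proof.
move=> x1; have := @taylor_step (fun x => expR x - 1) expR 4 0 _ _ _ x x1.
rewrite expr1; apply.
- by rewrite expR0 subrr.
- by move=> y; apply: is_derive_eq; rewrite subr0.
- move=> y y1; rewrite expr0 mulr1 ger0_norm ?expR_ge0//; apply: expR_le4.
  by apply: le_trans y1; exact: ler_norm.
Qed.

Lemma expR_taylor2 x : `|x| <= 1 -> `|expR x - 1 - x| <= 4 * `|x| ^+ 2.
Proof.
move=> x1; have := @taylor_step (fun x => expR x - 1 - x) (fun x => expR x - 1) 4 1 _ _ _ x x1.
apply.
- by rewrite expR0 subrr subr0.
- by move=> y; apply: is_derive_eq; rewrite subr0.
- by move=> y y1; rewrite expr1; exact: expR_taylor1.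
Qed.

Lemma expR_taylor3 x : `|x| <= 1 -> `|expR x - 1 - x - x ^+ 2 / 2| <= 4 * `|x| ^+ 3.
Proof.
move=> x1; have := @taylor_step (fun x => expR x - 1 - x - x ^+ 2 / 2) (fun x => expR x - 1 - x) 4 2 _ _ _ x x1.
apply.
- by rewrite expR0 expr0n mul0r subrr !subr0.
- by move=> y; apply: is_derive_eq; rewrite /GRing.scale /=; by field.
- by move=> y y1; exact: expR_taylor2.
Qed.

Lemma cexpD z w : cexp (z + w) = cexp z * cexp w.
Proof.
case: z => a b; case: w => c d; rewrite /cexp /= expRD cosD sinD ofRM.
rewrite mulrACA; congr (_ * _); apply/eqP; rewrite complex.eq_complex /=.
by rewrite eqxx /= addrC.
Qed.

Lemma cmod_cexp z : cmod (cexp z) = expR (complex.Re z).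
Proof.
rewrite /cexp cmodM cmod_ofR ger0_norm ?expR_ge0// [X in _ * X](_ : _ = 1) ?mulr1//.
by rewrite /cmod /= cos2Dsin2 sqrtr1.
Qed.

Lemma cexp0 : cexp (0 : C) = 1.
Proof.
rewrite /cexp /= expR0 cos0 sin0; apply/eqP; rewrite complex.eq_complex /=.
by rewrite !mulr0 !mul0r !mulr1 subr0 addr0 !eqxx.
Qed.

Lemma cexp_neq0 z : cexp z != 0.
Proof. by rewrite -cmod_gt0 cmod_cexp expR_gt0. Qed.

Lemma cexpN z : cexp (- z) = (cexp z)^-1.
Proof.
by apply: (mulfI (cexp_neq0 z)); rewrite -cexpD subrr cexp0 divff// cexp_neq0.
Qed.

Lemma cexpM_nat n z : cexp (n%:R * z) = cexp z ^+ n.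
Proof.
elim: n => [|n IH]; first by rewrite mul0r cexp0.
by rewrite -natr1 mulrDl mul1r cexpD IH exprSr.
Qed.

(** Real and imaginary parts are expanded separately, from the Taylor estimates for
    [expR], [cos] and [sin]. *)
Lemma cexp_taylor z : cmod z <= 1 -> cmod (cexp z - 1 - z - z ^+ 2 / 2) <= 20 * cmod z ^+ 3.
Proof.
move=> z1; have hx := Re_cmod z; have hy := Im_cmod z; have n0 := cmod_ge0 z.
set n := cmod z in z1 hx hy n0 *.
have x1 := le_trans hx z1; have y1 := le_trans hy z1.
have a3 := expR_taylor3 x1; have b4 := cos_taylor4 y1; have d3 := sin_taylor3 y1.
apply: le_trans (cmod_ReIm _) _.
have [eqR eqI] : complex.Re (cexp z - 1 - z - z ^+ 2 / 2) =
   expR (complex.Re z) * cos (complex.Im z) - 1 - complex.Re z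
   - (complex.Re z ^+ 2 - complex.Im z ^+ 2) / 2
 /\ complex.Im (cexp z - 1 - z - z ^+ 2 / 2) =
   expR (complex.Re z) * sin (complex.Im z) - complex.Im z
   - complex.Re z * complex.Im z.
  have -> : (2^-1 : C) = ofR 2^-1.
    apply: (mulfI (_ : (2 : C) != 0)); first by rewrite pnatr_eq0.
    rewrite divff ?pnatr_eq0//.
    have -> : (2 : C) = ofR 2 by apply/eqP; rewrite complex.eq_complex /= addr0 !eqxx.
    by rewrite -ofRM divff// pnatr_eq0.
  by case: (z) => a b; rewrite /cexp; split => /=; by field.
rewrite {}eqR {}eqI.
move: (complex.Re z) (complex.Im z) hx hy x1 y1 a3 b4 d3 => x y hx hy x1 y1 a3 b4 d3.
set a := expR x - 1 - x - x ^+ 2 / 2 in a3.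
set b := cos y - 1 + y ^+ 2 / 2 in b4.
set d := sin y - y in d3.
have -> : expR x = 1 + x + x ^+ 2 / 2 + a by rewrite /a; ring.
have -> : cos y = 1 - y ^+ 2 / 2 + b by rewrite /b; ring.
have -> : sin y = y + d by rewrite /d; ring.
have lea : `|a| <= 4 * n ^+ 3.
  by apply: le_trans a3 _; rewrite ler_wpM2l// lerXn2r// nnegrE.
have leb : `|b| <= n ^+ 3.
  apply: le_trans b4 _; apply: le_trans (_ : `|y| ^+ 3 <= _).
    by rewrite exprSr ler_piMr// exprn_ge0.
  by rewrite lerXn2r// nnegrE.
have led : `|d| <= n ^+ 3.
  by apply: le_trans d3 _; rewrite lerXn2r// nnegrE.
have N0 : 0 <= n ^+ 3 by rewrite exprn_ge0.
have c1 : `|1 - y ^+ 2 / 2 + b| <= 1.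
  by rewrite (_ : 1 - y ^+ 2 / 2 + b = cos y) ?cos_max// /b; ring.
have s1 : `|y + d| <= 1 by rewrite (_ : y + d = sin y) ?sin_max// /d; ring.
have e1 : `|1 + x + x ^+ 2 / 2| <= 5 / 2.
  by move: x1; rewrite !ler_norml => /andP[? ?]; apply/andP; split; nra.
have mulN (u v k l : R) : `|u| <= k -> `|v| <= l -> - (k * l) <= u * v <= k * l.
  by move=> uk vl; rewrite -ler_norml normrM ler_pM.
have pN (u v w : R) : `|u| <= n -> `|v| <= n -> `|w| <= n -> - n ^+ 3 <= u * v * w <= n ^+ 3.
  move=> hu hv hw; rewrite -ler_norml !normrM (_ : n ^+ 3 = n * n * n); last by ring.
  by rewrite ler_pM ?mulr_ge0// ler_pM.
have h1 := pN _ _ _ hx hy hy.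
have h2 := pN _ _ _ hx hx hy.
have h3 : - n ^+ 3 <= x * y * y * x <= n ^+ 3.
  rewrite -ler_norml normrM -[leRHS]mulr1 ler_pM//.
  by rewrite ler_norml.
have h4 := mulN _ _ _ _ e1 leb.
have h5 := mulN _ _ _ _ e1 led.
have h6 := mulN _ _ _ _ lea c1.
have h7 := mulN _ _ _ _ lea s1.
have rE : `|(1 + x + x ^+ 2 / 2 + a) * (1 - y ^+ 2 / 2 + b) - 1 - x - (x ^+ 2 - y ^+ 2) / 2| <= 10 * n ^+ 3.
  rewrite (_ : _ - _ = - (x * y * y) / 2 - (x * y * y * x) / 4 + (1 + x + x ^+ 2 / 2) * b + a * (1 - y ^+ 2 / 2 + b)); last by field.
  rewrite ler_norml; move: h1 h3 h4 h6; set A1 := x * y * y * x; set A2 := x * y * y; set A3 := _ * b; set A4 := a * _.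
  by lra.
have iE : `|(1 + x + x ^+ 2 / 2 + a) * (y + d) - y - x * y| <= 10 * n ^+ 3.
  rewrite (_ : _ - _ = (x * x * y) / 2 + (1 + x + x ^+ 2 / 2) * d + a * (y + d)); last by field.
  rewrite ler_norml; move: h2 h5 h7; set A2 := x * x * y; set A3 := _ * d; set A4 := a * _.
  by lra.
lra.
Qed.

Lemma cexp_taylor2 z : cmod z <= 1 -> cmod (cexp z - 1 - z) <= 21 * cmod z ^+ 2.
Proof.
move=> z1; have h := cexp_taylor z1.
rewrite (_ : cexp z - 1 - z = (cexp z - 1 - z - z ^+ 2 / 2) + z ^+ 2 / 2); last by ring.
apply: le_trans (cmodD _ _) _; rewrite cmodM cmodX cmodV cmod_nat.
by have := cmod_ge0 z; nra.
Qed.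

(** For such [z] the error [21 * cmod z ^+ 2] in [cexp_taylor2] is at most
    [cmod z / 2]. *)
Lemma cexp_sub1_small z : cmod z <= 42^-1 -> cmod z / 2 <= cmod (cexp z - 1).
Proof.
move=> z1; have h := @cexp_taylor2 z (le_trans z1 _).
have := cmodBge z (- (cexp z - 1 - z)); rewrite cmodN (_ : z - - _ = cexp z - 1); last by ring.
by have := h ltac:(lra); have := cmod_ge0 z; nra.
Qed.

Lemma Im_half z : complex.Im (z / 2) = complex.Im z / 2.
Proof.
have {2}-> : z = z / 2 + z / 2 by field.
by case: (z / 2) => a b /=; lra.
Qed.

(** [cexp z - 1] is the product of [cexp (z / 2) - 1] and [cexp (z / 2) + 1]; in this
    strip [cexp (z / 2)] has nonnegative real part, so the second factor has modulus at
    least 1. *)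
Lemma cexp_sub1_half z : `|complex.Im z| <= pi -> cmod (cexp (z / 2) - 1) <= cmod (cexp z - 1).
Proof.
move=> zpi.
have zE : z = z / 2 + z / 2 by field.
rewrite [in leRHS]zE cexpD; set u := cexp _.
rewrite (_ : u * u - 1 = (u - 1) * (u + 1)); last by ring.
rewrite cmodM ler_peMr ?cmod_ge0//.
apply: le_trans (Re_cmod _); apply: le_trans (ler_norm _).
have -> : complex.Re (u + 1) = complex.Re u + 1 by case: (u).
rewrite lerDr /u /cexp.
rewrite Im_half.
have -> r w : complex.Re (ofR r * w) = r * complex.Re w.
  by case: w => a b; rewrite /= mul0r subr0.
rewrite mulr_ge0 ?expR_ge0//= cos_ge0_pihalf//.
by move: zpi; rewrite ler_norml; lra.
Qed.

(** Repeated halving brings [z] into the range of [cexp_sub1_small], each halving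
    costing a factor 2 by [cexp_sub1_half]. *)
Lemma cexp_sub1_lb (Y : R) : exists2 c : R, 0 < c & forall z,
  `|complex.Im z| <= pi -> cmod z <= Y -> c * cmod z <= cmod (cexp z - 1).
Proof.
pose k := Num.truncn (42 * Y).
have H n (z : C) : `|complex.Im z| <= pi -> cmod z <= 2 ^+ n / 42 -> (2 ^+ n.+1)^-1 * cmod z <= cmod (cexp z - 1).
  elim: n z => [|n IH] z hi hz.
    by rewrite mulrC expr1; apply: cexp_sub1_small; rewrite expr0 mul1r in hz.
  apply: le_trans (cexp_sub1_half hi).
  have -> : (2 ^+ n.+2)^-1 * cmod z = (2 ^+ n.+1)^-1 * cmod (z / 2).
    by rewrite cmodM cmodV cmod_nat [2 ^+ n.+2]exprS invfM; ring.
  apply: IH.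
    rewrite Im_half normrM [X in _ * X]ger0_norm; last by rewrite invr_ge0.
    by have := pi_gt0 R; have := normr_ge0 (complex.Im z); lra.
  rewrite cmodM cmodV cmod_nat; move: hz; rewrite exprS; lra.
exists (2 ^+ k.+2)^-1; first by rewrite invr_gt0 exprn_gt0.
move=> z hi hz; apply: H => //; apply: le_trans hz _.
rewrite ler_pdivlMr// mulrC.
apply: le_trans (ltW (truncnS_gt _)) _; rewrite -/k.
by rewrite -natrX ler_nat ltnW// ltn_expl.
Qed.

End ModulusExponential.

(** * Unconditional sums *)

Section UnconditionalSums.
Context {R : realType}.
Local Notation C := (Cplx R).
Implicit Types (z w : C) (x y : R).
Local Open Scope fset_scope.
Local Open Scope ring_scope.

(** The epsilon form of convergence along [summability.totally], with a modulus in
    [R]. *)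
Definition nlim (I : choiceType) (g : {fset I} -> C) (l : C) :=
  forall e : R, 0 < e -> exists A0, forall A, A0 `<=` A -> cmod (g A - l) <= e.

Definition hsum (I : choiceType) (f : I -> C) (l : C) :=
  nlim (fun A => \sum_(i <- A) f i) l.

Definition bsum (I : choiceType) (f : I -> R) :=
  exists B : R, forall A : {fset I}, \sum_(i <- A) `|f i| <= B.

Lemma ofR_natr n : (n%:R : C) = ofR n%:R.
Proof.
elim: n => // n IH; rewrite -!natr1 IH.
by apply/eqP; rewrite complex.eq_complex /= addr0 !eqxx.
Qed.

Lemma posCE (e : C) : 0 < e -> exists2 r : R, 0 < r & e = ofR r.
Proof.
case: e => a b; rewrite complex.ltcE /= => /andP[/eqP b0 a0]; exists a => //.
by rewrite b0.
Qed.

Lemma leCE (x y : R) : (ofR x <= ofR y :> C) = (x <= y).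
Proof. by rewrite complex.lecE /= eqxx. Qed.

Lemma ltCE (x y : R) : (ofR x < ofR y :> C) = (x < y).
Proof. by rewrite complex.ltcE /= eqxx. Qed.

Lemma nlim_cvg (I : choiceType) (g : {fset I} -> C) l :
  nlim g l -> g @ summability.totally --> l.
Proof.
move=> gl; have TF := @summability.totally_filter I.
apply/cvgrPdist_le => e /posCE[r r0 ->].
have [A0 HA] := gl r r0; exists A0 => // A /= A0A.
by rewrite normCE leCE cmod_distC HA.
Qed.

Lemma nlim_lim (I : choiceType) (g : {fset I} -> C) l :
  nlim g l -> lim (g @ summability.totally) = l.
Proof.
move=> gl; have TF := @summability.totally_filter I.
by apply: cvg_lim; [exact: norm_hausdorff|exact: nlim_cvg].
Qed.

Lemma hsum_sum (I : choiceType) (f : I -> C) l : hsum f l -> summability.sum f = l.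
Proof.
move=> h; rewrite /summability.sum; apply: nlim_lim => e e0.
have [A0 HA] := h e e0; exists A0 => A /HA.
by rewrite /summability.partial_sum -(big_seq_fsetE _ A xpredT).
Qed.

Lemma nlim_unique (I : choiceType) (g : {fset I} -> C) l l' :
  nlim g l -> nlim g l' -> l = l'.
Proof.
move=> gl gl'; apply/eqP; rewrite -subr_eq0 -cmod_eq0.
have := cmod_ge0 (l - l'); rewrite le_eqVlt => /orP[/eqP <- //|d0].
have e0 : 0 < cmod (l - l') / 3 by lra.
have [A HA] := gl _ e0; have [B HB] := gl' _ e0.
have hA := HA (A `|` B) (fsubsetUl _ _); have hB := HB (A `|` B) (fsubsetUr _ _).
have := cmodD (l - g (A `|` B)) (g (A `|` B) - l').
by rewrite addrA subrK (cmod_distC l); lra.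
Qed.

Definition hsum_unique (I : choiceType) (f : I -> C) l l' :
  hsum f l -> hsum f l' -> l = l' := @nlim_unique I _ l l'.

Lemma nlim_eq (I : choiceType) (g g' : {fset I} -> C) l :
  g =1 g' -> nlim g l -> nlim g' l.
Proof. by move=> E H e e0; have [A HA] := H e e0; exists A => B; rewrite -E; exact: HA. Qed.

Lemma hsum_eq (I : choiceType) (f f' : I -> C) l : f =1 f' -> hsum f l -> hsum f' l.
Proof. by move=> E; apply: nlim_eq => A; apply: eq_bigr => i _; rewrite E. Qed.

Lemma nlim_cst (I : choiceType) c : nlim (fun _ : {fset I} => c) c.
Proof. by move=> e e0; exists fset0 => A _; rewrite subrr cmod0 ltW. Qed.

Lemma nlimD (I : choiceType) (g g' : {fset I} -> C) l l' :
  nlim g l -> nlim g' l' -> nlim (fun A => g A + g' A) (l + l').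
Proof.
move=> H H' e e0; have e2 : 0 < e / 2 by lra.
have [A HA] := H _ e2; have [B HB] := H' _ e2; exists (A `|` B) => D.
rewrite fsubUset => /andP[/HA hA /HB hB].
rewrite opprD addrACA; apply: le_trans (cmodD _ _) _; lra.
Qed.

Lemma nlim_bounded (I : choiceType) (g : {fset I} -> C) l (B : R) :
  nlim g l -> (forall A, cmod (g A) <= B) -> cmod l <= B.
Proof.
move=> H HB; apply/ler_addgt0Pr => e e0; have [A HA] := H _ e0.
have := HA A (fsubset_refl _); have := HB A.
have := cmodD (g A) (l - g A); rewrite addrC subrK (cmod_distC l); lra.
Qed.

Lemma nlim_near (I : choiceType) (g : {fset I} -> C) l : nlim g l ->
  exists A0, forall A, A0 `<=` A -> cmod (g A) <= cmod l + 1.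
Proof.
move=> H; have [A HA] := H 1 ltr01; exists A => D /HA.
by have := cmodD (g D - l) l; rewrite subrK; lra.
Qed.

Lemma nlimM (I : choiceType) (g g' : {fset I} -> C) l l' :
  nlim g l -> nlim g' l' -> nlim (fun A => g A * g' A) (l * l').
Proof.
move=> H H' e e0; have [A0 HA0] := nlim_near H.
have n1 := cmod_ge0 l; have n2 := cmod_ge0 l'.
have k1 : 0 < cmod l + 1 by lra.
have k2 : 0 < cmod l' + 1 by lra.
have [A HA] := H (e / 2 / (cmod l' + 1)) ltac:(by rewrite !divr_gt0).
have [B HB] := H' (e / 2 / (cmod l + 1)) ltac:(by rewrite !divr_gt0).
exists (A0 `|` A `|` B) => D.
rewrite !fsubUset -andbA => /and3P[/HA0 h0 /HA hA /HB hB].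
rewrite (_ : _ - _ = g D * (g' D - l') + (g D - l) * l'); last by ring.
apply: le_trans (cmodD _ _) _; rewrite !cmodM.
have a1 : cmod (g D) * cmod (g' D - l') <= (cmod l + 1) * (e / 2 / (cmod l + 1)).
  by rewrite ler_pM ?cmod_ge0.
have a2 : cmod (g D - l) * cmod l' <= (e / 2 / (cmod l' + 1)) * (cmod l' + 1).
  by rewrite ler_pM ?cmod_ge0//; lra.
move: a1 a2; rewrite mulrCA divff ?gt_eqF// mulr1 mulrVK ?unitfE ?gt_eqF//; lra.
Qed.

Lemma hsumD (I : choiceType) (f f' : I -> C) l l' :
  hsum f l -> hsum f' l' -> hsum (fun i => f i + f' i) (l + l').
Proof.
by move=> H H'; apply: nlim_eq (nlimD H H') => A; rewrite big_split.
Qed.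

Lemma hsumZ (I : choiceType) (f : I -> C) l c :
  hsum f l -> hsum (fun i => c * f i) (c * l).
Proof.
by move=> H; apply: nlim_eq (nlimM (nlim_cst _ c) H) => A; rewrite mulr_sumr.
Qed.

Lemma hsumN (I : choiceType) (f : I -> C) l : hsum f l -> hsum (fun i => - f i) (- l).
Proof.
by move=> /(hsumZ (-1)); rewrite mulN1r; apply: hsum_eq => i; rewrite mulN1r.
Qed.

Lemma hsumB (I : choiceType) (f f' : I -> C) l l' :
  hsum f l -> hsum f' l' -> hsum (fun i => f i - f' i) (l - l').
Proof. by move=> H /hsumN; exact: hsumD. Qed.

Lemma hsum_fin (I : choiceType) (f : I -> C) (A : {fset I}) :
  (forall i, i \notin A -> f i = 0) -> hsum f (\sum_(i <- A) f i).
Proof.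
move=> H e e0; exists A => B AB; rewrite -(big_fset_incl _ AB) ?subrr ?cmod0 ?ltW//.
by move=> x _; exact: H.
Qed.

Lemma hsum0 (I : choiceType) : hsum (fun _ : I => 0 : C) 0.
Proof.
by have := @hsum_fin I (fun=> 0) fset0 (fun _ _ => erefl); rewrite big_seq_fset0.
Qed.

Lemma hsum_fint (I : finType) (f : I -> C) : hsum f (\sum_i f i).
Proof.
move=> e e0; exists [fset i | i in I]%fset => B AB.
suff -> : \sum_(i <- B) f i = \sum_i f i by rewrite subrr cmod0 ltW.
rewrite -[in RHS]big_enum /=; apply: perm_big; apply: uniq_perm.
- exact: fset_uniq.
- exact: enum_uniq.
by move=> i; rewrite mem_enum /=; apply: (fsubsetP AB); rewrite !inE.
Qed.

Lemma hsum_bigsum (I : choiceType) (J : Type) (s : seq J) (f : J -> I -> C) (l : J -> C) :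
  (forall j, hsum (f j) (l j)) ->
  hsum (fun i => \sum_(j <- s) f j i) (\sum_(j <- s) l j).
Proof.
move=> H; elim: s => [|j s IH].
  by rewrite big_nil; apply: hsum_eq (hsum0 _) => i; rewrite big_nil.
by rewrite big_cons; apply: hsum_eq (hsumD (H j) IH) => i; rewrite big_cons.
Qed.

Lemma bsum_sub (I : choiceType) (f : I -> R) (A B : {fset I}) : (forall i, 0 <= f i) ->
  A `<=` B -> \sum_(i <- A) f i <= \sum_(i <- B) f i.
Proof.
move=> f0 AB; rewrite [leRHS](big_fsetID _ (mem A)) /=.
rewrite [leLHS](_ : _ = \sum_(i <- [fset x in B | x \in A]) f i) ?lerDl ?sumr_ge0//.
by apply: eq_fbigl => i; rewrite !inE /= andb_idl// => /(fsubsetP AB).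
Qed.

Lemma bsum_le (I : choiceType) (f g : I -> R) :
  (forall i, `|f i| <= g i) -> bsum g -> bsum f.
Proof.
move=> fg [B HB]; exists B => A; apply: le_trans (HB A); apply: ler_sum => i _.
by apply: le_trans (fg i) _; exact: ler_norm.
Qed.

Lemma bsum_eq (I : choiceType) (f g : I -> R) : f =1 g -> bsum f -> bsum g.
Proof. by move=> fg [B HB]; exists B => A; under eq_bigr do rewrite -fg. Qed.

Lemma bsumZ (I : choiceType) (f : I -> R) c : bsum f -> bsum (fun i => c * f i).
Proof.
move=> [B HB]; exists (`|c| * B) => A.
by under eq_bigr do rewrite normrM; rewrite -mulr_sumr ler_wpM2l.
Qed.

Lemma bsumD (I : choiceType) (f g : I -> R) :
  bsum f -> bsum g -> bsum (fun i => f i + g i).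
Proof.
move=> [B HB] [D HD]; exists (B + D) => A.
apply: le_trans (_ : \sum_(i <- A) (`|f i| + `|g i|) <= _).
  by apply: ler_sum => i _; exact: ler_normD.
by rewrite big_split lerD.
Qed.

Lemma bsum_inj (I J : choiceType) (h : J -> I) (f : I -> R) :
  injective h -> bsum f -> bsum (fun j => f (h j)).
Proof.
move=> hi [B HB]; exists B => A; apply: le_trans (HB [fset h x | x in A]).
by rewrite big_imfset //= => x y _ _; exact: hi.
Qed.

Lemma bsum_prod (I J : choiceType) (f : I -> R) (g : J -> R) :
  bsum f -> bsum g -> bsum (fun p : I * J => f p.1 * g p.2).
Proof.
move=> [B HB] [D HD]; exists (B * D) => A.
pose A1 := [fset p.1 | p in A]; pose A2 := [fset p.2 | p in A].
apply: le_trans (_ : \sum_(i <- A1) \sum_(j <- A2) `|f i| * `|g j| <= _); last first.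
  under eq_bigr do rewrite -mulr_sumr.
  by rewrite -mulr_suml ler_pM// sumr_ge0.
rewrite pair_big_dep_cond /=.
under eq_bigr do rewrite normrM.
apply: (@bsum_sub _ (fun p => `|f p.1| * `|g p.2|)) => [p|]; first exact: mulr_ge0.
apply/fsubsetP => -[a b] pA; apply/imfset2P; exists a => /=.
  by rewrite !inE /= andbT; apply/imfsetP; exists (a, b).
by exists b => //; rewrite !inE /= andbT; apply/imfsetP; exists (a, b).
Qed.

(** The real and imaginary parts form Cauchy nets in the complete space [R]. *)
Lemma nlim_cauchy (I : choiceType) (g : {fset I} -> C) :
  (forall e : R, 0 < e -> exists A0, forall A, A0 `<=` A -> cmod (g A - g A0) <= e) ->
  exists l, nlim g l.
Proof.
move=> H; have TF := @summability.totally_filter I.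
have key (h : C -> R) : (forall z w, `|h z - h w| <= cmod (z - w)) ->
    exists r : R, forall e : R, 0 < e -> exists A0, forall A, A0 `<=` A -> `|h (g A) - r| <= e.
  move=> hl; have : cvg ((h \o g) @ summability.totally).
    apply: cauchy_cvg; apply: cauchy_exP => e e0.
    have e2 : 0 < e / 2 by lra.
    have [A0 HA] := H _ e2; exists (h (g A0)); exists A0 => // A /= /HA hA.
    rewrite /ball /= distrC; apply: le_lt_trans (hl _ _) _; lra.
  move=> /cvg_ex[r hr]; exists r => e e0.
  move/cvgrPdist_le: hr => /(_ e e0)[A0 _ HA]; exists A0 => A /HA /=.
  by rewrite distrC.
have [a Ha] := key (@complex.Re R) ltac:(by move=> z w; apply: le_trans (Re_cmod _); case: z; case: w).
have [b Hb] := key (@complex.Im R) ltac:(by move=> z w; apply: le_trans (Im_cmod _); case: z; case: w).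
exists (Complex a b : C) => e e0; have e2 : 0 < e / 2 by lra.
have [A HA] := Ha _ e2; have [B HB] := Hb _ e2; exists (A `|` B) => D.
rewrite fsubUset => /andP[/HA hA /HB hB]; apply: le_trans (cmod_ReIm _) _.
by case: (g D) hA hB => u v /=; lra.
Qed.

(** Take for [A0] a finite set whose sum is within [e] of the supremum of all finite
    sums. *)
Lemma bsum_tail (I : choiceType) (f : I -> R) : bsum f -> forall e : R, 0 < e ->
  exists A0, forall A, A0 `<=` A -> \sum_(i <- A `\` A0) `|f i| <= e.
Proof.
move=> [B HB] e e0.
pose S := [set \sum_(i <- A) `|f i| | A in [set: {fset I}]]%classic.
have hS : has_sup S.
  split; first by exists (\sum_(i <- fset0) `|f i|), fset0.
  by exists B => _ [A _ <-].
have [_ [A0 _ <-] hA] := sup_adherent e0 hS.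
exists A0 => A A0A; have : \sum_(i <- A) `|f i| <= sup S.
  by apply: ub_le_sup => //; [case: hS|exists A].
rewrite (big_fsetID _ (mem A0)) /=.
have -> : \sum_(i <- [fset x in A | x \in A0]) `|f i| = \sum_(i <- A0) `|f i|.
  by apply: eq_fbigl => i; rewrite !inE /= andb_idl// => /(fsubsetP A0A).
have -> : \sum_(i <- [fset x in A | x \notin A0]) `|f i| = \sum_(i <- A `\` A0) `|f i|.
  by apply: eq_fbigl => i; rewrite !inE /= andbC.
lra.
Qed.

Lemma fsum_split (I : choiceType) (V : zmodType) (f : I -> V) (A0 A : {fset I}) : A0 `<=` A ->
  \sum_(i <- A) f i - \sum_(i <- A0) f i = \sum_(i <- A `\` A0) f i.
Proof.
move=> A0A; rewrite (big_fsetID _ (mem A0)) /=.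
have -> : \sum_(i <- [fset x in A | x \in A0]) f i = \sum_(i <- A0) f i.
  by apply: eq_fbigl => i; rewrite !inE /= andb_idl// => /(fsubsetP A0A).
rewrite [X in X - _]addrC addrK.
by apply: eq_fbigl => i; rewrite !inE /= andbC.
Qed.

Lemma bsum_hsum (I : choiceType) (f : I -> C) :
  bsum (fun i => cmod (f i)) -> exists l, hsum f l.
Proof.
move=> /bsum_tail H; apply: nlim_cauchy => e /H[A0 HA]; exists A0 => A A0A.
rewrite fsum_split//; apply: le_trans (HA A A0A); apply: le_trans (cmod_sum _ _ _) _.
by apply: ler_sum => i _; exact: ler_norm.
Qed.

Lemma hsum_bounded (I : choiceType) (f : I -> C) l (B : R) :
  hsum f l -> (forall A : {fset I}, \sum_(i <- A) cmod (f i) <= B) -> cmod l <= B.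
Proof.
by move=> H HB; apply: nlim_bounded H _ => A; apply: le_trans (HB A); exact: cmod_sum.
Qed.

(** The terms outside the image of [h] vanish, so a finite subset of [I] can be replaced
    by its preimage and a finite subset of [J] by its image. *)
Lemma hsum_inj (I J : choiceType) (h : J -> I) (f : I -> C) l : injective h ->
  (forall i, ~ (exists j, h j = i) -> f i = 0) ->
  hsum f l <-> hsum (fun j => f (h j)) l.
Proof.
move=> hi f0; split => H e e0; have [A0 HA] := H _ e0.
  pose g i : option J := if pselect (exists j, h j = i) is left p then Some (projT1 (cid p)) else None.
  pose B0 := [fset j in pmap g A0].
  exists B0 => B B0B; have := HA (A0 `|` [fset h x | x in B]) (fsubsetUl _ _).
  rewrite -(@big_fset_incl _ _ _ _ [fset h x | x in B]) ?fsubsetUr//.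
    by rewrite big_imfset //= => x y _ _; exact: hi.
  move=> i; rewrite inE => /orP[iA iB|-> //].
  apply: f0 => -[j hj]; case/negP: iB; apply/imfsetP; exists j => //=.
  apply: (fsubsetP B0B); rewrite !inE /= mem_pmap; apply/mapP; exists i => //.
  rewrite /g; case: pselect => [p|[]]; last by exists j.
  by congr Some; apply: hi; rewrite hj; case: (cid p).
exists [fset h x | x in A0] => A hA.
pose g i : option J := if pselect (exists j, h j = i) is left p then Some (projT1 (cid p)) else None.
pose B := [fset j in pmap g A].
have gh j : g (h j) = Some j.
  rewrite /g; case: pselect => [p|[]]; last by exists j.
  by congr Some; apply: hi; case: (cid p).
have hg i j : g i = Some j -> h j = i.
  by rewrite /g; case: pselect => // p [<-]; case: (cid p).
have inB j : (j \in B) = (h j \in A).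
  rewrite !inE /= mem_pmap; apply/mapP/idP => [[i iA /esym/hg ->//]|hA'].
  by exists (h j); rewrite ?gh.
clearbody B; have A0B : A0 `<=` B.
  apply/fsubsetP => j jA; rewrite inB; apply: (fsubsetP hA).
  by apply/imfsetP; exists j.
have := HA B A0B; rewrite (_ : \sum_(i <- B) f (h i) = \sum_(i <- A) f i)//.
transitivity (\sum_(i <- [fset h x | x in B]) f i).
  by rewrite big_imfset //= => x y _ _; exact: hi.
apply: big_fset_incl => [|i iA iB].
  by apply/fsubsetP => _ /imfsetP[j /= jB ->]; rewrite -inB.
apply: f0 => -[j hj]; case/negP: iB; apply/imfsetP; exists j => //=.
by rewrite inB hj.
Qed.

Lemma hsum_bij (I J : choiceType) (h : J -> I) (f : I -> C) l : bijective h ->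
  hsum f l <-> hsum (fun j => f (h j)) l.
Proof.
move=> hb; apply: hsum_inj; first exact: bij_inj.
by case: hb => g _ gh i []; exists (g i).
Qed.

(** For finitely many rows [A1], one finite set of columns brings the double sum within
    [e / 2] of [l], and the row sums within [e / 2] of their limits altogether. *)
Lemma hsum_fubini (I J : choiceType) (f : I * J -> C) (r : I -> C) l :
  hsum f l -> (forall i, hsum (fun j => f (i, j)) (r i)) -> hsum r l.
Proof.
move=> H Hr e e0; have e2 : 0 < e / 2 by lra.
have [A0 HA] := H _ e2; exists [fset p.1 | p in A0] => A1 hA1.
pose n := #|` A1|; pose d := e / 2 / n.+1%:R.
have d0 : 0 < d by rewrite !divr_gt0.
pose Ji i := projT1 (cid (Hr i d d0)).
have HJ i B : Ji i `<=` B -> cmod (\sum_(j <- B) f (i, j) - r i) <= d.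
  by rewrite /Ji; case: (cid _) => /= ? h /h.
pose A2 := [fset p.2 | p in A0] `|` \bigcup_(i <- A1) Ji i.
have h1 : cmod (\sum_(i <- A1) \sum_(j <- A2) f (i, j) - l) <= e / 2.
  rewrite pair_big_dep_cond /=.
  rewrite (eq_bigr f) => [|[]//]; apply: HA.
  apply/fsubsetP => -[a b] pA; apply/imfset2P; exists a => /=.
    rewrite !inE /= andbT; apply: (fsubsetP hA1).
    by apply/imfsetP; exists (a, b).
  exists b => //; rewrite !inE /= andbT; apply/orP; left.
  by apply/imfsetP; exists (a, b).
have h2 : cmod (\sum_(i <- A1) r i - \sum_(i <- A1) \sum_(j <- A2) f (i, j)) <= e / 2.
  rewrite -sumrB; apply: le_trans (cmod_sum _ _ _) _.
  apply: le_trans (_ : \sum_(i <- A1) d <= _).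
    rewrite big_seq [leRHS]big_seq; apply: ler_sum => i iA; rewrite cmod_distC; apply: HJ.
    apply: fsubset_trans (fsubsetUr _ _).
    exact: (bigfcup_sup _ iA).
  rewrite big_const_seq iter_addr_0 count_predT -/n.
  have -> : d *+ n = (e / 2) * n%:R / n.+1%:R by rewrite -mulr_natr /d; ring.
  by rewrite ler_pdivrMr// ler_wpM2l ?(ltW e2)// ler_nat.
have := cmodD (\sum_(i <- A1) r i - \sum_(i <- A1) \sum_(j <- A2) f (i, j)) (\sum_(i <- A1) \sum_(j <- A2) f (i, j) - l).
by rewrite addrA subrK; lra.
Qed.

End UnconditionalSums.

(** * Sums over the integers and over the lattice *)

Section IntegerSums.
Context {R : realType}.
Local Notation C := (Cplx R).
Implicit Types (z w : C) (x y : R).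
Local Open Scope fset_scope.
Local Open Scope ring_scope.

Definition absR (m : int) : R := (absz m)%:R.

Lemma absR_ge0 m : 0 <= absR m. Proof. exact: ler0n. Qed.
Lemma absRE m : absR m = `|m%:~R|.
Proof. by rewrite /absR -intr_norm -abszE. Qed.

Lemma absRD m n : absR (m + n) <= absR m + absR n.
Proof. by rewrite !absRE rmorphD ler_normD. Qed.

Lemma absRN m : absR (- m) = absR m.
Proof. by rewrite /absR abszN. Qed.

Lemma bsum_nat (f : nat -> R) (B : R) : (forall k, 0 <= f k) ->
  (forall N, \sum_(0 <= k < N) f k <= B) -> bsum f.
Proof.
move=> f0 HB; exists B => A.
have [N hN] : exists N, forall k, k \in A -> (k < N)%N.
  exists (\max_(k <- A) k).+1 => k kA; rewrite ltnS.
  by rewrite (big_fsetD1 k)//= leq_maxl.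
apply: le_trans (HB N).
have -> : \sum_(0 <= k < N) f k = \sum_(k <- [fset k in iota 0 N]) f k.
  rewrite /index_iota subn0; apply: perm_big; apply: uniq_perm; rewrite ?iota_uniq ?fset_uniq//.
  by move=> k; rewrite !inE.
apply: le_trans (_ : \sum_(k <- A) f k <= _).
  by apply: ler_sum => i _; rewrite ger0_norm.
apply: bsum_sub => //; apply/fsubsetP => k /hN kN; rewrite !inE /= mem_iota.
by rewrite add0n.
Qed.

Lemma bsum_int (f : int -> R) :
  bsum (fun k => f (Posz k)) -> bsum (fun k => f (Negz k)) -> bsum f.
Proof.
move=> [B HB] [D HD]; exists (B + D) => A.
pose gp (m : int) := if m is Posz k then Some k else None.
pose gn (m : int) := if m is Negz k then Some k else None.
have Pi : injective Posz by move=> ? ? [].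
have Ni : injective Negz by move=> ? ? [].
pose AP := [fset k in pmap gp A]; pose AN := [fset k in pmap gn A].
apply: le_trans (lerD (HB AP) (HD AN)).
have -> : \sum_(k <- AP) `|f (Posz k)| = \sum_(m <- [fset Posz k | k in AP]) `|f m|.
  by rewrite [RHS]big_imfset// => ? ? _ _; exact: Pi.
have -> : \sum_(k <- AN) `|f (Negz k)| = \sum_(m <- [fset Negz k | k in AN]) `|f m|.
  by rewrite [RHS]big_imfset// => ? ? _ _; exact: Ni.
rewrite (big_fsetID _ (fun m => if m is Posz _ then true else false)).
apply: lerD; apply: (@bsum_sub _ _ (fun m => `|f m|)) => //; apply/fsubsetP => -[k|k];
  rewrite !inE /= ?andbT ?andbF// => kA; apply/imfsetP; exists k => //=;
  rewrite !inE /= mem_pmap; apply/mapP; by [exists (Posz k)|exists (Negz k)].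
Qed.

(** Telescoping: the term at [k] is at most 4 times the difference of [(k + 1)^(-1/2)]
    and [(k + 2)^(-1/2)]. *)
Lemma bsum_nat_32 : bsum (fun k : nat => ((1 + k%:R) * Num.sqrt (1 + k%:R) : R)^-1).
Proof.
apply: (@bsum_nat _ 4) => [k|N].
  by rewrite invr_ge0 mulr_ge0 ?sqrtr_ge0// addr_ge0.
suff : \sum_(0 <= k < N) ((1 + k%:R) * Num.sqrt (1 + k%:R) : R)^-1 <= 4 * (1 - (Num.sqrt (1 + N%:R))^-1).
  have : 0 <= (Num.sqrt (1 + N%:R))^-1 :> R by rewrite invr_ge0 sqrtr_ge0.
  lra.
elim: N => [|N IH]; first by rewrite big_geq// addr0 sqrtr1 invr1 subrr mulr0.
rewrite big_nat_recr//= (_ : 1 + N.+1%:R = 1 + (N%:R + 1) :> R); last by rewrite natr1.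
have h1 : 0 < 1 + N%:R :> R by rewrite ltr_pwDl.
have h2 : 0 < 1 + (N%:R + 1) :> R by lra.
have a2 := sqr_sqrtr (ltW h1); have b2 := sqr_sqrtr (ltW h2).
have a0 : 0 < Num.sqrt (1 + N%:R : R) by rewrite sqrtr_gt0.
have b0 : 0 < Num.sqrt (1 + (N%:R + 1) : R) by rewrite sqrtr_gt0.
move: IH a2 b2 a0 b0.
have n1 : 1 <= 1 + N%:R :> R by rewrite lerDl.
move: (Num.sqrt (1 + N%:R)) (Num.sqrt (1 + (N%:R + 1))) => a b IH a2 b2 a0 b0.
apply: le_trans (lerD IH (lexx _)) _; rewrite -a2.
suff : (a ^+ 2 * a)^-1 <= 4 * (a^-1 - b^-1) by lra.
rewrite (_ : a^-1 - b^-1 = (b - a) / (a * b)); last by field; rewrite !gt_eqF.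
have ba : (b - a) * (b + a) = 1 by rewrite -subr_sqr a2 b2; ring.
have -> : b - a = (b + a)^-1 by apply: (mulIf (_ : b + a != 0)); rewrite ?ba ?mulVf// gt_eqF// addr_gt0.
rewrite -invfM -[4]invrK -invfM lef_pV2 ?posrE; last 2 first.
- by rewrite !mulr_gt0.
- by rewrite !mulr_gt0// ?invr_gt0 ?addr_gt0.
have h : (b + a) * b <= 4 * a ^+ 2 by have := sqr_ge0 (b - a); nra.
by have := ler_wpM2r (ltW a0) h; lra.
Qed.

Lemma bsum_int_32 : bsum (fun m : int => ((1 + absR m) * Num.sqrt (1 + absR m) : R)^-1).
Proof.
apply: bsum_int; first exact: bsum_nat_32.
by apply: (bsum_inj (h := S)) bsum_nat_32 => ? ? [].
Qed.

Lemma bsum_int_2 : bsum (fun m : int => ((1 + absR m) ^+ 2 : R)^-1).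
Proof.
apply: bsum_le bsum_int_32 => m; have a0 := absR_ge0 m.
rewrite ger0_norm ?invr_ge0 ?exprn_ge0 ?addr_ge0//.
have h : 0 < 1 + absR m by rewrite ltr_pwDl.
have s0 : 0 < Num.sqrt (1 + absR m) by rewrite sqrtr_gt0.
have s2 := sqr_sqrtr (ltW h).
rewrite lef_pV2 ?posrE ?mulr_gt0 ?exprn_gt0// expr2 ler_pM2l//.
by nra.
Qed.

(** The term at [(m, n)] is at most [(1 + |m|)^(-3/2) (1 + |n|)^(-3/2)], as
    [(1 + |m|) (1 + |n|) <= (1 + |m| + |n|)^2]. *)
Lemma bsum_lattice : bsum (fun w : int * int => ((1 + absR w.1 + absR w.2) ^+ 3 : R)^-1).
Proof.
apply: bsum_le (bsum_prod bsum_int_32 bsum_int_32) => -[m n] /=.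
have := absR_ge0 m; have := absR_ge0 n; move: (absR m) (absR n) => a b b0 a0.
rewrite ger0_norm ?invr_ge0 ?exprn_ge0 ?addr_ge0//.
have h1 : 0 < 1 + a by lra.
have h2 : 0 < 1 + b by lra.
have h3 : 0 < 1 + a + b by lra.
have s10 : 0 < Num.sqrt (1 + a) by rewrite sqrtr_gt0.
have s20 : 0 < Num.sqrt (1 + b) by rewrite sqrtr_gt0.
have s1 := sqr_sqrtr (ltW h1).
have s2 := sqr_sqrtr (ltW h2).
rewrite -invfM lef_pV2 ?posrE ?mulr_gt0 ?exprn_gt0//.
move: (Num.sqrt _) (Num.sqrt _) s10 s20 s1 s2 => s t s10 s20 s1 s2.
have st : s * t <= 1 + a + b by nra.
rewrite mulrACA exprSr ler_pM ?mulr_ge0//; nra.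
Qed.

Lemma hsum_shift (f : int -> C) l a : hsum f l -> hsum (fun n => f (n + a)) l.
Proof.
apply: (hsum_bij (h := fun n => n + a) f l _).1.
by exists (fun n => n - a) => n; rewrite ?addrK ?subrK.
Qed.

Lemma hsum_opp (f : int -> C) l : hsum f l -> hsum (fun n => f (- n)) l.
Proof.
by apply: (hsum_bij (h := fun n => - n) f l _).1; exists (fun n => - n) => n; rewrite opprK.
Qed.

Lemma hsum_odd (f : int -> C) l : hsum f l -> (forall m, f (- m) = - f m) -> l = 0.
Proof.
move=> H Hf; have H1 := hsum_opp H.
have H2 : hsum (fun n => f (- n)) (- l) by apply: hsum_eq (hsumN H) => n; rewrite Hf.
by have /eqP := hsum_unique H1 H2; rewrite -addr_eq0 -mulr2n mulrn_eq0 => /eqP.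
Qed.

Lemma hsum_mul (I J : choiceType) (e : I -> C) (e' : J -> C) a b :
  hsum e a -> hsum e' b -> bsum (fun i => cmod (e i)) -> bsum (fun i => cmod (e' i)) ->
  hsum (fun p : I * J => e p.1 * e' p.2) (a * b).
Proof.
move=> Ha Hb Ba Bb.
have [l Hl] := @bsum_hsum _ _ (fun p : I * J => e p.1 * e' p.2) (bsum_eq (fun p => esym (cmodM _ _)) (bsum_prod Ba Bb)).
suff <- : l = a * b by [].
have H2 : hsum (fun i => e i * b) l.
  by apply: hsum_fubini Hl _ => i; exact: (hsumZ (e i) Hb).
apply: hsum_unique H2 _; rewrite mulrC; apply: hsum_eq (hsumZ b Ha) => i.
by rewrite mulrC.
Qed.

(** Fubini for the function on [J * I] supported on the graph of [h]. *)
Lemma hsum_fiber (I J : choiceType) (h : I -> J) (f : I -> C) l (r : J -> C) :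
  hsum f l -> (forall j, hsum (fun i => if h i == j then f i else 0) (r j)) -> hsum r l.
Proof.
move=> H Hr; pose F (p : J * I) := if h p.2 == p.1 then f p.2 else 0.
apply: (@hsum_fubini _ _ _ F) => //.
apply/(@hsum_inj _ _ _ (fun i => (h i, i))) => [? ? []//|[j i] /= nE|].
  by rewrite /F /=; case: eqP => // E; case: nE; exists i; rewrite E.
by apply: hsum_eq H => i; rewrite /F /= eqxx.
Qed.

(** Euclidean division by [p] is a bijection between [int] and [int * 'I_p]. *)
Lemma hsum_splitp p (f : int -> C) l : (0 < p)%N -> hsum f l ->
  hsum (fun m : int => \sum_(j < p) f (m * p%:Z + j%:Z)) l.
Proof.
move=> p0 H; pose h (x : int * 'I_p) := x.1 * p%:Z + (x.2 : nat)%:Z.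
apply: (@hsum_fubini _ _ _ (fun x : int * 'I_p => f (h x))); last by move=> i; exact: hsum_fint.
apply: (hsum_bij (h := h) f l _).1 => //.
have pz : (p%:Z != 0 :> int) by rewrite eqz_nat -lt0n.
have mp (m : int) : (absz (m %% p%:Z)%Z < p)%N.
  by rewrite -ltz_nat abszE ger0_norm ?modz_ge0 ?ltz_pmod.
exists (fun m => ((m %/ p%:Z)%Z, Ordinal (mp m))) => [[m i]|m]; rewrite /h /=.
  congr pair.
    by rewrite divzDl ?dvdz_mull// mulzK// divz_small ?addr0//= ltz_nat ltn_ord.
  by apply: val_inj; rewrite /= modzMDl modz_small//= ltz_nat ltn_ord.
by rewrite abszE ger0_norm ?modz_ge0// -divz_eq.
Qed.

Lemma hsum_nat_cvg (f : nat -> C) l : hsum f l ->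
  (fun n => \sum_(0 <= k < n) f k) @ \oo --> l.
Proof.
move=> H; apply/cvgrPdist_le => e /posCE[r r0 ->].
have [A0 HA] := H r r0.
exists (\max_(k <- A0) k).+1 => // n /= hn.
rewrite normCE leCE cmod_distC.
have -> : \sum_(0 <= k < n) f k = \sum_(k <- [fset k in iota 0 n]) f k.
  rewrite /index_iota subn0; apply: perm_big; apply: uniq_perm; rewrite ?iota_uniq ?fset_uniq//.
  by move=> k; rewrite !inE.
apply: HA; apply/fsubsetP => k kA; rewrite !inE /= mem_iota add0n.
apply: leq_trans hn; rewrite ltnS.
by rewrite (big_fsetD1 k)//= leq_maxl.
Qed.

Lemma hsum_int_pos (f : int -> C) l : hsum f l ->
  hsum (fun k : nat => f (k.+1%:Z) + f (- k.+1%:Z)) (l - f 0).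
Proof.
move=> H.
have H0 : hsum (fun m : int => if m == 0 then f m else 0) (f 0).
  have := @hsum_fin _ _ (fun m : int => if m == 0 then f m else 0) [fset 0].
  by rewrite big_seq_fset1 eqxx; apply => i; rewrite inE; case: eqP.
have H1 := hsumB H H0.
pose h (x : nat * bool) : int := if x.2 then x.1.+1%:Z else - x.1.+1%:Z.
apply: (@hsum_fubini _ _ _ (fun x : nat * bool => f (h x))); last first.
  by move=> i; have := hsum_fint (fun b => f (h (i, b))); rewrite big_bool.
apply: hsum_eq ((hsum_inj (h := h) (f := fun m => f m - (if m == 0 then f m else 0)) _ _ _).1 H1).
- by move=> [k []]; rewrite /h /= ?oppr_eq0 /= subr0.
- by move=> [k []] [k' []]; rewrite /h /=; (try by case=> ->); move=> E; exfalso; lia.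
move=> i hi; case: eqP => [_|/eqP i0]; first by rewrite subrr.
case: hi; case: i i0 => [[|k] // _|k _]; first by exists (k, true).
by exists (k, false); rewrite /h /= NegzE.
Qed.

(** Up to the factor [- pi i], signs are the limits of pi cot (pi z) far up and far down
    in the plane; they serve to regularise series of cotangents. *)
Definition sgC (m : int) : C := (sgz m)%:~R.

Lemma sgCN m : sgC (- m) = - sgC m. Proof. by rewrite /sgC sgzN rmorphN. Qed.
Lemma cmod_sgC m : cmod (sgC m) <= 1.
Proof.
by rewrite /sgC; case: sgzP => _; rewrite ?cmod0 ?cmod1// mulrN1z cmodN cmod1.
Qed.

Lemma sgC_same m n : (absz m < absz n)%N -> sgC (m + n) = sgC n.
Proof.
move=> h; rewrite /sgC; congr (_%:~R).
have [n0|n0|n0] := sgzP n; first by lia.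
- by rewrite gtr0_sgz//; lia.
- by rewrite ltr0_sgz//; lia.
Qed.

Lemma hsum_sgC1 : hsum (fun n => sgC n - sgC (n + 1)) (- 2).
Proof.
have := @hsum_fin _ _ (fun n : int => sgC n - sgC (n + 1)) [fset 0; -1].
rewrite big_fsetU1 ?inE//= big_seq_fset1 addNr add0r /sgC /= sgz0 sgz1 sgzN1.
rewrite (_ : - 1%:~R + ((-1)%:~R - 0%:~R) = - 2 :> C); last by rewrite mulrN1z; ring.
apply => n; rewrite !inE negb_or => /andP[n0 n1]; apply/eqP; rewrite subr_eq0 /sgC; apply/eqP; congr (_%:~R).
have [n2|n2|n2] := sgzP n.
- by move: n0; rewrite n2 eqxx.
- by rewrite gtr0_sgz//; lia.
- by rewrite ltr0_sgz//; lia.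
Qed.

Lemma hsum_sgC1M : hsum (fun n : int => n%:~R * (sgC n - sgC (n + 1))) 1.
Proof.
have := @hsum_fin _ _ (fun n : int => n%:~R * (sgC n - sgC (n + 1))) [fset 0; -1].
rewrite big_fsetU1 ?inE//= big_seq_fset1 addNr add0r /sgC /= sgz0 sgz1 sgzN1.
rewrite (_ : 0%:~R * - 1%:~R + (-1)%:~R * ((-1)%:~R - 0%:~R) = 1 :> C); last by rewrite mulrN1z mulr0z mulr1z; ring.
apply => n; rewrite !inE negb_or => /andP[n0 n1]; apply/eqP; rewrite mulf_eq0 subr_eq0 /sgC; apply/orP; right; apply/eqP; congr (_%:~R).
have [n2|n2|n2] := sgzP n.
- by move: n0; rewrite n2 eqxx.
- by rewrite gtr0_sgz//; lia.
- by rewrite ltr0_sgz//; lia.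
Qed.

(** For [m > 0] the difference is [- 2] at the [m - 1] integers strictly between [- m]
    and 0, and [- 1] at [- m] and at 0. *)
Lemma hsum_sgC m : hsum (fun n => sgC n - sgC (m + n)) (- (2 * m%:~R)).
Proof.
have H1 k : hsum (fun n => sgC n - sgC (k%:Z + n)) (- (2 * k%:~R)).
  elim: k => [|k IH].
    rewrite mulr0 oppr0; apply: hsum_eq (hsum0 _) => n.
    by rewrite add0r subrr.
  have := hsumD IH (hsum_shift k%:Z hsum_sgC1).
  rewrite (_ : _ + _ = - (2 * k.+1%:~R)); last by rewrite intS rmorphD /=; ring.
  apply: hsum_eq => n; rewrite (_ : k.+1%:Z + n = n + k%:Z + 1); last by lia.
  by rewrite [k%:Z + n]addrC; ring.
case: m => k; first exact: H1.
have := hsumN (hsum_opp (H1 k.+1)).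
rewrite NegzE rmorphN /= mulrN => h; apply: hsum_eq h => n.
by rewrite sgCN (_ : - k.+1%:Z + n = - (k.+1%:Z - n)) ?sgCN; ring.
Qed.

Lemma in_fset_seq (T : choiceType) (s : seq T) i : (i \in [fset m in s]) = (i \in s).
Proof. by rewrite !inE. Qed.

(** The sum over the integers from [- N] to [N] is [u N - u (- N - 1)], which tends to
    0. *)
Lemma hsum_telescope (u : int -> C) l (K : R) :
  (forall n, cmod (u n) <= K / (1 + absR n)) -> hsum (fun n => u n - u (n - 1)) l -> l = 0.
Proof.
move=> uK H; apply/eqP; rewrite -cmod_eq0; apply/eqP/le_anti; rewrite cmod_ge0 andbT.
apply/ler_addgt0Pr => e e0; rewrite add0r.
have e2 : 0 < e / 2 by lra.
have [A0 HA] := H _ e2.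
have [N hN] : exists N, forall k, k \in A0 -> (absz k <= N)%N.
  exists (\max_(k <- A0) absz k) => k kA.
  by rewrite (big_fsetD1 k)//= leq_maxl.
pose N' := maxn N (Num.truncn (4 * `|K| / e)).
pose A := [fset m in [seq i%:Z - N'%:Z | i <- iota 0 (N'.*2.+1)]].
have A0A : A0 `<=` A.
  apply/fsubsetP => k /hN kN; rewrite in_fset_seq; apply/mapP.
  by exists (absz (k + N'%:Z)); [rewrite mem_iota|]; rewrite /N'; lia.
have SA : \sum_(i <- A) (u i - u (i - 1)) = u N'%:Z - u (- N'.+1%:Z).
  have -> : \sum_(i <- A) (u i - u (i - 1)) = \sum_(i <- [seq i%:Z - N'%:Z | i <- iota 0 (N'.*2.+1)]) (u i - u (i - 1)).
    apply: perm_big; apply: uniq_perm; rewrite ?fset_uniq ?map_inj_uniq ?iota_uniq//.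
      by move=> i j; lia.
    by move=> i; rewrite in_fset_seq.
  rewrite big_map -[iota 0 _](_ : index_iota 0 N'.*2.+1 = _); last by rewrite /index_iota subn0.
  rewrite (telescope_sumr_eq (fun i : nat => u (i%:Z - N'%:Z - 1)))//.
    by congr (u _ - u _); lia.
  by move=> i _; congr (u _ - u _); lia.
have := HA A A0A; rewrite SA => h.
have K0 : 0 <= K.
  by have := uK 0; rewrite /absR addr0 divr1; exact: le_trans (cmod_ge0 _).
have bd n : (N' <= absz n)%N -> cmod (u n) <= e / 4.
  move=> hn; apply: le_trans (uK n) _.
  rewrite ler_pdivrMr ?ltr_pwDl ?absR_ge0//.
  have : 4 * `|K| / e < 1 + absR n.
    apply: lt_le_trans (truncnS_gt _) _; rewrite -natr1 addrC lerD2l /absR ler_nat.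
    by apply: leq_trans hn; exact: leq_maxr.
  by rewrite ltr_pdivrMr// ger0_norm//; lra.
have b1 := bd N'%:Z (leqnn _).
have b2 := bd (- N'.+1%:Z) ltac:(lia).
have := cmodB (u N'%:Z) (u (- N'.+1%:Z)).
have := cmodD (l - (u N'%:Z - u (- N'.+1%:Z))) (u N'%:Z - u (- N'.+1%:Z)).
by rewrite subrK (cmod_distC l); lra.
Qed.

End IntegerSums.

(** * The function pi cot (pi z) *)

Section Cotangent.
Context {R : realType}.
Local Notation C := (Cplx R).
Local Notation piC := (@piC R).
Local Notation iC := (@iC R).
Implicit Types (z w : C) (x y : R).

Definition tpi : C := 2 * piC * iC.
Definition e2pi z : C := cexp (tpi * z).

(** This is pi cot (pi z). *)
Definition eis1 z : C := piC * iC * (e2pi z + 1) / (e2pi z - 1).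
Definition isint z := exists n : int, z = n%:~R.

Lemma iC2 : iC ^+ 2 = -1.
Proof. by apply/eqP; rewrite expr2 complex.eq_complex /=; apply/andP; split; apply/eqP; ring. Qed.

Lemma cmod_piC : cmod piC = pi. Proof. by rewrite cmod_ofR ger0_norm// pi_ge0. Qed.
Lemma cmod_iC : cmod iC = 1. Proof. by rewrite /cmod /= expr0n add0r expr1n sqrtr1. Qed.
Lemma piC_neq0 : piC != 0. Proof. by rewrite -cmod_gt0 cmod_piC pi_gt0. Qed.
Lemma iC_neq0 : iC != 0. Proof. by rewrite -cmod_gt0 cmod_iC. Qed.
Lemma cmod_tpi : cmod tpi = 2 * pi.
Proof. by rewrite !cmodM cmod_nat cmod_piC cmod_iC mulr1. Qed.

Lemma tpi_neq0 : tpi != 0.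
Proof. by rewrite !mulf_neq0 ?pnatr_eq0 ?piC_neq0 ?iC_neq0. Qed.

Lemma tpiE z : complex.Re (tpi * z) = - (2 * pi * complex.Im z) /\
  complex.Im (tpi * z) = 2 * pi * complex.Re z.
Proof.
have -> : tpi = Complex 0 (2 * pi).
  rewrite /tpi ofR_natr -ofRM; apply/eqP; rewrite complex.eq_complex /=.
  by apply/andP; split; apply/eqP; ring.
by case: z => a b /=; rewrite !mul0r sub0r add0r.
Qed.

Lemma e2piD z w : e2pi (z + w) = e2pi z * e2pi w.
Proof. by rewrite /e2pi mulrDr cexpD. Qed.

Lemma e2pi_neq0 z : e2pi z != 0. Proof. exact: cexp_neq0. Qed.
Lemma e2piN z : e2pi (- z) = (e2pi z)^-1.
Proof. by rewrite /e2pi mulrN cexpN. Qed.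

Lemma cmod_e2pi z : cmod (e2pi z) = expR (- (2 * pi * complex.Im z)).
Proof. by rewrite /e2pi cmod_cexp (tpiE z).1. Qed.

Lemma e2pi_nat n z : e2pi (n%:R * z) = e2pi z ^+ n.
Proof. by rewrite -cexpM_nat /e2pi; congr cexp; ring. Qed.

Lemma e2pi1 : e2pi 1 = 1.
Proof.
rewrite /e2pi /cexp !(tpiE 1).1 !(tpiE 1).2 /= mulr0 oppr0 expR0 mulr1.
rewrite mulr_natl cos2pi sin2pi; apply/eqP; rewrite complex.eq_complex /=.
by apply/andP; split; apply/eqP; ring.
Qed.

Lemma e2pi_int n : e2pi n%:~R = 1.
Proof.
have h (k : nat) : e2pi k%:R = 1 by rewrite -[k%:R]mulr1 e2pi_nat e2pi1 expr1n.
by case: n => k; rewrite ?NegzE ?rmorphN /= ?e2piN h ?invr1.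
Qed.

Lemma e2pi_addint z n : e2pi (z + n%:~R) = e2pi z.
Proof. by rewrite e2piD e2pi_int mulr1. Qed.

Lemma Re_int (n : int) : complex.Re (n%:~R : C) = n%:~R /\ complex.Im (n%:~R : C) = 0.
Proof.
have h (k : nat) : (k%:R : C) = Complex k%:R 0 by rewrite ofR_natr.
by case: n => k; rewrite ?NegzE ?mulrNz -?pmulrn h //= ?oppr0.
Qed.

Lemma Re_add z w : complex.Re (z + w) = complex.Re z + complex.Re w.
Proof. by case: z; case: w. Qed.

Lemma Im_add z w : complex.Im (z + w) = complex.Im z + complex.Im w.
Proof. by case: z; case: w. Qed.

Lemma Re_opp z : complex.Re (- z) = - complex.Re z. Proof. by case: z. Qed.
Lemma Im_opp z : complex.Im (- z) = - complex.Im z. Proof. by case: z. Qed.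
Lemma strip_red z : exists n : int, `|complex.Re (z - n%:~R)| <= 2^-1.
Proof.
exists (Num.floor (complex.Re z + 2^-1)).
rewrite Re_add Re_opp (Re_int _).1.
have /andP[] := floor_itv (complex.Re z + 2^-1).
by rewrite rmorphD /= ler_norml; lra.
Qed.

Lemma strip_lb Y : exists2 c : R, 0 < c & forall z,
  `|complex.Re z| <= 2^-1 -> cmod z <= Y -> c * cmod z <= cmod (e2pi z - 1).
Proof.
have [c c0 H] := cexp_sub1_lb (2 * pi * Y); exists (c * (2 * pi)).
  by rewrite !mulr_gt0 ?pi_gt0.
have p0 := pi_gt0 R.
move=> z hz zY; rewrite -mulrA -cmod_tpi -cmodM; apply: H.
  rewrite (tpiE z).2 normrM ger0_norm; last by rewrite mulr_ge0 ?(ltW p0).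
  by nra.
by rewrite cmodM cmod_tpi ler_pM2l// mulr_gt0.
Qed.

(** A translation by an integer brings [z] into the strip, where [strip_lb] leaves only
    the point 0. *)
Lemma e2pi_eq1 z : e2pi z = 1 <-> isint z.
Proof.
split=> [h|[n ->]]; last exact: e2pi_int.
have [n hn] := strip_red z; exists n.
have [c c0 H] := strip_lb (cmod (z - n%:~R)).
have := H _ hn (lexx _).
rewrite -rmorphN e2pi_addint h subrr cmod0 => hh.
apply/eqP; rewrite -subr_eq0 -cmod_eq0.
have := cmod_ge0 (z - n%:~R); rewrite rmorphN /= in hh; nra.
Qed.

Lemma e2pi_neq1 z : ~ isint z -> e2pi z - 1 != 0.
Proof. by rewrite subr_eq0 => h; apply/eqP => /e2pi_eq1. Qed.

Lemma isint_add z n : isint (z + n%:~R) <-> isint z.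
Proof.
split=> -[k hk].
  by exists (k - n); rewrite rmorphB /= -hk addrK.
by exists (k + n); rewrite rmorphD /= -hk.
Qed.

Lemma isint_opp z : isint (- z) <-> isint z.
Proof.
split=> -[k hk]; exists (- k); rewrite rmorphN /=; first by rewrite -hk opprK.
by rewrite hk.
Qed.

Lemma eis1N z : eis1 (- z) = - eis1 z.
Proof.
rewrite /eis1 e2piN; have [->|h] := eqVneq (e2pi z) 1; first by rewrite invr1 subrr invr0 !mulr0 oppr0.
have e0 := e2pi_neq0 z; field.
by rewrite mulN1r !subr_eq0 e0 h eq_sym h.
Qed.

Lemma eis1_addint z n : eis1 (z + n%:~R) = eis1 z.
Proof. by rewrite /eis1 e2pi_addint. Qed.

(** Both sides are rational functions of [e2pi a] and [e2pi b]. *)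
Lemma eis1_add a b : ~ isint a -> ~ isint b -> ~ isint (a + b) ->
  eis1 a * eis1 b = piC ^+ 2 + eis1 (a + b) * (eis1 a + eis1 b).
Proof.
move=> /e2pi_neq1 ha /e2pi_neq1 hb /e2pi_neq1; rewrite /eis1 e2piD => hab.
move: (e2pi a) (e2pi b) ha hb hab => u v ha hb hab.
have -> : piC * iC * (u + 1) / (u - 1) * (piC * iC * (v + 1) / (v - 1)) =
  - (piC ^+ 2 * ((u + 1) / (u - 1)) * ((v + 1) / (v - 1))).
  rewrite -[RHS]mulN1r -iC2; ring.
have -> : piC * iC * (u * v + 1) / (u * v - 1) *
 (piC * iC * (u + 1) / (u - 1) + piC * iC * (v + 1) / (v - 1)) =
  - (piC ^+ 2 * ((u * v + 1) / (u * v - 1)) * ((u + 1) / (u - 1) + (v + 1) / (v - 1))).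
  rewrite -[RHS]mulN1r -iC2; ring.
by field; rewrite ha hb.
Qed.

(** With [w] a primitive [p]-th root of unity and [u = e2pi z], the fraction
    [(u^p - 1) / (w^j u - 1)] is a geometric sum; summation over [j] leaves only the power
    [w^0]. *)
Lemma eis1_dist p z : (0 < p)%N -> ~ isint (p%:R * z) ->
  \sum_(j < p) eis1 (z + j%:R / p%:R) = p%:R * eis1 (p%:R * z).
Proof.
move=> p0 /e2pi_neq1; rewrite e2pi_nat => hz.
have pn : (p%:R : C) != 0 by rewrite pnatr_eq0 -lt0n.
pose w : C := e2pi (p%:R^-1).
have wp : w ^+ p = 1 by rewrite -e2pi_nat divff// e2pi1.
have wk k : (0 < k < p)%N -> w ^+ k != 1.
  move=> /andP[k0 kp]; rewrite -e2pi_nat; apply/eqP => /e2pi_eq1 [n hn].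
  have : (k%:R : C) = (n * p%:Z)%:~R by rewrite rmorphM /= -hn divfK.
  move=> /(congr1 (@complex.Re R)).
  rewrite (Re_int _).1 -[k%:R](_ : k%:Z%:~R = _)// (Re_int _).1 => /intr_inj E.
  have : (p %| k)%N by rewrite -[k]/(absz k%:Z) E abszM dvdn_mull.
  by move=> /(dvdn_leq k0); rewrite leqNgt kp.
set u := e2pi z in hz *.
have uj j : e2pi (z + j%:R / p%:R) = w ^+ j * u by rewrite e2piD e2pi_nat mulrC.
have wj j : (w ^+ j * u) ^+ p = u ^+ p by rewrite exprMn exprAC wp expr1n mul1r.
have h1 (j : 'I_p) : eis1 (z + j%:R / p%:R) =
   piC * iC * (1 + 2 / (u ^+ p - 1) * \sum_(k < p) (w ^+ k) ^+ j * u ^+ k).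
  rewrite /eis1 uj.
  have := subrX1 (w ^+ j * u) p; rewrite wj => E.
  have h0 : w ^+ j * u - 1 != 0 by apply: contraNneq hz => E0; rewrite E E0 mul0r.
  have -> : \sum_(k < p) (w ^+ k) ^+ j * u ^+ k = (u ^+ p - 1) / (w ^+ j * u - 1).
    rewrite E mulrAC divff// mul1r; apply: eq_bigr => k _.
    by rewrite [RHS]exprMn [in RHS]exprAC.
  by field; rewrite h0 hz.
rewrite (eq_bigr _ (fun j _ => h1 j)) -mulr_sumr big_split /= -mulr_sumr sumr_const card_ord.
rewrite exchange_big /=.
have -> : \sum_(k < p) \sum_(j < p) (w ^+ k) ^+ j * u ^+ k = p%:R.
  rewrite (bigD1 (Ordinal p0))//= [X in _ + X]big1 => [|k k0].
    rewrite addr0 (eq_bigr (fun=> 1)) ?sumr_const ?card_ord// => j _.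
    by rewrite /= !expr0 expr1n mul1r.
  rewrite -mulr_suml; apply/eqP; rewrite mulf_eq0; apply/orP; left.
  have := subrX1 (w ^+ k) p; rewrite exprAC wp expr1n subrr => /esym/eqP.
  rewrite mulf_eq0 subr_eq0 => /orP[|//]; rewrite (negPf (wk k _))//.
  rewrite ltn_ord andbT lt0n; apply: contraNneq k0 => h.
  by apply/eqP/val_inj.
by rewrite /eis1 e2pi_nat -/u; field.
Qed.

(** With [v = 2 pi i z], the difference is [pi i (v (e^v + 1) - 2 (e^v - 1)) / (v (e^v -
    1))]. The numerator is [O(v^3)] and the denominator is bounded below by [strip_lb]. *)
Lemma eis1_strip Y : exists K : R, forall z,
  `|complex.Re z| <= 2^-1 -> cmod z <= Y -> z != 0 -> cmod (eis1 z - z^-1) <= K * cmod z.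
Proof.
have [c c0 H] := strip_lb Y; have p0 := pi_gt0 R.
pose V := 2 * pi * Y.
pose K0 := 100 + (V + 2) * (expR V + 1).
exists (pi * K0 * (2 * pi) ^+ 2 / c) => z hz zY z0.
have := H z hz zY; have [v vD] : exists v, v = tpi * z by exists (tpi * z).
have exv : e2pi z = cexp v by rewrite vD.
have vE : cmod v = 2 * pi * cmod z by rewrite vD cmodM cmod_tpi.
have z0' : 0 < cmod z by rewrite cmod_gt0.
have v0 : 0 < cmod v by rewrite vE !mulr_gt0.
have v0' : v != 0 by rewrite -cmod_gt0.
have vV : cmod v <= V by rewrite vE ler_pM2l// mulr_gt0.
move=> lb; have e1 : e2pi z - 1 != 0.
  by rewrite -cmod_gt0; apply: lt_le_trans lb; rewrite mulr_gt0.
have -> : eis1 z - z^-1 = piC * iC * (v * (e2pi z + 1) - 2 * (e2pi z - 1)) / (v * (e2pi z - 1)).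
  by rewrite /eis1 vD /tpi; field; rewrite iC_neq0 piC_neq0 e1 z0.
have bN : cmod (v * (e2pi z + 1) - 2 * (e2pi z - 1)) <= K0 * cmod v ^+ 3.
  have [v1|v1] := leP (cmod v) 1.
    have h := cexp_taylor v1; rewrite -exv in h.
    rewrite (_ : _ - _ = (v - 2) * (e2pi z - 1 - v - v ^+ 2 / 2) + v ^+ 3 / 2); last by field.
    apply: le_trans (cmodD _ _) _; rewrite [cmod ((v - 2) * _)]cmodM [cmod (v ^+ 3 / 2)]cmodM cmodX cmodV cmod_nat.
    have := cmodB v 2; rewrite cmod_nat => h2.
    have := ler_pM (cmod_ge0 _) (cmod_ge0 _) h2 h.
    have : 0 <= (V + 2) * (expR V + 1).
      by rewrite mulr_ge0 ?addr_ge0 ?expR_ge0//; lra.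
    have : 0 <= cmod v ^+ 3 by rewrite exprn_ge0 ?cmod_ge0.
    rewrite /K0; nra.
  have ev : cmod (e2pi z) <= expR V.
    rewrite exv cmod_cexp ler_expR; apply: le_trans vV.
    by apply: le_trans (ler_norm _) (Re_cmod _).
  have v3 : 1 <= cmod v ^+ 3 by rewrite exprn_ege1// ltW.
  apply: le_trans (_ : K0 <= _); last first.
    rewrite -[leLHS]mulr1 ler_wpM2l// /K0 addr_ge0// mulr_ge0 ?addr_ge0 ?expR_ge0//; lra.
  apply: le_trans (cmodB _ _) _; rewrite !cmodM cmod_nat.
  have := cmodD (e2pi z) 1; have := cmodB (e2pi z) 1; rewrite cmod1 => a1 a2.
  have h1 : cmod v * cmod (e2pi z + 1) <= V * (expR V + 1) by rewrite ler_pM ?cmod_ge0//; lra.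
  by rewrite /K0; lra.
rewrite !cmodM cmodV !cmodM cmod_piC cmod_iC mulr1.
rewrite ler_pdivrMr; last by rewrite mulr_gt0// cmod_gt0.
apply: le_trans (ler_wpM2l (ltW p0) bN) _.
have : cmod v * (c * cmod z) <= cmod v * cmod (e2pi z - 1) by rewrite ler_pM2l.
have K00 : 0 <= pi * K0 * (2 * pi) ^+ 2 / c * cmod z.
  rewrite mulr_ge0 ?cmod_ge0// divr_ge0 ?(ltW c0)// !mulr_ge0 ?(ltW p0)//.
  rewrite /K0 addr_ge0// mulr_ge0 ?addr_ge0 ?expR_ge0//; lra.
move=> /(ler_wpM2l K00); apply: le_trans.
rewrite le_eqVlt; apply/orP; left; apply/eqP; rewrite vE; field.
by rewrite gt_eqF.
Qed.

End Cotangent.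

(** * Functions satisfying a duplication formula *)

Section Duplication.
Context {R : realType}.
Local Notation C := (Cplx R).
Local Notation piC := (@piC R).
Local Notation iC := (@iC R).
Implicit Types (z w : C) (x y : R).

(** [eis1], [eis2] and [eis3] are the closed forms of the sums of [(z + n)^-k] over the
    integers, see [eis1_sum], [eis2_sum] and [eis3_sum]. *)
Definition eis2 z : C := eis1 z ^+ 2 + piC ^+ 2.
Definition eis3 z : C := eis1 z * eis2 z.

Lemma isint_half z : isint (z / 2) -> isint z.
Proof.
by move=> [n h]; exists (n + n); rewrite rmorphD /= -h; field.
Qed.

Lemma isint_half1 z : isint ((z + 1) / 2) -> isint z.
Proof.
by move=> [n h]; exists (n + n - 1); rewrite rmorphB rmorphD /= -h; field.
Qed.

Lemma isint_halfP : ~ isint (2^-1 : C).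
Proof.
move=> [n hn]; have : (1 : C) = (n * 2)%:~R by rewrite rmorphM /= -hn mulVf// pnatr_eq0.
move=> /(congr1 (@complex.Re R)); rewrite (Re_int _).1 -[complex.Re 1](_ : 1%:~R = _)//.
by move=> /intr_inj; lia.
Qed.

Lemma eis1_half : eis1 (2^-1 : C) = 0.
Proof.
have : eis1 (2^-1 : C) = - eis1 (2^-1 : C).
  by rewrite -eis1N -(eis1_addint (- _) 1); congr eis1; field.
by move=> /eqP; rewrite -addr_eq0 -mulr2n mulrn_eq0 => /eqP.
Qed.

Lemma eis1_dbl z : ~ isint z -> eis1 (z / 2) + eis1 ((z + 1) / 2) = 2 * eis1 z.
Proof.
move=> hz; have E : 2 * (z / 2) = z by field.
have := @eis1_dist R 2 (z / 2) isT; rewrite E => /(_ hz) <-.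
by rewrite !big_ord_recr big_ord0 /= add0r mul0r addr0 mulrDl.
Qed.

(** The addition law at [z / 2] and [1 / 2], as [eis1 (1 / 2) = 0]. *)
Lemma eis1_half_mul z : ~ isint z -> eis1 (z / 2) * eis1 ((z + 1) / 2) = - piC ^+ 2.
Proof.
move=> hz; have := @eis1_add R (z / 2) 2^-1.
rewrite eis1_half mulr0 addr0 (_ : z / 2 + 2^-1 = (z + 1) / 2); last by field.
move=> H.
have := H (fun h => hz (isint_half h)) isint_halfP (fun h => hz (isint_half1 h)).
by rewrite [eis1 ((z + 1) / 2) * _]mulrC => /esym/eqP; rewrite addrC addr_eq0 => /eqP.
Qed.

Lemma eis2_dbl z : ~ isint z -> eis2 (z / 2) + eis2 ((z + 1) / 2) = 2 ^+ 2 * eis2 z.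
Proof.
move=> hz; have := eis1_dbl hz; have := eis1_half_mul hz; rewrite /eis2.
move: (eis1 (z / 2)) (eis1 ((z + 1) / 2)) => a b ab s.
transitivity ((a + b) ^+ 2 - 2 * (a * b) + 2 * piC ^+ 2); first by ring.
by rewrite ab s; ring.
Qed.

Lemma eis3_dbl z : ~ isint z -> eis3 (z / 2) + eis3 ((z + 1) / 2) = 2 ^+ 3 * eis3 z.
Proof.
move=> hz; have := eis1_dbl hz; have := eis1_half_mul hz; rewrite /eis3 /eis2.
move: (eis1 (z / 2)) (eis1 ((z + 1) / 2)) => a b ab s.
transitivity ((a + b) ^+ 3 - 3 * (a * b) * (a + b) + piC ^+ 2 * (a + b)); first by ring.
by rewrite ab s; ring.
Qed.

Definition in_strip (Y : R) z := [/\ `|complex.Re z| <= 2^-1, cmod z <= Y & z != 0].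

Lemma Re_half z : complex.Re (z / 2) = complex.Re z / 2.
Proof.
have {2}-> : z = z / 2 + z / 2 by field.
by case: (z / 2) => a b /=; lra.
Qed.

Lemma in_strip_half Y z : in_strip Y z -> in_strip Y (z / 2).
Proof.
move=> [h1 h2 h3]; split.
- by rewrite Re_half; move: h1; rewrite !ler_norml; lra.
- by rewrite cmodM cmodV cmod_nat; have := cmod_ge0 z; lra.
- by rewrite mulf_neq0// invr_eq0 pnatr_eq0.
Qed.

Lemma cmod_addint z : 0 <= complex.Re z + 2^-1 -> cmod z <= cmod (z + 1).
Proof.
case: z => a b /= h; rewrite /cmod /= ler_wsqrtr// addr0 lerD2r; nra.
Qed.

(** The sign of the real part of [z] decides which of [(z + 1) / 2] and [(z - 1) / 2]
    lies in the strip; since [|Re z| <= 1 / 2], neither is shorter than [z / 2]. *)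
Lemma in_strip_half1 Y z : 1 <= Y -> in_strip Y z -> exists w, [/\ in_strip Y w, cmod z / 2 <= cmod w &
  exists n : int, w = (z + 1) / 2 + n%:~R].
Proof.
move=> Y1 [h1 h2 h3].
have [z0|z0] := leP (complex.Re z) 0.
  have hb : cmod z <= cmod (z + 1) by apply: cmod_addint; move: h1; rewrite ler_norml; lra.
  exists ((z + 1) / 2); split; last by exists 0; rewrite addr0.
    split.
    - by rewrite Re_half Re_add /=; move: h1; rewrite !ler_norml; lra.
    - rewrite cmodM cmodV cmod_nat; have := cmodD z 1; rewrite cmod1; lra.
    - rewrite -cmod_gt0 cmodM cmodV cmod_nat divr_gt0//; apply: lt_le_trans hb.
      by rewrite cmod_gt0.
  by rewrite cmodM cmodV cmod_nat ler_pM2r// invr_gt0.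
have hb : cmod z <= cmod (z - 1).
  rewrite cmod_distC -(cmodN z) addrC; apply: cmod_addint; rewrite Re_opp.
  by move: h1; rewrite ler_norml; lra.
exists ((z - 1) / 2); split; last by exists (-1); rewrite rmorphN /=; field.
  split.
  - by rewrite Re_half Re_add Re_opp /=; move: h1; rewrite !ler_norml; lra.
  - rewrite cmodM cmodV cmod_nat; have := cmodB z 1; rewrite cmod1; lra.
  - rewrite -cmod_gt0 cmodM cmodV cmod_nat divr_gt0//; apply: lt_le_trans hb.
    by rewrite cmod_gt0.
by rewrite cmodM cmodV cmod_nat ler_pM2r// invr_gt0.
Qed.

Lemma le_geom0 (x M : R) : (forall k, x * 2 ^+ k <= M) -> x <= 0.
Proof.
move=> H; rewrite leNgt; apply/negP => x0.
have := H (Num.truncn (M / x)).+1; rewrite leNgt => /negP; apply.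
rewrite mulrC -ltr_pdivrMr//; apply: lt_le_trans (truncnS_gt _) _.
by rewrite -natrX ler_nat ltnW// ltn_expl.
Qed.

Lemma isint_in_strip Y z : in_strip Y z -> ~ isint z.
Proof.
move=> [h _ z0] [n hn]; move: h z0; rewrite hn (Re_int n).1 intr_eq0.
rewrite ler_norml => /andP[h1 h2] n0.
have h1' : -1 < n%:~R :> R by lra.
have h2' : n%:~R < 1 :> R by lra.
move: h1' h2'; rewrite -[-1](_ : (-1)%:~R = _)// -[1](_ : 1%:~R = _)// !ltr_int; lia.
Qed.

Lemma in_strip_reduce z : ~ isint z -> exists Y, 1 <= Y /\ exists n : int, in_strip Y (z - n%:~R).
Proof.
move=> hz; have [n hn] := strip_red z; exists (cmod (z - n%:~R) + 1); split.
  by have := cmod_ge0 (z - n%:~R); lra.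
exists n; split=> //; first lra.
by rewrite subr_eq0; apply/eqP => h; apply: hz; exists n.
Qed.

Section Doubling.
Variables (h : C -> C) (j : nat).
Hypothesis per : forall z (n : int), h (z + n%:~R) = h z.
Hypothesis dbl : forall z, ~ isint z -> h (z / 2) + h ((z + 1) / 2) = 2 ^+ j * h z.

(** If [|h z| <= M / |z|^i] in the strip, the duplication formula gives the same bound
    with [M] replaced by [2^(1 + i - j) M], that is at most [M / 2]; iterate. *)
Lemma doubling_zero i : (i.+2 <= j)%N ->
  (forall Y, exists M, forall z, in_strip Y z -> cmod (h z) * cmod z ^+ i <= M) ->
  forall z, ~ isint z -> h z = 0.
Proof.
move=> ij bd z hz; have [Y [Y1 [n dz]]] := in_strip_reduce hz.
rewrite -[z](subrK n%:~R) per; move: (z - _) dz => {hz n}z dz.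
have [M HM] := bd Y.
have HMk k w : in_strip Y w -> cmod (h w) * cmod w ^+ i * 2 ^+ k <= M.
  elim: k w => [|k IH] w dw; first by rewrite expr0 mulr1 HM.
  have [w' [dw' ww' [n wE]]] := in_strip_half1 Y1 dw.
  have := dbl (isint_in_strip dw); rewrite -(per ((w + 1) / 2) n) -wE => E.
  have h1 := IH _ (in_strip_half dw); have h2 := IH _ dw'.
  rewrite cmodM cmodV cmod_nat in h1.
  have w20 : 0 <= cmod w / 2 by rewrite divr_ge0 ?cmod_ge0.
  have h2' : cmod (h w') * (cmod w / 2) ^+ i * 2 ^+ k <= M.
    apply: le_trans h2; rewrite ler_wpM2r ?exprn_ge0// ler_wpM2l ?cmod_ge0//.
    by rewrite lerXn2r// nnegrE ?cmod_ge0.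
  have := cmodD (h (w / 2)) (h w'); rewrite E cmodM cmodX cmod_nat => tri.
  have T : 2 ^+ j * cmod (h w) * (cmod w / 2) ^+ i * 2 ^+ k <= 2 * M.
    apply: le_trans (_ : (cmod (h (w / 2)) + cmod (h w')) * (cmod w / 2) ^+ i * 2 ^+ k <= _).
      by rewrite ler_wpM2r ?exprn_ge0// ler_wpM2r ?exprn_ge0.
    by rewrite !mulrDl; lra.
  have : 2 ^+ i.+2 * cmod (h w) * (cmod w / 2) ^+ i * 2 ^+ k <= 2 * M.
    apply: le_trans T; rewrite ler_wpM2r ?exprn_ge0// ler_wpM2r ?exprn_ge0//.
    by rewrite ler_wpM2r ?cmod_ge0// ler_eXn2l ?ltr1n.
  have -> : 2 ^+ i.+2 * cmod (h w) * (cmod w / 2) ^+ i * 2 ^+ k = 2 * (cmod (h w) * cmod w ^+ i * 2 ^+ k.+1).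
    by rewrite expr_div_n !exprS; field; rewrite expf_neq0// pnatr_eq0.
  by rewrite ler_pM2l.
have := le_geom0 (fun k => HMk k z dz).
have z0 : 0 < cmod z by rewrite cmod_gt0; case: dz.
rewrite pmulr_lle0 ?exprn_gt0// => h0.
by apply/eqP; rewrite -cmod_eq0; apply/eqP/le_anti; rewrite h0 cmod_ge0.
Qed.

(** For [j = 1] the duplication formula alone does not improve a bound of [h], but
    halving the argument does, as [h z = O(|z|)]. With [S] the supremum of [|h|], [k]
    halvings give [|h w| <= A |w| / 4^k + (1 - 2^-k) S], whence [S <= 2^-k A Y] for all
    [k]. *)
Lemma doubling_zero1 : j = 1%N ->
  (forall Y, exists A, forall z, in_strip Y z -> cmod (h z) <= A * cmod z) ->
  forall z, ~ isint z -> h z = 0.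
Proof.
move=> j1 bd z hz; have [Y [Y1 [n dz]]] := in_strip_reduce hz.
rewrite -[z](subrK n%:~R) per; move: (z - _) dz => {hz n}z dz.
have [A HA] := bd Y.
have A0 : 0 <= A.
  have := le_trans (cmod_ge0 _) (HA _ dz); rewrite pmulr_lge0// cmod_gt0.
  by case: dz.
have HY w : in_strip Y w -> cmod (h w) <= A * Y.
  by move=> dw; apply: le_trans (HA _ dw) _; rewrite ler_wpM2l//; case: dw.
pose S := [set cmod (h w) | w in in_strip Y].
have hS : has_sup S.
  by split; [exists (cmod (h z)), z|exists (A * Y) => _ [w dw <-]; exact: HY].
have leS w : in_strip Y w -> cmod (h w) <= sup S.
  by move=> dw; apply: ub_le_sup; [case: hS|exists w].
have M0 : 0 <= sup S by apply: le_trans (leS _ dz); exact: cmod_ge0.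
have step k w : in_strip Y w -> cmod (h w) <= A * cmod w / (2 ^+ k) ^+ 2 + (1 - (2 ^+ k)^-1) * sup S.
  elim: k w => [|k IH] w dw; first by rewrite expr0 expr1n divr1 invr1 subrr mul0r addr0 HA.
  have [w' [dw' ww' [n wE]]] := in_strip_half1 Y1 dw.
  have := dbl (isint_in_strip dw); rewrite -(per ((w + 1) / 2) n) -wE j1 expr1 => E.
  have h1 := IH _ (in_strip_half dw); have h2 := leS _ dw'.
  have := cmodD (h (w / 2)) (h w'); rewrite E cmodM cmod_nat => tri.
  have t0 : 2 ^+ k != 0 :> R by rewrite expf_neq0// pnatr_eq0.
  move: h1; rewrite cmodM cmodV cmod_nat [2 ^+ k.+1]exprS.
  move: (2 ^+ k) t0 => t t0.
  rewrite (_ : A * (cmod w / 2) / t ^+ 2 = A * cmod w / t ^+ 2 / 2); last by field.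
  rewrite (_ : A * cmod w / (2 * t) ^+ 2 = A * cmod w / t ^+ 2 / 4); last by field.
  rewrite (_ : (2 * t)^-1 = t^-1 / 2); last by field.
  move: (A * cmod w / t ^+ 2) (t^-1) => a b; lra.
have lek k : sup S <= A * Y / (2 ^+ k) ^+ 2 + (1 - (2 ^+ k)^-1) * sup S.
  apply: ge_sup => [|_ [w dw <-]]; first by case: hS.
  apply: le_trans (step k w dw) _; rewrite lerD2r ler_wpM2r ?invr_ge0 ?exprn_ge0//.
  by rewrite ler_wpM2l//; case: dw.
have hk k : sup S * 2 ^+ k <= A * Y.
  have := lek k; have t0 : 0 < 2 ^+ k :> R by rewrite exprn_gt0.
  rewrite -exprVn => h1.
  rewrite -(@ler_pM2r _ ((2 ^+ k)^-1 ^+ 2)) ?exprn_gt0 ?invr_gt0//.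
  rewrite (_ : sup S * 2 ^+ k * (2 ^+ k)^-1 ^+ 2 = sup S * (2 ^+ k)^-1); last by field; rewrite gt_eqF.
  by move: h1; move: ((2 ^+ k)^-1) => u; lra.
have S0 := le_geom0 hk.
apply/eqP; rewrite -cmod_eq0; apply/eqP/le_anti; rewrite cmod_ge0 andbT.
by apply: le_trans (leS _ dz) S0.
Qed.

End Doubling.

End Duplication.

(** * Partial fractions of the cotangent *)

Section PartialFractions.
Context {R : realType}.
Local Notation C := (Cplx R).
Local Notation piC := (@piC R).
Local Notation iC := (@iC R).
Implicit Types (z w : C) (x y : R).

Lemma cmod_int (n : int) : cmod (n%:~R : C) = absR n.
Proof.
by case: n => k; rewrite ?NegzE ?mulrNz ?cmodN -?pmulrn cmod_nat /absR ?abszN.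
Qed.

Lemma absR_ge1 (n : int) : n != 0 -> 1 <= absR n :> R.
Proof. by move=> n0; rewrite /absR ler1n absz_gt0. Qed.

Lemma strip_far z n : `|complex.Re z| <= 2^-1 -> n != 0 -> (1 + absR n) / 4 <= cmod (z + n%:~R).
Proof.
move=> h n0; apply: le_trans (Re_cmod _); rewrite Re_add (Re_int n).1.
have := lerB_normD (n%:~R : R) (complex.Re z); rewrite [_ + complex.Re z]addrC -absRE.
by have := absR_ge1 n0; lra.
Qed.

Lemma int_far z : ~ isint z -> exists2 c : R, 0 < c & forall n, c * (1 + absR n) <= cmod (z + n%:~R).
Proof.
move=> hz; have [Y [_ [k [h1 _ h3]]]] := in_strip_reduce hz.
set z0 := z - k%:~R in h1 h3; have z00 : 0 < cmod z0 by rewrite cmod_gt0.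
pose c0 := Num.min (4^-1) (cmod z0).
have c00 : 0 < c0 by rewrite lt_min z00 andbT invr_gt0.
have k0 : 0 < 1 + absR k :> R by rewrite ltr_pwDl ?absR_ge0.
exists (c0 / (1 + absR k)); first by rewrite divr_gt0.
move=> n; have -> : z + n%:~R = z0 + (n + k)%:~R by rewrite /z0 rmorphD /=; ring.
have hh : c0 * (1 + absR (n + k)) <= cmod (z0 + (n + k)%:~R).
  have [->|nk] := eqVneq (n + k) 0.
    by rewrite /absR !addr0 mulr1 ge_min lexx orbT.
  apply: le_trans (strip_far h1 nk); rewrite mulrC; apply: ler_wpM2l.
    by rewrite addr_ge0 ?absR_ge0.
  by rewrite ge_min lexx.
apply: le_trans hh; rewrite -mulrA ler_pM2l// mulrC ler_pdivrMr//.
have := @absRD R (n + k) (- k); rewrite addrK absRN.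
have := @absR_ge0 R (n + k); have := @absR_ge0 R k; nra.
Qed.

Definition term1 z (n : int) : C := (z + n%:~R)^-1 - (n%:~R)^-1.
Definition tsum z := summability.sum (term1 z).
Definition sumk (k : nat) z := summability.sum (fun n : int => ((z + n%:~R) ^+ k)^-1).

Lemma hsumE (I : choiceType) (f : I -> C) l : hsum f l -> hsum f (summability.sum f).
Proof. by move=> h; rewrite (hsum_sum h). Qed.

Lemma bsum_hsumE (I : choiceType) (f : I -> C) :
  bsum (fun i => cmod (f i)) -> hsum f (summability.sum f).
Proof. by move=> /bsum_hsum [l /hsumE]. Qed.

Lemma bsum_sumk k z : (1 < k)%N -> ~ isint z ->
  bsum (fun n : int => cmod (((z + n%:~R) ^+ k)^-1)).
Proof.
move=> k1 /int_far [c c0 H].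
apply: bsum_le (bsumZ ((c ^+ k)^-1) bsum_int_2) => n.
rewrite ger0_norm ?cmod_ge0// cmodV cmodX -invfM.
have a1 : 1 <= 1 + absR n :> R by rewrite lerDl absR_ge0.
have a0 : 0 < 1 + absR n :> R by exact: lt_le_trans a1.
have p0 : 0 < cmod (z + n%:~R) by apply: lt_le_trans (H n); rewrite mulr_gt0.
rewrite lef_pV2 ?posrE ?mulr_gt0 ?exprn_gt0//.
apply: le_trans (_ : c ^+ k * (1 + absR n) ^+ k <= _).
  by rewrite ler_pM2l ?exprn_gt0// ler_weXn2l.
by rewrite -exprMn lerXn2r// nnegrE ?cmod_ge0// mulr_ge0 ?(ltW c0) ?(ltW a0).
Qed.

Lemma hsum_sumk k z : (1 < k)%N -> ~ isint z ->
  hsum (fun n : int => ((z + n%:~R) ^+ k)^-1) (sumk k z).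
Proof. by move=> k1 hz; apply: bsum_hsumE; exact: bsum_sumk. Qed.

Lemma term1E z n : ~ isint z -> n != 0 -> term1 z n = - z / (n%:~R * (z + n%:~R)).
Proof.
move=> hz n0; rewrite /term1; field; rewrite intr_eq0 n0 andbT.
by apply/eqP => h; apply: hz; exists (- n); rewrite rmorphN /=; apply/eqP; rewrite -addr_eq0 h.
Qed.

Lemma bsum_term1 z : ~ isint z -> bsum (fun n : int => cmod (term1 z n)).
Proof.
move=> hz; have [c c0 H] := int_far hz.
apply: bsum_le (bsumZ (2 * cmod z / c + cmod z^-1) bsum_int_2) => n.
rewrite ger0_norm ?cmod_ge0//.
have [->|n0] := eqVneq n 0.
  rewrite /term1 mulr0z invr0 subr0 addr0 /absR addr0 expr1n invr1 mulr1 lerDr.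
  by rewrite divr_ge0 ?mulr_ge0 ?cmod_ge0// ltW.
rewrite term1E// cmodM cmodV cmodM cmodN cmod_int.
have a1 := absR_ge1 n0.
have p0 : 0 < c * (1 + absR n) by rewrite mulr_gt0//; lra.
apply: le_trans (_ : cmod z * ((1 + absR n) / 2 * (c * (1 + absR n)))^-1 <= _).
  rewrite ler_wpM2l ?cmod_ge0// lef_pV2 ?posrE.
  - apply: ler_pM => //; [lra|exact: ltW|lra].
  - by rewrite mulr_gt0//; [lra|exact: lt_le_trans (H n)].
  - by rewrite mulr_gt0//; lra.
rewrite [leRHS]mulrDl (_ : cmod z * ((1 + absR n) / 2 * (c * (1 + absR n)))^-1 = 2 * cmod z / c * ((1 + absR n) ^+ 2)^-1).
  by rewrite lerDl mulr_ge0 ?cmod_ge0// invr_ge0 exprn_ge0//; lra.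
by field; rewrite !gt_eqF//; lra.
Qed.

Lemma hsum_term1 z : ~ isint z -> hsum (term1 z) (tsum z).
Proof. by move=> hz; apply: bsum_hsumE; exact: bsum_term1. Qed.

Lemma sumk_per k z (n : int) : (1 < k)%N -> ~ isint z -> sumk k (z + n%:~R) = sumk k z.
Proof.
move=> k1 hz; apply: hsum_unique (hsum_sumk k1 _) _; first by move=> /isint_add.
apply: hsum_eq (hsum_shift n (hsum_sumk k1 hz)) => m.
by rewrite rmorphD /= addrA addrAC.
Qed.

Lemma sumk_dbl k z : (1 < k)%N -> ~ isint z ->
  sumk k (z / 2) + sumk k ((z + 1) / 2) = 2 ^+ k * sumk k z.
Proof.
move=> k1 hz.
have h1 := hsum_sumk k1 (fun h => hz (isint_half h)).
have h2 := hsum_sumk k1 (fun h => hz (isint_half1 h)).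
apply: hsum_unique (hsumD h1 h2) _.
apply: hsum_eq (hsumZ (2 ^+ k) (hsum_splitp (p := 2) isT (hsum_sumk k1 hz))) => m.
rewrite !big_ord_recr big_ord0 /= add0r mulrDr -!exprVn -!exprMn.
have H a b : (a : C) = 2 * b -> 2 * a^-1 = b^-1 by move=> ->; rewrite invfM mulrA divff ?pnatr_eq0// mul1r.
by congr (_ ^+ _ + _ ^+ _); apply: H; rewrite !rmorphD rmorphM /=; field.
Qed.

Lemma tsum_per1 z : ~ isint z -> tsum (z + 1) = tsum z.
Proof.
move=> hz; have hz1 : ~ isint (z + 1) by move=> /(isint_add z 1).
have [c c0 H] := int_far hz1.
apply/eqP; rewrite -subr_eq0; apply/eqP.
apply: (@hsum_telescope R (fun n : int => (z + 1 + n%:~R)^-1) _ c^-1).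
  move=> n; have a0 : 0 < 1 + absR n :> R by rewrite ltr_pwDl ?absR_ge0.
  rewrite cmodV -invfM lef_pV2 ?posrE ?mulr_gt0//.
  by apply: lt_le_trans (H n); rewrite mulr_gt0.
apply: hsum_eq (hsumB (hsum_term1 hz1) (hsum_term1 hz)) => n.
rewrite /term1 opprB addrA subrK rmorphB /=; congr (_ - _^-1); ring.
Qed.

Lemma tsum_per z (n : int) : ~ isint z -> tsum (z + n%:~R) = tsum z.
Proof.
move=> hz; have h (k : nat) w : ~ isint w -> tsum (w + k%:~R) = tsum w.
  move=> hw; elim: k => [|k IH]; first by rewrite addr0.
  rewrite intS rmorphD /= addrA addrAC tsum_per1 ?IH//.
  by move=> /isint_add.
case: n => k; first exact: h.
rewrite -[in RHS](subrK (k.+1%:~R) z) h ?NegzE ?rmorphN//.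
by rewrite -rmorphN => /isint_add.
Qed.

Lemma tsumN z : ~ isint z -> tsum (- z) = - tsum z.
Proof.
move=> hz; have hz1 : ~ isint (- z) by move=> /isint_opp.
apply: hsum_unique (hsum_term1 hz1) _.
apply: hsum_eq (hsumN (hsum_opp (hsum_term1 hz))) => n.
rewrite /term1 rmorphN /= (_ : - z + n%:~R = - (z - n%:~R)); last by ring.
by rewrite !invrN; ring.
Qed.

(** Splitting the sum by parity gives the formula up to a constant independent of [z];
    the constant vanishes because all terms are odd in [z]. *)
Lemma tsum_dbl z : ~ isint z -> tsum (z / 2) + tsum ((z + 1) / 2) = 2 * tsum z.
Proof.
(* [ka] collects the terms [1 / n] of both sides, the part independent of [z]. *)
pose ka (m : int) : C := (m%:~R)^-1 - ((m * 2)%:~R)^-1 - ((m * 2 + 1)%:~R)^-1.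
have Hk w : ~ isint w -> hsum ka (tsum w - 2^-1 * (tsum (w / 2) + tsum ((w + 1) / 2))).
  move=> hw.
  have h1 := hsum_term1 (fun h => hw (isint_half h)).
  have h2 := hsum_term1 (fun h => hw (isint_half1 h)).
  have h3 := hsum_splitp (p := 2) isT (hsum_term1 hw).
  apply: hsum_eq (hsumB h3 (hsumZ 2^-1 (hsumD h1 h2))) => m.
  rewrite !big_ord_recr big_ord0 /= add0r /term1 /ka addr0.
  have H a b : (a : C) = 2 * b -> a^-1 = 2^-1 * b^-1 by move=> ->; rewrite invfM.
  rewrite (H (w + (m * 2)%:~R) (w / 2 + m%:~R)); last by rewrite rmorphM /=; field.
  rewrite (H (w + (m * 2 + 1)%:~R) ((w + 1) / 2 + m%:~R)); last by rewrite rmorphD rmorphM /=; field.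
  move: ((w / 2 + m%:~R)^-1) (((w + 1) / 2 + m%:~R)^-1) ((m%:~R)^-1) ((m * 2)%:~R^-1) ((m * 2 + 1)%:~R^-1) => a b d d1 d2.
  by field.
move=> hz; have hz1 : ~ isint (- z) by move=> /isint_opp.
have := hsum_unique (Hk _ hz) (Hk _ hz1).
rewrite tsumN// mulNr tsumN; last by move=> /isint_half.
have -> : (- z + 1) / 2 = - ((z + 1) / 2) + 1%:~R by field.
have h2 : ~ isint ((z + 1) / 2) by move=> /isint_half1.
rewrite tsum_per ?tsumN//; last by move=> /isint_opp.
move: (tsum z) (tsum (z / 2)) (tsum ((z + 1) / 2)) => a b c E.
have : 2 * a - (b + c) = (a - 2^-1 * (b + c)) - (- a - 2^-1 * (- b - c)) by field.
by rewrite E subrr => /eqP; rewrite subr_eq0 => /eqP.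
Qed.

(** The bound of the tail is uniform in [f], as all tails are dominated by the same
    series. *)
Lemma strip_bound : exists2 B : R, 0 <= B & forall (f : int -> C) l (K : R),
  hsum f l -> 0 <= K -> (forall n, n != 0 -> cmod (f n) <= K * ((1 + absR n) ^+ 2)^-1) ->
  cmod (l - f 0) <= K * B.
Proof.
have [B HB] := @bsum_int_2 R; exists B.
  by have := HB fset0; rewrite big_seq_fset0.
move=> f l K H K0 Hf.
have H0 : hsum (fun m : int => if m == 0 then f m else 0) (f 0).
  have := @hsum_fin _ _ (fun m : int => if m == 0 then f m else 0) [fset 0]%fset.
  by rewrite big_seq_fset1 eqxx; apply => i; rewrite inE; case: eqP.
apply: (hsum_bounded (hsumB H H0)) => A.
apply: le_trans (_ : K * \sum_(i <- A) `|((1 + absR i) ^+ 2)^-1| <= _); last by rewrite ler_wpM2l.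
rewrite mulr_sumr; apply: ler_sum => n _.
have [->|n0] := eqVneq n 0; first by rewrite subrr cmod0 mulr_ge0.
by rewrite subr0; apply: le_trans (Hf n n0) _; rewrite ler_wpM2l// ler_norm.
Qed.

Lemma sumk_strip k : (1 < k)%N -> exists M : R, forall Y z, in_strip Y z -> cmod (sumk k z - (z ^+ k)^-1) <= M.
Proof.
move=> k1; have [B B0 HB] := strip_bound; exists (4 ^+ k * B) => Y z dz.
have hz := isint_in_strip dz.
have := HB _ _ (4 ^+ k) (hsum_sumk k1 hz); rewrite addr0; apply; first by rewrite exprn_ge0.
move=> n n0; have [h _ _] := dz; have := strip_far h n0.
have a0 := absR_ge1 n0 => lb.
have a1 : 0 < 1 + absR n :> R by lra.
have p0 : 0 < cmod (z + n%:~R) by apply: lt_le_trans lb; lra.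
rewrite cmodV cmodX -[leLHS]mul1r ler_pdivrMr ?exprn_gt0// mulrAC.
rewrite ler_pdivlMr ?exprn_gt0// mul1r -exprMn.
apply: le_trans (_ : (1 + absR n) ^+ k <= _); first by rewrite ler_weXn2l//; lra.
have p1 : 0 <= 4 * cmod (z + n%:~R) by lra.
by rewrite lerXn2r// ?nnegrE ?(ltW a1)//; lra.
Qed.

Lemma tsum_strip : exists M : R, forall Y z, in_strip Y z -> cmod (tsum z - z^-1) <= M * cmod z.
Proof.
have [B B0 HB] := strip_bound; exists (8 * B) => Y z dz.
have hz := isint_in_strip dz; rewrite mulrAC.
have := HB _ _ (8 * cmod z) (hsum_term1 hz).
rewrite /term1 addr0 mulr0z invr0 subr0; apply; first by rewrite mulr_ge0 ?cmod_ge0.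
move=> n n0; have [h _ _] := dz; have := strip_far h n0.
have a0 := absR_ge1 n0 => lb.
have a1 : 0 < 1 + absR n :> R by lra.
rewrite -/(term1 z n) term1E// cmodM cmodV cmodM cmodN cmod_int.
rewrite (_ : 8 * cmod z * _ = cmod z * (((1 + absR n) / 2) * ((1 + absR n) / 4))^-1); last by field; rewrite gt_eqF.
rewrite ler_wpM2l ?cmod_ge0// lef_pV2 ?posrE ?mulr_gt0 ?divr_gt0//; try lra.
by apply: ler_pM => //; lra.
Qed.

(** The difference of the two sides is periodic, satisfies the duplication formula, and
    is [O(|z|)] in the strip since the poles at 0 cancel; it is zero by [doubling_zero1]. *)
Theorem eis1_sum z : ~ isint z -> tsum z = eis1 z.
Proof.
move=> hz; apply/eqP; rewrite -subr_eq0; apply/eqP.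
pose h w := if `[< isint w >] then 0 else tsum w - eis1 w.
have hE w : ~ isint w -> h w = tsum w - eis1 w by rewrite /h; case: asboolP.
rewrite -hE//; apply: (@doubling_zero1 R h 1) => //.
- move=> w n; rewrite /h (asbool_equiv_eq (isint_add w n)).
  by case: asboolP => // w1; rewrite tsum_per// eis1_addint.
- move=> w hw; rewrite !hE//; try by [move=> /isint_half|move=> /isint_half1].
  by rewrite addrACA -opprD tsum_dbl// eis1_dbl// expr1 mulrBr.
- move=> Y; have [K HK] := @eis1_strip R Y; have [M HM] := tsum_strip.
  exists (M + K) => w dw; rewrite hE; last exact: isint_in_strip dw.
  have [w1 w2 w3] := dw.
  rewrite (_ : _ - _ = (tsum w - w^-1) - (eis1 w - w^-1)); last by ring.
  by apply: le_trans (cmodB _ _) _; rewrite mulrDl lerD ?HK// (HM _ _ dw).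
Qed.

Lemma eis2_strip Y : exists K : R, forall z, in_strip Y z -> cmod (eis2 z - (z ^+ 2)^-1) <= K.
Proof.
have [K HK] := @eis1_strip R Y.
exists (2 * K + (K * Y) ^+ 2 + pi ^+ 2) => z [h1 h2 h3].
have hr := HK z h1 h2 h3; set r := eis1 z - z^-1 in hr.
have p0 : 0 < cmod z by rewrite cmod_gt0.
have r0 := cmod_ge0 r.
have K0 : 0 <= K by rewrite -(pmulr_lge0 _ p0); exact: le_trans hr.
rewrite (_ : _ - _ = 2 * (r / z) + r ^+ 2 + piC ^+ 2); last by rewrite /eis2 /r; field.
apply: le_trans (cmodD _ _) _; rewrite [cmod (piC ^+ 2)]cmodX cmod_piC lerD2r.
apply: le_trans (cmodD _ _) _; rewrite cmodX !cmodM cmod_nat cmodV.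
apply: lerD; first by rewrite ler_pM2l// ler_pdivrMr.
have rY : cmod r <= K * Y by apply: le_trans hr _; rewrite ler_wpM2l.
by rewrite lerXn2r ?nnegrE// (le_trans r0).
Qed.

(** As for [eis1_sum]; the difference is bounded in the strip, and [doubling_zero]
    applies. *)
Theorem eis2_sum z : ~ isint z -> sumk 2 z = eis2 z.
Proof.
move=> hz; apply/eqP; rewrite -subr_eq0; apply/eqP.
pose h w := if `[< isint w >] then 0 else sumk 2 w - eis2 w.
have hE w : ~ isint w -> h w = sumk 2 w - eis2 w by rewrite /h; case: asboolP.
rewrite -hE//; apply: (@doubling_zero R h 2 _ _ 0) => //.
- move=> w n; rewrite /h (asbool_equiv_eq (isint_add w n)).
  by case: asboolP => // w1; rewrite sumk_per// /eis2 eis1_addint.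
- move=> w hw; rewrite !hE//; try by [move=> /isint_half|move=> /isint_half1].
  by rewrite addrACA -opprD sumk_dbl// eis2_dbl// mulrBr.
- move=> Y; have [K HK] := eis2_strip Y; have [M HM] := @sumk_strip 2 isT.
  exists (M + K) => w dw; rewrite hE; last exact: isint_in_strip dw.
  rewrite (_ : sumk 2 w - eis2 w = (sumk 2 w - (w ^+ 2)^-1) - (eis2 w - (w ^+ 2)^-1)); last by ring.
  by rewrite expr0 mulr1; apply: le_trans (cmodB _ _) _; rewrite lerD ?HK// (HM _ _ dw).
Qed.

Lemma eis3_strip Y : exists K : R, forall z, in_strip Y z -> cmod (eis3 z - (z ^+ 3)^-1) * cmod z <= K.
Proof.
have [K HK] := @eis1_strip R Y; have [L HL] := eis2_strip Y.
exists (K + K * Y * L * Y + L) => z dz; have [h1 h2 h3] := dz.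
have hr := HK z h1 h2 h3; set r := eis1 z - z^-1 in hr.
have hs := HL z dz; set s := eis2 z - _ in hs.
have p0 : 0 < cmod z by rewrite cmod_gt0.
have r0 := cmod_ge0 r; have s0 := cmod_ge0 s.
have K0 : 0 <= K by rewrite -(pmulr_lge0 _ p0); exact: le_trans hr.
have L0 : 0 <= L by exact: le_trans hs.
have Y0 : 0 <= Y by apply: le_trans h2; exact: ltW.
rewrite -cmodM (_ : _ * z = r / z + r * s * z + s); last by rewrite /eis3 /s /r; field.
apply: le_trans (cmodD _ _) _; apply: lerD => //.
apply: le_trans (cmodD _ _) _; rewrite !cmodM cmodV.
apply: lerD; first by rewrite ler_pdivrMr.
have rY : cmod r <= K * Y by apply: le_trans hr _; rewrite ler_wpM2l.
by rewrite ler_pM ?(ltW p0) ?mulr_ge0 ?ler_pM.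
Qed.

(** As for [eis1_sum]; the difference is [O(1 / |z|)] in the strip, and [doubling_zero]
    applies. *)
Theorem eis3_sum z : ~ isint z -> sumk 3 z = eis3 z.
Proof.
move=> hz; apply/eqP; rewrite -subr_eq0; apply/eqP.
pose h w := if `[< isint w >] then 0 else sumk 3 w - eis3 w.
have hE w : ~ isint w -> h w = sumk 3 w - eis3 w by rewrite /h; case: asboolP.
rewrite -hE//; apply: (@doubling_zero R h 3 _ _ 1) => //.
- move=> w n; rewrite /h (asbool_equiv_eq (isint_add w n)).
  by case: asboolP => // w1; rewrite sumk_per// /eis3 /eis2 eis1_addint.
- move=> w hw; rewrite !hE//; try by [move=> /isint_half|move=> /isint_half1].
  by rewrite addrACA -opprD sumk_dbl// eis3_dbl// mulrBr.
- move=> Y; have [K HK] := eis3_strip Y; have [M HM] := @sumk_strip 3 isT.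
  exists (`|M| * Y + K) => w dw; rewrite hE; last exact: isint_in_strip dw.
  rewrite (_ : sumk 3 w - eis3 w = (sumk 3 w - (w ^+ 3)^-1) - (eis3 w - (w ^+ 3)^-1)); last by ring.
  rewrite expr1; apply: le_trans (_ : (cmod (sumk 3 w - (w ^+ 3)^-1) + cmod (eis3 w - (w ^+ 3)^-1)) * cmod w <= _).
    by rewrite ler_wpM2r ?cmod_ge0// cmodB.
  rewrite mulrDl lerD ?HK// ler_pM ?cmod_ge0//; last by case: dw.
  by apply: le_trans (HM _ _ dw) _; exact: ler_norm.
Qed.

(** The even [n] contribute a quarter of the sum, the odd ones a quarter of
    [eis2 (1 / 2) = pi^2]. *)
Lemma sum_inv_sq : hsum (fun n : int => if n == 0 then 0 else ((n%:~R : C) ^+ 2)^-1) (piC ^+ 2 / 3).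
Proof.
pose f (n : int) : C := if n == 0 then 0 else ((n%:~R : C) ^+ 2)^-1.
have bf : bsum (fun n => cmod (f n)).
  apply: bsum_le (bsumZ 4 bsum_int_2) => n; rewrite ger0_norm ?cmod_ge0// /f.
  have [->|n0] := eqVneq n 0; first by rewrite cmod0 mulr_ge0// invr_ge0 exprn_ge0// addr_ge0// absR_ge0.
  have a1 := absR_ge1 n0.
  rewrite cmodV cmodX cmod_int -[leLHS]mul1r ler_pdivrMr ?exprn_gt0//; last by lra.
  rewrite mulrAC ler_pdivlMr ?mul1r; [nra|rewrite exprn_gt0//; lra].
have [S HS] := bsum_hsum bf; suff <- : S = piC ^+ 2 / 3 by [].
have h1 := hsum_splitp (p := 2) isT HS.
have h2 := hsum_sumk (k := 2) isT isint_halfP.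
rewrite eis2_sum in h2; last exact: isint_halfP.
have h3 := hsumZ 4^-1 (hsumD HS h2).
have := hsum_unique h1 (hsum_eq _ h3).
rewrite /eis2 eis1_half expr0n add0r => E.
have {}E : S = 4^-1 * (S + piC ^+ 2).
  apply: E => m; rewrite !big_ord_recr big_ord0 /= add0r /f addr0 mulf_eq0 orbF.
  have -> : (m * 2 + 1 == 0) = false by lia.
  have H a b : (a : C) = 2 * b -> (a ^+ 2)^-1 = 4^-1 * (b ^+ 2)^-1.
    by move=> ->; rewrite exprMn invfM; congr (_^-1 * _); ring.
  rewrite mulrDr; congr (_ + _).
    case: eqP => _; first by rewrite mulr0.
    by rewrite (H (m * 2)%:~R m%:~R)//; rewrite rmorphM /= mulrC.
  by rewrite (H (m * 2 + 1)%:~R (2^-1 + m%:~R))//; rewrite rmorphD rmorphM /=; field.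
have : 3 * S = piC ^+ 2.
  have -> : 3 * S = 4 * S - S by ring.
  by rewrite {1}E; field.
by move=> <-; field.
Qed.

End PartialFractions.

(** * Sums of three-term relations over pairs of integers *)

Section ThreeTerm.
Context {R : realType}.
Local Notation C := (Cplx R).
Local Notation piC := (@piC R).
Local Notation iC := (@iC R).
Implicit Types (z w : C) (x y : R) (e : int -> C).

(** Decay to the fourth power allows for a first moment and for a second index ranging
    over about [|m|] values, see [hsum_sgCM]. *)
Definition rapid e := exists K : R, forall m, cmod (e m) * (1 + absR m) ^+ 4 <= K.
Definition ssum e : C := summability.sum e.
Definition smom e : C := summability.sum (fun m : int => m%:~R * e m).

Lemma absR1_gt0 (m : int) : 0 < 1 + absR m :> R.
Proof. by rewrite ltr_pwDl ?absR_ge0. Qed.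

Lemma rapid_bsum2 e : rapid e -> bsum (fun m => cmod (e m) * (1 + absR m) ^+ 2).
Proof.
move=> [K HK]; apply: bsum_le (bsumZ K bsum_int_2) => m.
have a0 := absR1_gt0 m.
rewrite ger0_norm ?mulr_ge0 ?cmod_ge0 ?exprn_ge0 ?(ltW a0)//.
by rewrite ler_pdivlMr ?exprn_gt0// -mulrA -exprD HK.
Qed.

Lemma rapid_bsum e : rapid e -> bsum (fun m => cmod (e m)).
Proof.
move=> /rapid_bsum2; apply: bsum_le => m.
rewrite ger0_norm ?cmod_ge0// ler_peMr ?cmod_ge0// exprn_ege1// lerDl absR_ge0//.
Qed.

Lemma rapid_bsum1 e : rapid e -> bsum (fun m => cmod (m%:~R * e m)).
Proof.
move=> /rapid_bsum2; apply: bsum_le => m.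
rewrite ger0_norm ?cmod_ge0// cmodM cmod_int mulrC ler_wpM2l ?cmod_ge0//.
by have := @absR_ge0 R m; nra.
Qed.

Lemma hsum_ssum e : rapid e -> hsum e (ssum e).
Proof. by move=> /rapid_bsum /bsum_hsumE. Qed.

Lemma hsum_smom e : rapid e -> hsum (fun m => m%:~R * e m) (smom e).
Proof. by move=> /rapid_bsum1 /bsum_hsumE. Qed.

(** The difference vanishes unless [|n| <= |m|]. *)
Lemma cmod_sgC_diff m n : cmod (sgC n - sgC (m + n) : C) <= 2 * (1 + absR m) ^+ 2 * ((1 + absR n) ^+ 2)^-1.
Proof.
have a0 := absR1_gt0 m; have b0 := absR1_gt0 n.
have [h|h] := ltnP (absz m) (absz n).
  by rewrite sgC_same// subrr cmod0 mulr_ge0 ?invr_ge0 ?mulr_ge0 ?exprn_ge0// ltW.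
apply: le_trans (_ : 2 <= _).
  by apply: le_trans (cmodB _ _) _; have := cmod_sgC (R := R) n; have := cmod_sgC (R := R) (m + n); lra.
rewrite ler_pdivlMr ?exprn_gt0// ler_pM2l// lerXn2r ?nnegrE ?(ltW a0) ?(ltW b0)//.
by rewrite lerD2l /absR ler_nat.
Qed.

(** The sum over the second index is [hsum_sgC], whence the first moment. *)
Lemma hsum_sgCM e : rapid e ->
  hsum (fun p : int * int => (sgC p.2 - sgC (p.1 + p.2)) * e p.1) (- (2 * smom e)).
Proof.
move=> re.
have [l Hl] : exists l, hsum (fun p : int * int => (sgC p.2 - sgC (p.1 + p.2)) * e p.1) l.
  apply: bsum_hsum.
  apply: bsum_le (bsumZ 2 (bsum_prod (rapid_bsum2 re) bsum_int_2)) => -[m n] /=.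
  rewrite ger0_norm ?cmod_ge0// cmodM mulrC.
  apply: le_trans (ler_wpM2l (cmod_ge0 _) (cmod_sgC_diff m n)) _.
  by rewrite le_eqVlt; apply/orP; left; apply/eqP; ring.
suff -> : - (2 * smom e) = l by [].
have h1 : hsum (fun m : int => - (2 * m%:~R) * e m) l.
  apply: hsum_fubini Hl _ => m /=.
  have := hsumZ (e m) (hsum_sgC m); rewrite mulrC.
  by apply: hsum_eq => n; rewrite mulrC.
apply: hsum_unique h1; rewrite -mulNr.
by apply: hsum_eq (hsumZ (- 2) (hsum_smom re)) => m; ring.
Qed.

(** As [m] tends to plus or minus infinity, [eis1 (z + m tau)] tends to [- pi i] times
    the sign of [m], and the addition law [eis1_add] becomes this identity of signs. It
    fails at the origin, whence the constant [pi^2] in [qzeta_three]. *)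
Lemma sgC_identity m n : sgC m * sgC n + 1 - sgC (m + n) * (sgC m + sgC n) =
  (if (m == 0) && (n == 0) then 1 else 0 : C).
Proof.
have E : sgz m * sgz n + 1 - sgz (m + n) * (sgz m + sgz n) =
    if (m == 0) && (n == 0) then 1 else 0.
  have [m0|m0|m0] := sgzP m; have [n0|n0|n0] := sgzP n; have [k0|k0|k0] := sgzP (m + n);
  by case: (m =P 0) => ?; case: (n =P 0) => ? /=; lia.
have := congr1 (fun i : int => (i%:~R : C)) E.
rewrite rmorphB rmorphD !rmorphM rmorphD /= -/(sgC m) -/(sgC n) -/(sgC (m + n)) => ->.
by case: ifP.
Qed.

(** The hypothesis is the addition law for functions [eis1 (z + m tau)] from which their
    limits at infinity, multiples of signs, have been subtracted. After changes of indices
    the products [e_i m * e_j n] sum to products of sums, and the sign differences sum to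
    first moments by [hsum_sgCM]. *)
Theorem three_term (e1 e2 e3 : int -> C) (X : int * int -> C) (x : C) :
  rapid e1 -> rapid e2 -> rapid e3 -> hsum X x ->
  (forall m n, e1 m * e2 n - e3 (m + n) * (e1 m + e2 n) =
     piC * iC * ((sgC n - sgC (m + n)) * e1 m + (sgC m - sgC (m + n)) * e2 n
                 - (sgC m + sgC n) * e3 (m + n)) + X (m, n)) ->
  ssum e1 * ssum e2 - ssum e3 * (ssum e1 + ssum e2) =
    - (tpi * (smom e1 + smom e2 + smom e3)) + x.
Proof.
move=> r1 r2 r3 HX H.
have s1 := hsum_ssum r1; have s2 := hsum_ssum r2; have s3 := hsum_ssum r3.
have b1 := rapid_bsum r1; have b2 := rapid_bsum r2; have b3 := rapid_bsum r3.
have h12 := hsum_mul s1 s2 b1 b2.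
have bij31 : bijective (fun p : int * int => (p.1 + p.2, p.1)).
  by exists (fun p : int * int => (p.2, p.1 - p.2)) => -[m n] /=; congr pair; ring.
have bij32 : bijective (fun p : int * int => (p.1 + p.2, p.2)).
  by exists (fun p : int * int => (p.1 - p.2, p.2)) => -[m n] /=; congr pair; ring.
have h31 := (hsum_bij _ _ bij31).1 (hsum_mul s3 s1 b3 b1).
have h32 := (hsum_bij _ _ bij32).1 (hsum_mul s3 s2 b3 b2).
have m1 := hsum_sgCM r1.
have bijs : bijective (fun p : int * int => (p.2, p.1)).
  by exists (fun p : int * int => (p.2, p.1)) => -[m n].
have m2 := (hsum_bij _ _ bijs).1 (hsum_sgCM r2).
have bij3 : bijective (fun p : int * int => (p.1 + p.2, - p.2)).
  by exists (fun p : int * int => (p.1 + p.2, - p.2)) => -[m n] /=; congr pair; ring.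
have m3 := (hsum_bij _ _ bij3).1 (hsum_sgCM r3).
have lhs := hsumB h12 (hsumD h31 h32).
have rhs := hsumD (hsumZ (piC * iC) (hsumD (hsumD m1 m2) m3)) HX.
rewrite mulrDr; apply: (hsum_unique lhs).
rewrite (_ : - (tpi * _) + x = piC * iC * (- (2 * smom e1) - 2 * smom e2 - 2 * smom e3) + x); last by rewrite /tpi; ring.
apply: hsum_eq rhs => -[m n] /=.
rewrite -mulrDr H (addrC n m) (_ : m + n + - n = m); last by ring.
by rewrite sgCN; ring.
Qed.

Lemma hsum_delta (I : choiceType) (i : I) (c : C) : hsum (fun j => if j == i then c else 0) c.
Proof.
have := @hsum_fin R _ (fun j => if j == i then c else 0) [fset i]%fset.
by rewrite big_seq_fset1 eqxx; apply => j; rewrite inE; case: eqP.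
Qed.

End ThreeTerm.

(** * Series of cotangents over the multiples of tau *)

Section CotangentSeries.
Context {R : realType}.
Local Notation C := (Cplx R).
Local Notation piC := (@piC R).
Local Notation iC := (@iC R).
Implicit Types (z w : C) (x y : R) (e : int -> C).

Lemma poly_mul_expR_bd (c : R) (j : nat) : 0 < c -> exists K : R, forall k : nat,
  (1 + k%:R) ^+ j * expR (- (c * k%:R)) <= K.
Proof.
move=> c0; pose d := Num.min 1 (c / j.+1%:R).
have d0 : 0 < d by rewrite lt_min ltr01 divr_gt0.
exists ((d^-1) ^+ j) => k.
have h1 : d * (1 + k%:R) <= expR (c / j.+1%:R * k%:R).
  apply: le_trans (expR_ge1Dx _); rewrite mulrDr mulr1 lerD ?ge_min ?lexx//.
  by rewrite ler_wpM2r// ge_min lexx orbT.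
have k0 : 0 <= 1 + k%:R :> R by rewrite addr_ge0.
have h2 : (1 + k%:R) <= d^-1 * expR (c / j.+1%:R * k%:R).
  by rewrite mulrC ler_pdivlMr// mulrC.
have h3 : (1 + k%:R) ^+ j <= (d^-1 * expR (c / j.+1%:R * k%:R)) ^+ j.
  by rewrite lerXn2r// nnegrE// mulr_ge0 ?expR_ge0// invr_ge0 ltW.
apply: le_trans (ler_wpM2r (expR_ge0 _) h3) _.
have -> : c * k%:R = j.+1%:R * (c / j.+1%:R * k%:R).
  by rewrite mulrA [_ * (c / _)]mulrC divfK// pnatr_eq0.
have : 0 <= c / j.+1%:R * k%:R by rewrite mulr_ge0// divr_ge0// ltW.
move: (c / _ * _) => t t0.
rewrite exprMn -mulrA ler_piMr// ?exprn_ge0// ?invr_ge0 ?(ltW d0)//.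
rewrite -expRM_natl -expRD -[leRHS]expR0 ler_expR -natr1.
lra.
Qed.

Lemma bounded_fin (I : choiceType) (g : I -> R) (A : {fset I}) (K : R) :
  (forall i, 0 <= g i) -> (forall i, i \notin A -> g i <= K) -> exists K', forall i, g i <= K'.
Proof.
move=> g0 H; exists (`|K| + \sum_(i <- A) g i) => i.
have s0 : 0 <= \sum_(i <- A) g i by rewrite sumr_ge0.
have [iA|iA] := boolP (i \in A).
  rewrite (big_fsetD1 i)//= addrCA lerDl addr_ge0// sumr_ge0//.
by apply: le_trans (H i iA) _; apply: le_trans (ler_norm _) _; rewrite lerDl.
Qed.

Definition ballz (N : nat) : {fset int} := [fset m in [seq i%:Z - N%:Z | i <- iota 0 N.*2.+1]]%fset.

Lemma in_ballz N m : (m \in ballz N) = (absz m <= N)%N.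
Proof.
rewrite in_fset_seq; apply/mapP/idP => [[i ih] |h].
  by move: ih; rewrite mem_iota => h ->; lia.
by exists (absz (m + N%:Z)); [rewrite mem_iota|]; lia.
Qed.

Lemma rapid_of_expR e (N : nat) (K c : R) : 0 < c -> 
  (forall m, (N < absz m)%N -> cmod (e m) <= K * expR (- (c * absR m))) -> rapid e.
Proof.
move=> c0 H; have [K4 HK] := poly_mul_expR_bd 4 c0.
apply: (@bounded_fin _ _ (ballz N) (`|K| * K4)) => m.
  by rewrite mulr_ge0 ?cmod_ge0// exprn_ge0// ltW// absR1_gt0.
rewrite in_ballz -ltnNge => /H hm.
apply: le_trans (ler_wpM2r _ hm) _; first by rewrite exprn_ge0// ltW// absR1_gt0.
rewrite -mulrA; apply: le_trans (_ : `|K| * (expR (- (c * absR m)) * (1 + absR m) ^+ 4) <= _).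
  by rewrite ler_wpM2r ?ler_norm// mulr_ge0 ?expR_ge0// exprn_ge0// ltW// absR1_gt0.
by rewrite ler_wpM2l// mulrC; exact: HK.
Qed.

(** With [u = e2pi w], the sum is [2 pi i u / (u - 1)]. *)
Lemma eis1_up w : cmod (e2pi w) <= 2^-1 -> cmod (eis1 w + piC * iC) <= 4 * pi * cmod (e2pi w).
Proof.
move=> h; have h1 : 2^-1 <= cmod (e2pi w - 1).
  by rewrite cmod_distC; have := cmodBge 1 (e2pi w); rewrite cmod1; lra.
have h0 : e2pi w - 1 != 0 by rewrite -cmod_gt0; apply: lt_le_trans h1; rewrite invr_gt0.
rewrite (_ : eis1 w + piC * iC = piC * iC * 2 * e2pi w / (e2pi w - 1)); last by rewrite /eis1; field.
move: (e2pi w) h h1 h0 => u h h1 h0.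
rewrite !cmodM cmodV cmod_piC cmod_iC cmod_nat mulr1 ler_pdivrMr ?cmod_gt0//.
have := mulr_ge0 (pi_ge0 R) (cmod_ge0 u); nra.
Qed.

Section Tau.
Variable tau : C.
Hypothesis Htau : 0 < complex.Im tau.

(** The row [m] of the lattice contributes [eis1 (z + m tau)]; its limit for large [m],
    a multiple of the sign of [m], is removed so that the sum over [m] converges. *)
Definition rowsum (m : int) z : C := eis1 (z + m%:~R * tau) + piC * iC * sgC m.

(** [qzeta z] is [zeta(z) - E2 z], by [wzeta_qzeta] and [E2_G2]; [qmom z] is the
    tau-derivative of log sigma up to a quadratic polynomial in [z], by [dtau_log]. *)
Definition qzeta z := ssum (rowsum ^~ z).
Definition qmom z := smom (rowsum ^~ z).

Lemma rowsumN m z : rowsum m (- z) = - rowsum (- m) z.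
Proof.
rewrite /rowsum sgCN (_ : - z + _ = - (z + (- m)%:~R * tau)); last by rewrite rmorphN /=; ring.
by rewrite eis1N; ring.
Qed.

Lemma Im_mul_int (m : int) z : complex.Im (m%:~R * z) = m%:~R * complex.Im z.
Proof.
have := Re_int (R := R) m; case: z => a b; case: (m%:~R : C) => c d /= [-> ->].
by rewrite mul0r addr0.
Qed.

Lemma expR_half (t : R) : 1 <= t -> expR (- t) <= 2^-1.
Proof.
move=> t1; rewrite expRN lef_pV2 ?posrE ?expR_gt0//.
by apply: le_trans (expR_ge1Dx _); lra.
Qed.

(** For [m > 0] the row sums decay exponentially by [eis1_up]; for [m < 0] use
    oddness. *)
Lemma rapid_rowsum z : rapid (rowsum ^~ z).
Proof.
pose s := complex.Im tau; pose y := `|complex.Im z|.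
have p2 : 1 <= 2 * pi :> R by have := pi_ge2 R; lra.
pose N := Num.truncn ((y + 1) / s).
have key m : 0 <= m -> (N < absz m)%N -> forall w, `|complex.Im w| <= y ->
   cmod (eis1 (w + m%:~R * tau) + piC * iC) <= 4 * pi * expR (2 * pi * y) * expR (- (2 * pi * s * absR m)).
  move=> m0 mN w wy.
  have mE : m%:~R = absR m :> R by rewrite absRE ger0_norm// ler0z.
  have ms : y + 1 <= absR m * s.
    rewrite -ler_pdivrMr//; apply: le_trans (ltW (truncnS_gt _)) _.
    by rewrite /absR ler_nat.
  have hI : complex.Im (w + m%:~R * tau) >= absR m * s - y.
    by rewrite Im_add Im_mul_int mE; move: wy; rewrite ler_norml -/s; lra.
  have hE : cmod (e2pi (w + m%:~R * tau)) <= expR (- (2 * pi * (absR m * s - y))).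
    by rewrite cmod_e2pi ler_expR lerN2 ler_pM2l//; lra.
  apply: le_trans (eis1_up _) _.
    by apply: le_trans hE _; apply: expR_half; nra.
  rewrite -[leRHS]mulrA ler_pM2l; last by rewrite mulr_gt0 ?pi_gt0.
  by apply: le_trans hE _; rewrite -expRD ler_expR; lra.
apply: (@rapid_of_expR _ N (4 * pi * expR (2 * pi * y)) (2 * pi * s)) => [|m mN].
  by rewrite mulr_gt0//; lra.
have [m0|m0] := leP 0 m.
  have m1 : 0 < m by lia.
  by rewrite /rowsum /sgC gtr0_sgz// mulr1; apply: key.
have -> : rowsum m z = - rowsum (- m) (- z) by rewrite rowsumN !opprK.
rewrite cmodN -(absRN m).
rewrite /rowsum /sgC gtr0_sgz ?oppr_gt0// mulr1; apply: key; [lia|by rewrite abszN|].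
by rewrite Im_opp normrN.
Qed.

Lemma hsum_qzeta z : hsum (rowsum ^~ z) (qzeta z). Proof. exact: hsum_ssum (rapid_rowsum z). Qed.
Lemma hsum_qmom z : hsum (fun m => m%:~R * rowsum m z) (qmom z). Proof. exact: hsum_smom (rapid_rowsum z). Qed.
Lemma qzetaN z : qzeta (- z) = - qzeta z.
Proof.
apply: hsum_unique (hsum_qzeta _) _; apply: hsum_eq (hsumN (hsum_opp (hsum_qzeta z))) => m.
by rewrite rowsumN.
Qed.

Lemma qmomN z : qmom (- z) = qmom z.
Proof.
apply: hsum_unique (hsum_qmom _) _; apply: hsum_eq (hsum_opp (hsum_qmom z)) => m.
by rewrite rowsumN rmorphN /=; ring.
Qed.

Lemma rowsum_add1 m z : rowsum m (z + 1) = rowsum m z.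
Proof. by rewrite /rowsum addrAC -[1](_ : 1%:~R = _)// eis1_addint. Qed.

Lemma qzeta_add1 z : qzeta (z + 1) = qzeta z.
Proof. by apply: hsum_unique (hsum_qzeta _) _; apply: hsum_eq (hsum_qzeta z) => m; rewrite rowsum_add1. Qed.

Lemma qmom_add1 z : qmom (z + 1) = qmom z.
Proof. by apply: hsum_unique (hsum_qmom _) _; apply: hsum_eq (hsum_qmom z) => m; rewrite rowsum_add1. Qed.

Lemma rowsum_addtau m z : rowsum m (z + tau) = rowsum (m + 1) z + piC * iC * (sgC m - sgC (m + 1)).
Proof.
rewrite /rowsum (_ : z + tau + m%:~R * tau = z + (m + 1)%:~R * tau); last by rewrite rmorphD /=; ring.
by ring.
Qed.

(** Adding [tau] to [z] shifts the index of the cotangents but not that of the signs. *)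
Lemma qzeta_addtau z : qzeta (z + tau) = qzeta z - tpi.
Proof.
apply: hsum_unique (hsum_qzeta _) _.
have := hsumD (hsum_shift 1 (hsum_qzeta z)) (hsumZ (piC * iC) hsum_sgC1).
rewrite (_ : piC * iC * (- 2) = - tpi); last by rewrite /tpi; ring.
by apply: hsum_eq => m; rewrite rowsum_addtau.
Qed.

Lemma qmom_addtau z : qmom (z + tau) = qmom z - qzeta z + tpi / 2.
Proof.
apply: hsum_unique (hsum_qmom _) _.
have := hsumD (hsum_shift 1 (hsumB (hsum_qmom z) (hsum_qzeta z))) (hsumZ (piC * iC) hsum_sgC1M).
rewrite (_ : piC * iC * 1 = tpi / 2); last by rewrite /tpi; field.
by apply: hsum_eq => m; rewrite rowsum_addtau rmorphD /=; ring.
Qed.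

Lemma lat_int z (m : int) : ~ lattice tau z -> ~ isint (z + m%:~R * tau).
Proof.
move=> hz [n hn]; apply: hz; exists (- m, n) => //=.
by rewrite /lattice_pt /= rmorphN /= -hn; ring.
Qed.

Lemma lat_add z (w : int * int) : lattice tau (z + lattice_pt tau w) <-> lattice tau z.
Proof.
case: w => a b; split => -[[c d] _ h].
  exists (c - a, d - b) => //; apply: (addIr (lattice_pt tau (a, b))); rewrite -h.
  by rewrite /lattice_pt /= !rmorphB /=; ring.
by exists (c + a, d + b) => //; rewrite -h /lattice_pt /= !rmorphD /=; ring.
Qed.

Lemma lat_opp z : lattice tau (- z) <-> lattice tau z.
Proof.
have H w : lattice tau w -> lattice tau (- w).
  by move=> [[c d] _ <-]; exists (- c, - d) => //; rewrite /lattice_pt /= !rmorphN /=; ring.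
by split=> /H; rewrite ?opprK.
Qed.

Lemma piCiC_sqr : (piC * iC) ^+ 2 = - piC ^+ 2.
Proof. by rewrite exprMn iC2; ring. Qed.

(** The addition law at [a + m tau] and [b + n tau], summed over [m] and [n]. *)
Lemma qzeta_three a b : ~ lattice tau a -> ~ lattice tau b -> ~ lattice tau (a + b) ->
  qzeta a * qzeta b - qzeta (a + b) * (qzeta a + qzeta b) = - (tpi * (qmom a + qmom b + qmom (a + b))) + piC ^+ 2.
Proof.
move=> ha hb hab.
apply: (three_term (rapid_rowsum a) (rapid_rowsum b) (rapid_rowsum (a + b)) (hsum_delta (0, 0) (piC ^+ 2))).
move=> m n; rewrite xpair_eqE.
have X' : (if (m == 0) && (n == 0) then piC ^+ 2 else 0) =
    - (piC * iC) ^+ 2 * (sgC m * sgC n + 1 - sgC (m + n) * (sgC m + sgC n)).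
  by rewrite sgC_identity piCiC_sqr opprK; case: ifP; rewrite ?mulr1 ?mulr0.
have E := eis1_add (lat_int (m := m) ha) (lat_int (m := n) hb).
rewrite X' /rowsum.
have EE : a + m%:~R * tau + (b + n%:~R * tau) = a + b + (m + n)%:~R * tau by rewrite rmorphD /=; ring.
rewrite EE in E; have {}E := E (lat_int hab); rewrite -[piC ^+ 2]opprK -piCiC_sqr in E.
move: (piC * iC) (eis1 (a + m%:~R * tau)) (eis1 (b + n%:~R * tau)) (eis1 (a + b + (m + n)%:~R * tau)) E => q c1 c2 c3 E.
apply/eqP; rewrite -subr_eq0; apply/eqP.
transitivity (c1 * c2 - (- q ^+ 2 + c3 * (c1 + c2))); first by ring.
by rewrite E subrr.
Qed.

(** [wpsum z] is [wp(z) + E2], by [wp_wpsum] and [E2_G2]. *)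
Definition wpsum z : C := summability.sum (fun m : int => eis2 (z + m%:~R * tau)).

Lemma hsum_wpsum z : hsum (fun m : int => eis2 (z + m%:~R * tau)) (wpsum z).
Proof.
apply: bsum_hsumE.
have re := rapid_rowsum z.
have pE m : eis2 (z + m%:~R * tau) = rowsum m z * rowsum m z - 2 * (piC * iC) * sgC m * rowsum m z + piC ^+ 2 * (if m == 0 then 1 else 0).
  have := sgC_identity m 0; rewrite eqxx andbT => <-; rewrite addr0 /sgC sgz0 /= mulr0z mulr0 add0r addr0.
  rewrite -/(sgC m) /rowsum /eis2 -[piC ^+ 2]opprK -piCiC_sqr; ring.
have [K HK] := re.
have d0 : bsum (fun m : int => if m == 0 then 1 else 0 : R).
  exists 1 => A; have [A0|A0] := boolP (0 \in A).
    rewrite (big_fsetD1 0)//= normr1 big1_fset ?addr0// => i; rewrite !inE => /andP[/negPf -> _] _.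
    by rewrite normr0.
  by rewrite big1_fset// => i iA _; case: eqP => [i0|]; rewrite ?normr0//; rewrite -i0 iA in A0.
apply: bsum_le (bsumD (bsumZ (K + 2 * pi) (rapid_bsum re)) (bsumZ (pi ^+ 2) d0)) => m.
rewrite ger0_norm ?cmod_ge0// pE; apply: le_trans (cmodD _ _) _; apply: lerD; last first.
  by rewrite cmodM cmodX cmod_piC; case: eqP => _; rewrite ?cmod1 ?cmod0.
apply: le_trans (cmodB _ _) _; rewrite !cmodM cmod_nat cmod_piC cmod_iC [leRHS]mulrDl; apply: lerD.
  rewrite ler_wpM2r ?cmod_ge0//; apply: le_trans (HK m).
  by rewrite ler_peMr ?cmod_ge0// exprn_ege1// lerDl absR_ge0.
rewrite ler_wpM2r ?cmod_ge0// mulr1 -[leRHS]mulr1 ler_wpM2l ?cmod_sgC//.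
by rewrite mulr_ge0// pi_ge0.
Qed.

(** The limiting case [b = - a] of [qzeta_three]. If [m + n = 0], the factor
    [eis1 (a + b + (m + n) tau)] has a pole; it is replaced by 0, and the resulting defect
    of the addition law is [- eis2 (z + m tau)]. *)
Lemma wpsum_qzeta : exists c : C, forall z, ~ lattice tau z -> wpsum z = qzeta z ^+ 2 - 2 * tpi * qmom z + c.
Proof.
pose e0 (k : int) := if k == 0 then 0 else rowsum k 0.
have r0 : rapid e0.
  have [K HK] := rapid_rowsum 0; exists K => m; rewrite /e0; case: eqP => _; last exact: HK.
  by rewrite cmod0 mul0r; apply: le_trans (HK m); rewrite mulr_ge0 ?cmod_ge0// exprn_ge0// ltW// absR1_gt0.
exists (- tpi * smom e0 + piC ^+ 2) => z hz.
pose X1 (p : int * int) := if p.1 + p.2 == 0 then eis2 (z + p.1%:~R * tau) else 0.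
have hX1 : hsum X1 (wpsum z).
  apply/(@hsum_inj _ _ _ (fun m : int => (m, - m))) => [? ? []//|[m n] /= nE|].
    rewrite /X1 /=; case: eqP => // E; case: nE; exists m; congr pair.
    by apply/eqP; rewrite eq_sym -addr_eq0 addrC E.
  by apply: hsum_eq (hsum_wpsum z) => m; rewrite /X1 /= subrr eqxx.
have hz' : ~ lattice tau (- z) by move=> /lat_opp.
have := three_term (rapid_rowsum z) (rapid_rowsum (- z)) r0 (hsumB (hsum_delta (0, 0) (piC ^+ 2)) hX1) _.
rewrite -/(qzeta z) -/(qzeta (- z)) -/(qmom z) -/(qmom (- z)) qzetaN qmomN subrr mulr0 subr0 => E.
have {}E : qzeta z * - qzeta z = - (tpi * (qmom z + qmom z + smom e0)) + (piC ^+ 2 - wpsum z).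
  apply: E => m n; rewrite xpair_eqE.
  have X' : (if (m == 0) && (n == 0) then piC ^+ 2 else 0) =
      - (piC * iC) ^+ 2 * (sgC m * sgC n + 1 - sgC (m + n) * (sgC m + sgC n)).
    by rewrite sgC_identity piCiC_sqr opprK; case: ifP; rewrite ?mulr1 ?mulr0.
  rewrite X' /X1 /= /e0; case: eqP => [mn|mn].
    have {mn}nE : n = - m by apply/eqP; rewrite -addr_eq0 addrC mn.
    rewrite nE subrr rowsumN opprK /rowsum sgCN /eis2 -[piC ^+ 2]opprK -piCiC_sqr /sgC sgz0 /=; ring.
  have nk : ~ isint (0 + (m + n)%:~R * tau).
    rewrite add0r => -[k hk]; have := congr1 (@complex.Im R) hk.
    rewrite Im_mul_int (Re_int k).2 => /eqP; rewrite mulf_eq0 intr_eq0 (gt_eqF Htau) orbF.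
    by move=> /eqP.
  have E := eis1_add (lat_int (m := m) hz) (lat_int (m := n) hz').
  have EE : z + m%:~R * tau + (- z + n%:~R * tau) = 0 + (m + n)%:~R * tau by rewrite rmorphD /=; ring.
  rewrite EE in E; have {}E := E nk; rewrite -[piC ^+ 2]opprK -piCiC_sqr in E.
  rewrite subr0 /rowsum.
  move: (piC * iC) (eis1 (z + m%:~R * tau)) (eis1 (- z + n%:~R * tau)) (eis1 (0 + (m + n)%:~R * tau)) E => q c1 c2 c3 E.
  apply/eqP; rewrite -subr_eq0; apply/eqP.
  transitivity (c1 * c2 - (- q ^+ 2 + c3 * (c1 + c2))); first by ring.
  by rewrite E subrr.
have -> : wpsum z = piC ^+ 2 - tpi * (qmom z + qmom z + smom e0) - qzeta z * - qzeta z by rewrite E; ring.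
by ring.
Qed.

End Tau.

End CotangentSeries.

(** * Lattice-periodic corrections and distribution relations *)

Section PeriodicFunctions.
Context {R : realType}.
Local Notation C := (Cplx R).
Local Notation piC := (@piC R).
Local Notation iC := (@iC R).
Implicit Types (z w : C) (x y : R) (e : int -> C).
Variable tau : C.
Hypothesis Htau : 0 < complex.Im tau.
Local Notation qzeta := (qzeta tau).
Local Notation qmom := (qmom tau).
Local Notation rowsum := (rowsum tau).
Local Notation lat := (lattice tau).

(** The coordinate of [z] along [tau] in the real basis formed by 1 and [tau]. *)
Definition tcoord z : C := ofR (complex.Im z / complex.Im tau).

(** The multiples of [tcoord] make up for the quasi-periods of [qzeta] and [qmom] along
    [tau], see [qzeta_addtau] and [qmom_addtau]. *)
Definition ellZ z : C := qzeta z + tpi * tcoord z.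
Definition ellL z : C := - tpi * (qmom z + tcoord z * qzeta z) - tpi ^+ 2 / 2 * tcoord z ^+ 2.

Lemma tcoordD z w : tcoord (z + w) = tcoord z + tcoord w.
Proof. by rewrite /tcoord Im_add mulrDl ofRD. Qed.

Lemma tcoordN z : tcoord (- z) = - tcoord z.
Proof. by rewrite /tcoord Im_opp mulNr ofRN. Qed.

Lemma tcoord_real x : tcoord (ofR x) = 0.
Proof. by rewrite /tcoord /= mul0r. Qed.

Lemma tcoord_tau : tcoord tau = 1.
Proof. by rewrite /tcoord divff ?gt_eqF. Qed.

Lemma tcoord_1 : tcoord 1 = 0.
Proof. exact: (tcoord_real 1). Qed.

Lemma tcoord0 : tcoord 0 = 0. Proof. exact: (tcoord_real 0). Qed.
Lemma tcoord_nat n z : tcoord (n%:R * z) = n%:R * tcoord z.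
Proof.
elim: n => [|n IH]; first by rewrite !mul0r tcoord0.
by rewrite -natr1 !mulrDl tcoordD IH !mul1r.
Qed.

Lemma tcoord_int (n : int) z : tcoord (n%:~R * z) = n%:~R * tcoord z.
Proof.
case: n => k; first exact: tcoord_nat.
by rewrite NegzE !rmorphN /= !mulNr tcoordN tcoord_nat.
Qed.

Lemma tcoord_divn n z : (0 < n)%N -> tcoord (z / n%:R) = tcoord z / n%:R.
Proof.
move=> n0; have n1 : (n%:R : C) != 0 by rewrite pnatr_eq0 -lt0n.
by apply: (mulfI n1); rewrite -tcoord_nat !(mulrC n%:R) !divfK.
Qed.

Lemma ellZ_add1 z : ellZ (z + 1) = ellZ z.
Proof. by rewrite /ellZ qzeta_add1// tcoordD tcoord_1 addr0. Qed.

Lemma ellZ_addtau z : ellZ (z + tau) = ellZ z.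
Proof. by rewrite /ellZ qzeta_addtau// tcoordD tcoord_tau; ring. Qed.

Lemma ellL_add1 z : ellL (z + 1) = ellL z.
Proof. by rewrite /ellL qzeta_add1// qmom_add1// tcoordD tcoord_1 addr0. Qed.

Lemma ellL_addtau z : ellL (z + tau) = ellL z.
Proof. by rewrite /ellL qzeta_addtau// qmom_addtau// tcoordD tcoord_tau; field. Qed.

Lemma ellZN z : ellZ (- z) = - ellZ z.
Proof. by rewrite /ellZ qzetaN// tcoordN; ring. Qed.

Lemma ellLN z : ellL (- z) = ellL z.
Proof. by rewrite /ellL qzetaN// qmomN// tcoordN; ring. Qed.

Lemma ellZ0 : ellZ 0 = 0.
Proof.
have := ellZN 0; rewrite oppr0 => /eqP.
by rewrite -addr_eq0 -mulr2n mulrn_eq0 => /eqP.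
Qed.

Lemma per_lat (f : C -> C) : (forall z, f (z + 1) = f z) -> (forall z, f (z + tau) = f z) ->
  forall z (w : int * int), f (z + lattice_pt tau w) = f z.
Proof.
move=> f1 ft.
have H (u : C) : (forall z, f (z + u) = f z) -> forall z (n : int), f (z + n%:~R * u) = f z.
  move=> fu z n; have Hk (k : nat) w : f (w + k%:R * u) = f w.
    elim: k => [|k IH]; first by rewrite mul0r addr0.
    by rewrite -natr1 mulrDl mul1r addrA fu.
  case: n => k; first exact: Hk.
  by rewrite -(Hk k.+1) NegzE rmorphN /= mulNr subrK.
by move=> z [m n]; rewrite /lattice_pt addrA -[n%:~R]mulr1 (H 1 f1) (H tau ft).
Qed.

Definition ellZ_lat := per_lat ellZ_add1 ellZ_addtau.
Definition ellL_lat := per_lat ellL_add1 ellL_addtau.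

(** As [tcoord] is additive, the correction terms cancel. *)
Lemma ellZ_three a b : ~ lat a -> ~ lat b -> ~ lat (a + b) ->
  ellZ a * ellZ b - ellZ (a + b) * (ellZ a + ellZ b) = ellL a + ellL b + ellL (a + b) + piC ^+ 2.
Proof.
move=> ha hb hab; have E := qzeta_three Htau ha hb hab; rewrite /ellZ /ellL tcoordD.
move: (qzeta a) (qzeta b) (qzeta (a + b)) (qmom a) (qmom b) (qmom (a + b)) (tcoord a) (tcoord b) E => Fa Fb Fc Ma Mb Mc x y E.
apply/eqP; rewrite -subr_eq0; apply/eqP.
transitivity ((Fa * Fb - Fc * (Fa + Fb)) - (- (tpi * (Ma + Mb + Mc)) + piC ^+ 2)); first by field.
by rewrite E subrr.
Qed.

Section Distribution.
Variable N : nat.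
Hypothesis N0 : (0 < N)%N.

Let tor (i j : 'I_N) : C := (i%:R + j%:R * tau) / N%:R.

Let NN : (N%:R : C) != 0. Proof. by rewrite pnatr_eq0 -lt0n. Qed.

Lemma tcoord_tor i j : tcoord (tor i j) = j%:R / N%:R.
Proof.
rewrite /tor tcoord_divn// tcoordD tcoord_nat tcoord_tau mulr1.
by rewrite -[i%:R]mulr1 tcoord_nat tcoord_1 mulr0 add0r.
Qed.

(** The points [i / N] are summed by [eis1_dist]; the coordinate [j] of the torsion
    point selects the row [m N + j] of the lattice for the argument [N z]. *)
Lemma rowsum_dist z (m : int) (j : 'I_N) : ~ lat (N%:R * z) ->
  \sum_(i < N) rowsum m (z + tor i j) =
    N%:R * (rowsum (m * N%:Z + j%:Z) (N%:R * z) + piC * iC * (sgC m - sgC (m * N%:Z + j%:Z))).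
Proof.
move=> hz; rewrite /rowsum big_split /= sumr_const card_ord.
pose w := z + j%:R * tau / N%:R + m%:~R * tau.
have wE : N%:R * w = N%:R * z + (m * N%:Z + j%:Z)%:~R * tau.
  by rewrite rmorphD rmorphM /= /w; field.
have hw : ~ isint (N%:R * w) by rewrite wE; exact: lat_int.
transitivity (\sum_(i < N) eis1 (w + i%:R / N%:R) + piC * iC * sgC m *+ N).
  by congr (_ + _); apply: eq_bigr => i _; congr eis1; rewrite /tor /w; field.
by rewrite eis1_dist// wE; ring.
Qed.

Lemma sgC_block (m : int) (j : 'I_N) : m != 0 -> sgC m - sgC (m * N%:Z + j%:Z) = 0 :> C.
Proof.
move=> m0; apply/eqP; rewrite subr_eq0 /sgC; apply/eqP; congr (_%:~R).
have jN := ltn_ord j.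
have [m1|m1|m1] := sgzP m; first by rewrite m1 eqxx in m0.
  by rewrite gtr0_sgz//; nia.
by rewrite ltr0_sgz//; nia.
Qed.

Lemma sum_ord_half : \sum_(j < N) (j%:R : C) = N%:R * (N%:R - 1) / 2.
Proof.
rewrite -(big_mkord xpredT (fun j => j%:R)); elim: (N) => [|n IH].
  by rewrite big_geq// !mul0r.
by rewrite big_nat_recr//= IH -natr1; field.
Qed.

(** The rows [m N + j] exhaust all rows. The signs of [m] and [m N + j] disagree only
    for [m = 0]; the resulting constant is cancelled by the sum of the [tcoord] terms. *)
Lemma ellZ_dist z : ~ lat (N%:R * z) ->
  \sum_(j < N) \sum_(i < N) ellZ (z + tor i j) = N%:R * ellZ (N%:R * z).
Proof.
move=> hz.
have h1 : hsum (fun m : int => \sum_(j < N) \sum_(i < N) rowsum m (z + tor i j))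
   (\sum_(j < N) \sum_(i < N) qzeta (z + tor i j)).
  apply: hsum_bigsum => j; apply: hsum_bigsum => i; exact: hsum_qzeta.
pose D (m : int) : C := \sum_(j < N) (sgC m - sgC (m * N%:Z + j%:Z)).
have hD : hsum D (1 - N%:R).
  have := @hsum_fin R _ D [fset 0]%fset; rewrite big_seq_fset1.
  have -> : D 0 = 1 - N%:R.
    rewrite /D; case: (N) N0 => // n _; rewrite big_ord_recl /= mul0r addr0 subrr add0r.
    rewrite (eq_bigr (fun=> -1)) => [|i _]; last by rewrite !add0r /sgC gtr0_sgz.
    by rewrite sumr_const card_ord mulNrn -natr1; ring.
  by apply => m; rewrite inE => m0; apply: big1 => j _; exact: sgC_block.
have h2 := hsumZ N%:R (hsumD (hsum_splitp N0 (hsum_qzeta Htau (N%:R * z))) (hsumZ (piC * iC) hD)).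
have E : \sum_(j < N) \sum_(i < N) qzeta (z + tor i j) = N%:R * (qzeta (N%:R * z) + piC * iC * (1 - N%:R)).
  apply: hsum_unique h1 _; apply: hsum_eq h2 => m.
  rewrite /D mulr_sumr -big_split /= mulr_sumr; apply: eq_bigr => j _.
  by rewrite rowsum_dist.
rewrite /ellZ; under eq_bigr do rewrite big_split /= -mulr_sumr.
rewrite big_split /= E -mulr_sumr.
rewrite (eq_bigr (fun j : 'I_N => N%:R * (tcoord z + j%:R / N%:R))) => [|j _]; last first.
  rewrite (eq_bigr (fun=> tcoord z + j%:R / N%:R)) => [|i _]; last by rewrite tcoordD tcoord_tor.
  by rewrite sumr_const card_ord [RHS]mulr_natl.
rewrite -mulr_sumr big_split /= sumr_const card_ord -mulr_suml sum_ord_half tcoord_nat.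
by rewrite /tpi; field.
Qed.

(** As for [ellZ_dist], the row [m N + j] having the weight [N (m + j / N)] in the first
    moment. The fraction [j / N] is the coordinate [tcoord] of the torsion point, and
    [tcoord] vanishes at the real number [x]. *)
Lemma ellL_dist : exists c : C, forall x, ~ lat (N%:R * ofR x) ->
  \sum_(j < N) \sum_(i < N) ellL (ofR x + tor i j) = ellL (N%:R * ofR x) + c.
Proof.
pose D (m : int) : C := \sum_(j < N) (m * N%:Z + j%:Z)%:~R * (sgC m - sgC (m * N%:Z + j%:Z)).
have [d hD] : exists d, hsum D d.
  exists (\sum_(m <- [fset 0]%fset) D m); apply: hsum_fin => m.
  by rewrite inE => m0; apply: big1 => j _; rewrite sgC_block ?mulr0.
pose c2 : C := \sum_(j < N) \sum_(i < N) (j%:R / N%:R) ^+ 2.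
exists (- tpi * (piC * iC * d) - tpi ^+ 2 / 2 * c2) => x hz.
set z := ofR x in hz *.
have h1 : hsum (fun m : int => \sum_(j < N) \sum_(i < N) (m%:~R * rowsum m (z + tor i j) + j%:R / N%:R * rowsum m (z + tor i j)))
   (\sum_(j < N) \sum_(i < N) (qmom (z + tor i j) + j%:R / N%:R * qzeta (z + tor i j))).
  apply: hsum_bigsum => j; apply: hsum_bigsum => i; apply: hsumD; first exact: hsum_qmom.
  by apply: hsumZ; exact: hsum_qzeta.
have h2 := hsumD (hsum_splitp N0 (hsum_qmom Htau (N%:R * z))) (hsumZ (piC * iC) hD).
have E : \sum_(j < N) \sum_(i < N) (qmom (z + tor i j) + j%:R / N%:R * qzeta (z + tor i j)) = qmom (N%:R * z) + piC * iC * d.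
  apply: hsum_unique h1 _; apply: hsum_eq h2 => m.
  rewrite /D mulr_sumr -big_split /=; apply: eq_bigr => j _.
  under [RHS]eq_bigr do rewrite -mulrDl.
  by rewrite -mulr_sumr rowsum_dist// rmorphD rmorphM /=; field.
have alz i j : tcoord (z + tor i j) = j%:R / N%:R by rewrite tcoordD tcoord_tor tcoord_real add0r.
rewrite /ellL; under eq_bigr => j _ do under eq_bigr => i _ do rewrite alz.
rewrite (eq_bigr (fun j : 'I_N => - tpi * (\sum_(i < N) (qmom (z + tor i j) + j%:R / N%:R * qzeta (z + tor i j)))
   - tpi ^+ 2 / 2 * \sum_(i < N) (j%:R / N%:R) ^+ 2)) => [|j _]; last by rewrite sumrB -mulr_sumr -mulr_sumr.
rewrite sumrB -mulr_sumr -mulr_sumr E tcoord_nat tcoord_real -/c2; ring.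
Qed.

End Distribution.

End PeriodicFunctions.

(** * Torsion points and the reciprocity sum *)

Section TorsionSums.
Context {R : realType}.
Local Notation C := (Cplx R).
Local Notation piC := (@piC R).
Local Notation iC := (@iC R).
Implicit Types (z w : C) (x y : R) (e : int -> C).
Variable tau : C.
Hypothesis Htau : 0 < complex.Im tau.
Local Notation lat := (lattice tau).
Local Notation ellZ := (ellZ tau).
Local Notation ellL := (ellL tau).
Local Notation tp lm := (torsion_pt lm tau).

Lemma lat_sum z w : lat z -> lat w -> lat (z + w).
Proof. by move=> hz [v _ <-]; apply/lat_add. Qed.

Lemma lat_mulz (n : int) z : lat z -> lat (n%:~R * z).
Proof.
move=> [[a b] _ <-]; exists (n * a, n * b) => //.
by rewrite /lattice_pt /= !rmorphM /=; ring.
Qed.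

Lemma lat_mulN (n : nat) z : lat z -> lat (n%:R * z).
Proof. exact: (@lat_mulz n%:Z). Qed.

Lemma lat0 : lat 0.
Proof. by exists (0, 0); rewrite // /lattice_pt /= mul0r addr0. Qed.

Lemma real_nlat x : 0 < `|x| < 1 -> ~ lat (ofR x).
Proof.
move=> /andP[x0 x1] [[m n] _]; rewrite /lattice_pt /= => E.
have := congr1 (@complex.Im R) E; rewrite Im_add Im_mul_int (Re_int n).2 /= addr0 => /eqP.
rewrite mulf_eq0 intr_eq0 (gt_eqF Htau) orbF => /eqP m0.
have := congr1 (@complex.Re R) E; rewrite m0 mul0r add0r (Re_int n).1 /= => xE.
move: x0 x1; rewrite -xE -intr_norm ltr0z -[1](_ : 1%:~R = _)// ltr_int; lia.
Qed.

Lemma tp_scale N (lm : 'I_N * 'I_N) : (0 < N)%N ->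
  N%:R * tp lm = lattice_pt tau ((lm.2 : nat)%:Z, (lm.1 : nat)%:Z).
Proof.
move=> N0; have NN : (N%:R : C) != 0 by rewrite pnatr_eq0 -lt0n.
by rewrite /torsion_pt mulrC divfK// /lattice_pt /= addrC.
Qed.

(** The coordinates of a torsion point are less than [N] before division by [N]. *)
Lemma tp_lat N (lm : 'I_N * 'I_N) : (0 < N)%N -> lat (tp lm) -> ~~ nz_index lm.
Proof.
move=> N0 [[m n] _ E].
have := tp_scale lm N0; rewrite -E => {}E.
have [e1 e2] : N%:Z * m = (lm.2 : nat)%:Z /\ N%:Z * n = (lm.1 : nat)%:Z.
  have := congr1 (@complex.Im R) E; have := congr1 (@complex.Re R) E.
  rewrite /lattice_pt /= -[N%:R](_ : N%:Z%:~R = _)// mulrDr mulrA -!rmorphM /=.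
  rewrite !Re_add !Im_add !Im_mul_int !(Re_int _).1 !(Re_int _).2 !addr0 => eR eI.
  have mE : N%:Z * m = (lm.2 : nat)%:Z.
    by apply: (@intr_inj R); apply: (mulIf (_ : complex.Im tau != 0)) => //; rewrite gt_eqF.
  by split=> //; apply: (@intr_inj R); move: eR; rewrite mE => /addrI.
rewrite /nz_index negb_or !negbK; have h1 := ltn_ord lm.1; have h2 := ltn_ord lm.2.
have zero (k : nat) (d : int) : (k < N)%N -> N%:Z * d = k%:Z -> k = 0%N.
  move=> kN kE; have kd : k = (N * absz d)%N by rewrite -[k]/(absz k%:Z) -kE abszM.
  by move: kN; rewrite kd -[ltnRHS]muln1 ltn_mul2l => /andP[_]; rewrite ltnS leqn0 => /eqP ->; rewrite muln0.
by apply/andP; split; apply/eqP; [exact: zero h1 e2|exact: zero h2 e1].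
Qed.

Lemma tp0 N (lm : 'I_N * 'I_N) : ~~ nz_index lm -> tp lm = 0.
Proof.
by rewrite /nz_index negb_or !negbK /torsion_pt => /andP[/eqP -> /eqP ->]; rewrite mul0r addr0 mul0r.
Qed.

(** A Bezout relation between [N] and [q] exhibits the torsion point itself as a lattice
    point. *)
Lemma tp_coprime N (q : int) (lm : 'I_N * 'I_N) : (0 < N)%N -> gcdz N%:Z q = 1 ->
  lat (q%:~R * tp lm) -> ~~ nz_index lm.
Proof.
move=> N0 g hq; apply: tp_lat => //.
have [u [v uv]] := Bezoutz N%:Z q.
have -> : tp lm = u%:~R * (N%:R * tp lm) + v%:~R * (q%:~R * tp lm).
  have := congr1 (fun i : int => (i%:~R : C)) uv; rewrite rmorphD !rmorphM g /= => E.
  by move: (tp lm) => w; rewrite [u%:~R * _]mulrA [v%:~R * _]mulrA -mulrDl E mul1r.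
apply: lat_sum; last exact: lat_mulz.
by apply: lat_mulz; rewrite tp_scale//; exists ((lm.2 : nat)%:Z, (lm.1 : nat)%:Z).
Qed.

Lemma tp_real_nlat N (lm : 'I_N * 'I_N) z : (0 < N)%N -> ~ lat (N%:R * z) -> ~ lat (tp lm + z).
Proof.
move=> N0 hz h; apply: hz; have := lat_mulN N h.
by rewrite mulrDr tp_scale// addrC => /lat_add.
Qed.

Lemma tp_add_nlat p q (t : 'I_p * 'I_p) (s : 'I_q * 'I_q) : (0 < p)%N -> (0 < q)%N -> gcdn p q = 1%N ->
  lat (tp t + tp s) -> ~~ nz_index t /\ ~~ nz_index s.
Proof.
move=> p0 q0 g h; split.
  apply: (@tp_coprime p q%:Z) => //; first by rewrite /gcdz g.
  have := lat_mulN q h; rewrite mulrDr (tp_scale s)// => /lat_add.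
  by [].
apply: (@tp_coprime q p%:Z) => //; first by rewrite /gcdz gcdnC g.
have := lat_mulN p h; rewrite mulrDr (tp_scale t)// addrC => /lat_add.
by [].
Qed.

Definition periodic_lat (f : C -> C) := forall z (w : int * int), f (z + lattice_pt tau w) = f z.

(** Negation permutes the torsion points modulo the lattice. *)
Lemma tp_neg N (f : C -> C) : (0 < N)%N -> periodic_lat f ->
  \sum_(lm : 'I_N * 'I_N) f (- tp lm) = \sum_(lm : 'I_N * 'I_N) f (tp lm).
Proof.
case: N => // n _ fp; pose h (lm : 'I_n.+1 * 'I_n.+1) := (- lm.1, - lm.2).
have hi : injective h.
  by move=> [a b] [c d] E; congr pair; apply: oppr_inj; [exact: (congr1 fst E)|exact: (congr1 snd E)].
rewrite [RHS](reindex_inj hi); apply: eq_bigr => -[i j] _ /=.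
have ni (k : 'I_n.+1) : exists d : int, ((- k : 'I_n.+1) : nat)%:Z = d * n.+1%:Z - (k : nat)%:Z.
  have kn := ltn_ord k; have [k0|k0] := eqVneq (k : nat) 0%N.
    by exists 0; rewrite /= k0 subn0 modnn mul0r.
  by exists 1; rewrite /= modn_small; lia.
have [a ha] := ni i; have [b hb] := ni j.
rewrite -(fp (- tp (i, j)) (b, a)); congr f.
have nn : (n.+1%:R : C) != 0 by rewrite pnatr_eq0.
rewrite /torsion_pt /h; apply: (mulIf nn); rewrite divfK// mulrDl mulNr divfK//.
have E (k : 'I_n.+1) d : ((- k : 'I_n.+1) : nat)%:Z = d * n.+1%:Z - (k : nat)%:Z ->
  (((- k : 'I_n.+1) : nat)%:R : C) = d%:~R * n.+1%:R - k%:R.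
  by move=> /(congr1 (fun i : int => (i%:~R : C))); rewrite rmorphB rmorphM.
by rewrite (E _ _ ha) (E _ _ hb) /lattice_pt /=; ring.
Qed.

Lemma tp_sum N (f : C -> C) : \sum_(lm : 'I_N * 'I_N) f (tp lm) =
  \sum_(j < N) \sum_(i < N) f ((i%:R + j%:R * tau) / N%:R).
Proof. by rewrite exchange_big pair_bigA. Qed.

Lemma ellZ_tp N z : (0 < N)%N -> ~ lat (N%:R * z) ->
  \sum_(lm : 'I_N * 'I_N) ellZ (tp lm + z) = N%:R * ellZ (N%:R * z).
Proof.
move=> N0 hz; rewrite -(ellZ_dist Htau N0 hz) (tp_sum _ (fun t => ellZ (t + z))).
by apply: eq_bigr => j _; apply: eq_bigr => i _; rewrite addrC.
Qed.

Lemma ellL_tp N : (0 < N)%N -> exists c : C, forall x, ~ lat (N%:R * ofR x) ->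
  \sum_(lm : 'I_N * 'I_N) ellL (tp lm + ofR x) = ellL (N%:R * ofR x) + c.
Proof.
move=> N0; have [c Hc] := ellL_dist Htau N0; exists c => x hx.
rewrite -(Hc x hx) (tp_sum _ (fun t => ellL (t + ofR x))).
by apply: eq_bigr => j _; apply: eq_bigr => i _; rewrite addrC.
Qed.

(** This is [ellZ_dist] at a torsion point. At the origin, where [ellZ_dist] does not
    apply, both sides vanish since [ellZ] is odd. *)
Lemma ellZ_tp_mul p q (t : 'I_p * 'I_p) : (0 < p)%N -> (0 < q)%N -> gcdn p q = 1%N ->
  q%:R * ellZ (q%:R * tp t) = \sum_(s : 'I_q * 'I_q) ellZ (tp t + tp s).
Proof.
move=> p0 q0 g; have [tz|tz] := boolP (nz_index t).
  rewrite -ellZ_tp//; first by apply: eq_bigr => s _; rewrite addrC.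
  move=> h; have gz : gcdz p%:Z q%:Z = 1 by rewrite /gcdz g.
  by have := tp_coprime p0 gz h; rewrite tz.
rewrite (tp0 tz) mulr0 ellZ0// mulr0.
have := tp_neg q0 (ellZ_lat Htau); under eq_bigr do rewrite ellZN//.
rewrite sumrN => /eqP; rewrite eq_sym -addr_eq0 -mulr2n mulrn_eq0 /= => /eqP E.
by under eq_bigr do rewrite add0r.
Qed.

Lemma double_sum (I J : finType) (f a : I -> C) (g b : J -> C) (d k : I -> J -> C) :
  \sum_i \sum_j (f i * g j - a i - b j - d i j + k i j) =
  (\sum_i f i) * (\sum_j g j) - #|J|%:R * (\sum_i a i) - #|I|%:R * (\sum_j b j)
  - \sum_i \sum_j d i j + \sum_i \sum_j k i j.
Proof.
transitivity (\sum_i (f i * (\sum_j g j) - #|J|%:R * a i - (\sum_j b j) - \sum_j d i j + \sum_j k i j)).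
  apply: eq_bigr => i _; rewrite big_split /= !sumrB -mulr_sumr sumr_const.
  by rewrite !mulr_natl.
by rewrite big_split /= !sumrB -mulr_suml -mulr_sumr sumr_const !mulr_natl.
Qed.

(** By [ellZ_tp_mul] both sums become double sums over [t] and [s] with a common factor
    [ellZ (t + s)], and [ellZ_three] at [t - x] and [s + x] separates the variables. Each
    single sum is then evaluated by a distribution relation. The pair of origins, to which
    [ellZ_three] does not apply, gives [ellZ x ^+ 2 + 2 * ellL x]. *)
Theorem reciprocity_sum p q : (0 < p)%N -> (0 < q)%N -> gcdn p q = 1%N ->
  exists c : C, forall x, ~ lat (p%:R * ofR x) -> ~ lat (q%:R * ofR x) ->
    q%:R * (\sum_(t : 'I_p * 'I_p) ellZ (tp t - ofR x) * ellZ (q%:R * tp t)) +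
    p%:R * (\sum_(s : 'I_q * 'I_q) ellZ (tp s - ofR x) * ellZ (p%:R * tp s)) =
    - (p%:R * q%:R * ellZ (p%:R * ofR x) * ellZ (q%:R * ofR x))
    - q%:R ^+ 2 * ellL (p%:R * ofR x) - p%:R ^+ 2 * ellL (q%:R * ofR x)
    + (ellZ (ofR x) ^+ 2 + 2 * ellL (ofR x)) + c.
Proof.
move=> p0 q0 g.
have [cp Hp] := ellL_tp p0; have [cq Hq] := ellL_tp q0.
pose cst : C := \sum_(t : 'I_p * 'I_p) \sum_(s : 'I_q * 'I_q) (ellL (tp t + tp s) + piC ^+ 2).
exists (- q%:R ^+ 2 * cp - p%:R ^+ 2 * cq - cst + (ellL 0 + piC ^+ 2)) => x hp hq.
set X := ofR x.
have Zlat := ellZ_lat Htau; have Llat := ellL_lat Htau.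
have hp' : ~ lat (p%:R * - X) by rewrite mulrN => /lat_opp.
have hx : ~ lat X by move=> /(lat_mulN p).
have E1 : q%:R * (\sum_(t : 'I_p * 'I_p) ellZ (tp t - X) * ellZ (q%:R * tp t)) =
    \sum_(t : 'I_p * 'I_p) \sum_(s : 'I_q * 'I_q) ellZ (tp t - X) * ellZ (tp t + tp s).
  rewrite mulr_sumr; apply: eq_bigr => t _.
  by rewrite mulrCA ellZ_tp_mul// mulr_sumr.
have E2 : p%:R * (\sum_(s : 'I_q * 'I_q) ellZ (tp s - X) * ellZ (p%:R * tp s)) =
    \sum_(t : 'I_p * 'I_p) \sum_(s : 'I_q * 'I_q) ellZ (tp s + X) * ellZ (tp t + tp s).
  transitivity (\sum_(s : 'I_q * 'I_q) \sum_(t : 'I_p * 'I_p) ellZ (tp s - X) * ellZ (tp s + tp t)).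
    rewrite mulr_sumr; apply: eq_bigr => t _.
    by rewrite mulrCA ellZ_tp_mul// 1?gcdnC// mulr_sumr.
  (* Replacing [s] and [t] by their opposites turns [s - x] into [- (s + x)]. *)
  rewrite -(tp_neg (f := fun s => \sum_(t : 'I_p * 'I_p) ellZ (s - X) * ellZ (s + tp t)) q0); last first.
    by move=> z w; apply: eq_bigr => t _; rewrite addrAC Zlat addrAC Zlat.
  rewrite exchange_big /=.
  rewrite -(tp_neg (f := fun t => \sum_(s : 'I_q * 'I_q) ellZ (- tp s - X) * ellZ (- tp s + t)) p0); last first.
    by move=> z w; apply: eq_bigr => t _; rewrite addrA Zlat.
  apply: eq_bigr => t _; apply: eq_bigr => s _.
  by rewrite -!opprD !ellZN// mulrNN (addrC (tp s) (tp t)).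
rewrite E1 E2 -big_split /=.
pose K : C := ellZ X ^+ 2 + 2 * ellL X + (ellL 0 + piC ^+ 2).
have key (t : 'I_p * 'I_p) (s : 'I_q * 'I_q) :
  ellZ (tp t - X) * ellZ (tp t + tp s) + ellZ (tp s + X) * ellZ (tp t + tp s) =
  ellZ (tp t - X) * ellZ (tp s + X) - ellL (tp t - X) - ellL (tp s + X) - (ellL (tp t + tp s) + piC ^+ 2)
  + (if ~~ nz_index t && ~~ nz_index s then K else 0).
  case: ifP => [/andP[/tp0 -> /tp0 ->]|ts].
    rewrite !add0r ellZ0// ellZN// ellLN//.
    by rewrite /K; ring.
  have ha : ~ lat (tp t - X) by apply: tp_real_nlat.
  have hb : ~ lat (tp s + X) by apply: tp_real_nlat.
  have abE : tp t - X + (tp s + X) = tp t + tp s by ring.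
  have hab : ~ lat (tp t - X + (tp s + X)).
    by rewrite abE => /(tp_add_nlat p0 q0 g)[h1 h2]; rewrite h1 h2 in ts.
  have := ellZ_three Htau ha hb hab; rewrite abE => E.
  rewrite addr0 -mulrDl [_ * ellZ (tp t + _)]mulrC.
  apply/eqP; rewrite -subr_eq0; apply/eqP.
  transitivity (- (ellZ (tp t - X) * ellZ (tp s + X) - ellZ (tp t + tp s) * (ellZ (tp t - X) + ellZ (tp s + X)) - (ellL (tp t - X) + ellL (tp s + X) + ellL (tp t + tp s) + piC ^+ 2))); first by ring.
  by rewrite E subrr oppr0.
have pk N : (0 < N)%N -> exists2 i : 'I_N * 'I_N, ~~ nz_index i & forall j : 'I_N * 'I_N, ~~ nz_index j -> j = i.
  case: N => // n _; exists (ord0, ord0) => // -[a b].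
  rewrite /nz_index negb_or !negbK /= => /andP[/eqP a0 /eqP b0].
  by congr pair; apply: val_inj.
have -> : \sum_(t : 'I_p * 'I_p) (\sum_(s : 'I_q * 'I_q) ellZ (tp t - X) * ellZ (tp t + tp s) +
     \sum_(s : 'I_q * 'I_q) ellZ (tp s + X) * ellZ (tp t + tp s)) =
  (\sum_(t : 'I_p * 'I_p) ellZ (tp t - X)) * (\sum_(s : 'I_q * 'I_q) ellZ (tp s + X))
  - (q ^ 2)%:R * (\sum_(t : 'I_p * 'I_p) ellL (tp t - X))
  - (p ^ 2)%:R * (\sum_(s : 'I_q * 'I_q) ellL (tp s + X)) - cst + K.
  under eq_bigr do rewrite -big_split /=.
  under eq_bigr => t _ do under eq_bigr => s _ do rewrite key.
  rewrite double_sum !card_prod !card_ord !mulnn -/cst.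
  have -> : \sum_(t : 'I_p * 'I_p) \sum_(s : 'I_q * 'I_q) (if ~~ nz_index t && ~~ nz_index s then K else 0) = K.
    have [i0 hi hiu] := pk p p0; have [j0 hj hju] := pk q q0.
    rewrite (bigD1 i0)//= [X in _ + X]big1 ?addr0 => [|i ii]; last first.
      apply: big1 => j _; case: ifP => // /andP[/hiu ij _].
      by rewrite ij eqxx in ii.
    rewrite (bigD1 j0)//= hi hj /= [X in _ + X]big1 ?addr0// => j jn.
    by case: ifP => // /hju jj0; rewrite jj0 eqxx in jn.
  by [].
have -> : \sum_(t : 'I_p * 'I_p) ellL (tp t - X) = ellL (p%:R * X) + cp.
  by rewrite -[- X](ofRN x) Hp ofRN mulrN ?ellLN// => /lat_opp.
rewrite (ellZ_tp p0 hp') (ellZ_tp q0 hq) (Hq _ hq) mulrN ellZN// !natrX /K; ring.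
Qed.

End TorsionSums.

(** * The Weierstrass functions as series of cotangents *)

Section WeierstrassSeries.
Context {R : realType}.
Local Notation C := (Cplx R).
Local Notation piC := (@piC R).
Local Notation iC := (@iC R).
Implicit Types (z u : C) (x y : R) (e : int -> C) (w : int * int).
Variable tau : C.
Hypothesis Htau : 0 < complex.Im tau.
Local Notation lat := (lattice tau).
Local Notation qzeta := (qzeta tau).
Local Notation qmom := (qmom tau).
Local Notation wpsum := (wpsum tau).
Local Notation rowsum := (rowsum tau).
Local Notation gg := (lattice_pt tau).

Definition height (w : int * int) : R := 1 + absR w.1 + absR w.2.

Lemma height_ge1 w : 1 <= height w.
Proof. by rewrite /height -addrA lerDl addr_ge0 ?absR_ge0. Qed.

Lemma height_gt0 w : 0 < height w. Proof. exact: lt_le_trans (height_ge1 w). Qed.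

(** The imaginary part of a lattice point bounds [m], and then its modulus bounds
    [n]. *)
Lemma lat_far0 : exists2 c : R, 0 < c & forall w, w != (0, 0) -> c * height w <= cmod (gg w).
Proof.
pose y := complex.Im tau; pose K := 2 * (y^-1 + 1 + cmod tau / y).
have y0 : 0 < y by [].
have t0 := cmod_ge0 tau.
have K0 : 0 < K.
  have h1 : 0 < y^-1 by rewrite invr_gt0.
  have h2 : 0 <= cmod tau / y by rewrite divr_ge0// ltW.
  by rewrite /K; lra.
exists K^-1; rewrite ?invr_gt0// => -[m n] w0.
rewrite mulrC ler_pdivrMr// /height /=; set g := cmod _.
have h1 : absR m <= g / y.
  rewrite ler_pdivlMr//; apply: le_trans (Im_cmod _).
  rewrite /lattice_pt Im_add Im_mul_int (Re_int n).2 addr0 normrM -absRE.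
  by rewrite ger0_norm// ltW.
have h2 : absR n <= g + absR m * cmod tau.
  have := cmodB (gg (m, n)) (m%:~R * tau).
  by rewrite {1}/lattice_pt /= addrAC subrr add0r cmod_int cmodM cmod_int.
have h3 : 1 <= absR m + absR n :> R.
  rewrite /absR -natrD ler1n; move: w0; rewrite xpair_eqE; lia.
have h4 : absR m * cmod tau <= g / y * cmod tau by rewrite ler_wpM2r.
rewrite /K; have -> : g * (2 * (y^-1 + 1 + cmod tau / y)) = 2 * (g / y + g + g / y * cmod tau) by ring.
lra.
Qed.

(** Where [height w] is large, [z] is negligible against the lattice point; the other
    [w] are finite in number. *)
Lemma lat_far z : ~ lat z -> exists2 c : R, 0 < c & forall w, c * height w <= cmod (z - gg w).
Proof.
move=> hz; have [c c0 H] := lat_far0.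
have z0 w : 0 < cmod (z - gg w).
  by rewrite cmod_gt0 subr_eq0; apply/eqP => h; apply: hz; exists w.
pose N := Num.truncn (2 * cmod z / c).
have [K HK] : exists K, forall w, height w / cmod (z - gg w) <= K.
  apply: (@bounded_fin _ _ _ [fset w | w in [seq (a, b) | a <- ballz N, b <- ballz N]]%fset (2 / c)).
    by move=> w; rewrite divr_ge0 ?cmod_ge0 ?(ltW (height_gt0 w)).
  move=> [m n] hw; rewrite ler_pdivrMr//.
  have big : 2 * cmod z / c < height (m, n).
    have : ((N < absz m) || (N < absz n))%N.
      move: hw; apply: contraR; rewrite negb_or -!leqNgt -!in_ballz => /andP[hm hn].
      by rewrite in_fset_seq; apply/allpairsP; exists (m, n).
    move=> h; apply: lt_le_trans (truncnS_gt _) _; rewrite -/N /height /=.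
    have : (N.+1%:R <= absR m + absR n :> R).
      by rewrite /absR -natrD ler_nat; lia.
    by lra.
  have w0 : (m, n) != (0, 0).
    apply/eqP => -[m0 n0]; move: hw; rewrite in_fset_seq m0 n0 => /negP; apply.
    by apply/allpairsP; exists (0, 0); rewrite !in_ballz.
  have h1 := H _ w0.
  have h2 := cmodBge (gg (m, n)) z; rewrite cmod_distC in h2.
  rewrite ltr_pdivrMr// in big.
  rewrite mulrAC ler_pdivlMr//; lra.
have K0 : 0 < K.
  by apply: lt_le_trans (HK (0, 0)); rewrite divr_gt0// height_gt0.
exists K^-1; rewrite ?invr_gt0// => w.
by rewrite mulrC ler_pdivrMr// mulrC -ler_pdivrMr.
Qed.

Lemma bsum_height : bsum (fun w => (height w ^+ 3)^-1).
Proof. exact: bsum_lattice. Qed.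

Definition ext0 (f : int * int -> C) (w : int * int) : C := if w == (0, 0) then 0 else f w.

(** The bound makes the sum over the lattice unconditionally convergent, so that it may
    be computed row by row. *)
Lemma pair_sumE (f : int * int -> C) (B : R) l (r : int -> C) :
  (forall w, w != (0, 0) -> cmod (f w) <= B * (height w ^+ 3)^-1) ->
  (forall m, hsum (fun n => ext0 f (m, n)) (r m)) -> hsum r l ->
  hsum (fun w : nzpair => f (val w)) l.
Proof.
move=> HB Hr Hl.
have [l' Hl'] : exists l', hsum (ext0 f) l'.
  apply: bsum_hsum; apply: bsum_le (bsumZ `|B| bsum_height) => w.
  rewrite ger0_norm ?cmod_ge0// /ext0; case: eqVneq => [_|w0].
    by rewrite cmod0 mulr_ge0// invr_ge0 exprn_ge0// ltW// height_gt0.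
  by apply: le_trans (HB w w0) _; rewrite ler_wpM2r ?ler_norm// invr_ge0 exprn_ge0// ltW// height_gt0.
have E : l' = l by apply: hsum_unique Hl; exact: hsum_fubini Hl' Hr.
rewrite E in Hl'.
have nE w : ~ (exists v : nzpair, val v = w) -> ext0 f w = 0.
  by rewrite /ext0; case: eqVneq => // w0 []; exists (exist _ w w0).
have := (hsum_inj l val_inj nE).1 Hl'.
by apply: hsum_eq => -[w /= w0]; rewrite /ext0 (negPf w0).
Qed.

Lemma lattice_sumE (f : C -> C) (B : R) l (r : int -> C) : 
  (forall w, w != (0, 0) -> cmod (f (gg w)) <= B * (height w ^+ 3)^-1) ->
  (forall m, hsum (fun n => ext0 (fun w => f (gg w)) (m, n)) (r m)) -> hsum r l ->
  hsum (fun w : nzpair => f (gg (val w))) l.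
Proof. exact: pair_sumE. Qed.

(** The values at [m tau] of [eis1] (regularised), [eis2] and [eis3] come from the terms
    that make the Weierstrass series converge. The row of the origin has to be treated
    apart. *)
Definition eistau1 (m : int) : C := if m == 0 then 0 else rowsum m 0.
Definition eistau2 (m : int) : C := if m == 0 then 0 else eis2 (m%:~R * tau).
Definition eistau3 (m : int) : C := if m == 0 then 0 else eis3 (m%:~R * tau).

Lemma rapid_mulb e (b : int -> C) (B : R) : rapid e -> (forall m, cmod (b m) <= B) ->
  rapid (fun m => b m * e m).
Proof.
move=> [K HK] Hb; exists (B * K) => m; rewrite cmodM -mulrA.
by rewrite ler_pM ?cmod_ge0// mulr_ge0 ?cmod_ge0// exprn_ge0// ltW// absR1_gt0.
Qed.

Lemma rapid_eistau1 : rapid eistau1.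
Proof.
have [K HK] := rapid_rowsum Htau 0; exists K => m; rewrite /eistau1; case: eqP => _; last exact: HK.
by rewrite cmod0 mul0r; apply: le_trans (HK m); rewrite mulr_ge0 ?cmod_ge0// exprn_ge0// ltW// absR1_gt0.
Qed.

Lemma eis1_tau_bd : exists B, forall m : int, cmod (eis1 (m%:~R * tau) : C) <= B.
Proof.
have [K HK] := rapid_rowsum Htau 0; exists (K + pi) => m.
have -> : eis1 (m%:~R * tau) = rowsum m 0 - piC * iC * sgC m by rewrite /rowsum add0r addrK.
apply: le_trans (cmodB _ _) _; apply: lerD.
  apply: le_trans (HK m); rewrite ler_peMr ?cmod_ge0// exprn_ege1// lerDl absR_ge0//.
by rewrite !cmodM cmod_piC cmod_iC mulr1 ler_piMr ?pi_ge0// cmod_sgC.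
Qed.

(** As the square of [sgC m] is 1, [eis2] factors into [eis1 - pi i sgC m] and
    [eis1 + pi i sgC m]; the second factor decays. *)
Lemma eistau2E m : eistau2 m = (eis1 (m%:~R * tau) - piC * iC * sgC m) * eistau1 m.
Proof.
rewrite /eistau2 /eistau1; case: eqP => [_|m0]; first by rewrite mulr0.
have := sgC_identity (R := R) m 0; rewrite eqxx andbT; case: eqP => // _.
rewrite addr0 {2 4}/sgC sgz0 mulr0 add0r addr0 => /eqP; rewrite subr_eq0 => /eqP E.
rewrite /rowsum add0r /eis2.
transitivity (eis1 (m%:~R * tau) ^+ 2 - (piC * iC) ^+ 2 * (sgC m * sgC m)); last by ring.
by rewrite -E piCiC_sqr; ring.
Qed.

Lemma eistau3E m : eistau3 m = eis1 (m%:~R * tau) * (eis1 (m%:~R * tau) - piC * iC * sgC m) * eistau1 m.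
Proof.
rewrite -mulrA -eistau2E /eistau3 /eistau2; case: eqP => // _; by rewrite mulr0.
Qed.

Lemma eis1_shift_bd : exists B, forall m : int, cmod (eis1 (m%:~R * tau) - piC * iC * sgC m : C) <= B.
Proof.
have [B HB] := eis1_tau_bd; exists (B + pi) => m.
apply: le_trans (cmodB _ _) _; apply: lerD => //.
by rewrite !cmodM cmod_piC cmod_iC mulr1 ler_piMr ?pi_ge0// cmod_sgC.
Qed.

Lemma rapid_eistau2 : rapid eistau2.
Proof.
have [B HB] := eis1_shift_bd; have [K HK] := rapid_mulb rapid_eistau1 HB; exists K => m.
by rewrite eistau2E.
Qed.

Lemma rapid_eistau3 : rapid eistau3.
Proof.
have [B HB] := eis1_shift_bd; have [B' HB'] := eis1_tau_bd.
have [K HK] := rapid_mulb rapid_eistau2 HB'; exists K => m.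
by rewrite eistau3E -mulrA -eistau2E.
Qed.

Lemma eis2N z : eis2 (- z) = eis2 z. Proof. by rewrite /eis2 eis1N; ring. Qed.
Lemma ssum_eistau1 : ssum eistau1 = 0.
Proof.
apply: (hsum_odd (hsum_ssum rapid_eistau1)) => m; rewrite /eistau1 oppr_eq0.
by case: eqP => _; rewrite ?oppr0// -[in LHS]oppr0 rowsumN opprK.
Qed.

Lemma smom_eistau2 : smom eistau2 = 0.
Proof.
apply: (hsum_odd (hsum_smom rapid_eistau2)) => m; rewrite /eistau2 oppr_eq0 rmorphN /= mulNr.
by case: eqP => _; rewrite // mulNr eis2N.
Qed.

(** The sum of the [g^-2] over the lattice, in rows; it is [E2 tau] by [E2_G2]. *)
Definition G2 : C := ssum eistau2 + piC ^+ 2 / 3.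

Lemma tau_nint m : m != 0 -> ~ isint (m%:~R * tau).
Proof.
move=> m0 [k hk]; have := congr1 (@complex.Im R) hk.
rewrite Im_mul_int (Re_int k).2 => /eqP; rewrite mulf_eq0 intr_eq0 (gt_eqF Htau) orbF.
by rewrite (negPf m0).
Qed.

Lemma lat_intB z m : ~ lat z -> ~ isint (z - m%:~R * tau).
Proof. by move=> hz; have := lat_int (m := - m) hz; rewrite rmorphN mulNr. Qed.

Lemma hsum_inv_sub z m : ~ lat z -> hsum (fun n => term1 (z - m%:~R * tau) (- n)) (eis1 (z - m%:~R * tau)).
Proof. by move=> /(lat_intB (m := m)) h; rewrite -eis1_sum//; apply: hsum_opp; exact: hsum_term1. Qed.

Lemma hsum_inv_tau m : m != 0 -> hsum (term1 (m%:~R * tau)) (eis1 (m%:~R * tau)).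
Proof. by move=> /tau_nint h; rewrite -eis1_sum//; exact: hsum_term1. Qed.

Lemma hsum_inv_sq_tau m : m != 0 -> hsum (fun n : int => ((m%:~R * tau + n%:~R) ^+ 2)^-1) (eistau2 m).
Proof. by move=> m0; rewrite /eistau2 (negPf m0) -eis2_sum; [apply: hsum_sumk|]; try exact: tau_nint. Qed.

Lemma hsum_inv_cube_tau m : m != 0 -> hsum (fun n : int => ((m%:~R * tau + n%:~R) ^+ 3)^-1) (eistau3 m).
Proof. by move=> m0; rewrite /eistau3 (negPf m0) -eis3_sum; [apply: hsum_sumk|]; try exact: tau_nint. Qed.

Lemma nlat_neq0 z : ~ lat z -> z != 0.
Proof. by move=> hz; apply/eqP => z0; apply: hz; rewrite z0; exact: lat0. Qed.

Lemma gg_neq0 w : w != (0, 0) -> gg w != 0.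
Proof.
move=> w0; have [c c0 H] := lat_far0; rewrite -cmod_gt0; apply: lt_le_trans (H w w0).
by rewrite mulr_gt0 ?height_gt0.
Qed.

Lemma nlat_sub z w : ~ lat z -> z - gg w != 0.
Proof. by move=> hz; rewrite subr_eq0; apply/eqP => h; apply: hz; exists w. Qed.

Lemma ext0_row (f : int * int -> C) m n : m != 0 -> ext0 f (m, n) = f (m, n).
Proof. by move=> m0; rewrite /ext0 xpair_eqE (negPf m0). Qed.

Lemma ext0_row0 (f : int * int -> C) n : ext0 f (0, n) = if n == 0 then 0 else f (0, n).
Proof. by rewrite /ext0 xpair_eqE eqxx. Qed.

Lemma rowsum_opp z m : eis1 (z - m%:~R * tau) = rowsum (- m) z + piC * iC * sgC m.
Proof. by rewrite /rowsum sgCN rmorphN /= mulNr mulrN subrK. Qed.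

(** In a row, the sums of [1 / (z - g)], [1 / g] and [z / g^2] are [eis1 (z - m tau)],
    [eis1 (m tau)] and [z * eis2 (m tau)]. The regularised values [eis1 (m tau)] are odd in
    [m] and cancel. *)
Theorem wzeta_qzeta z : ~ lat z -> wzeta z tau = qzeta z + G2 * z.
Proof.
move=> hz; have z0 := nlat_neq0 hz.
have [c c0 Hc] := lat_far0; have [d dp Hd] := lat_far hz.
pose r (m : int) : C := rowsum (- m) z + eistau1 m + z * eistau2 m + (if m == 0 then - z^-1 + z * (piC ^+ 2 / 3) else 0).
have hr : hsum r (qzeta z + 0 + z * ssum eistau2 + (- z^-1 + z * (piC ^+ 2 / 3))).
  have he0 := hsum_ssum rapid_eistau1; rewrite ssum_eistau1 in he0.
  exact: (hsumD (hsumD (hsumD (hsum_opp (hsum_qzeta Htau z)) he0) (hsumZ z (hsum_ssum rapid_eistau2))) (hsum_delta 0 _)).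
have := @lattice_sumE (fun g => 1 / (z - g) + 1 / g + z / g ^+ 2) (cmod z ^+ 2 / (c ^+ 2 * d)) _ r _ _ hr.
move=> H; rewrite /wzeta /lattice_sum (hsum_sum (H _ _)) => [|w w0|m].
- by rewrite /G2; field.
- have g0 := gg_neq0 w0; have zg := nlat_sub w hz.
  rewrite (_ : _ + _ = z ^+ 2 / (gg w ^+ 2 * (z - gg w))); last by field; rewrite zg g0.
  rewrite cmodM cmodX cmodV [cmod (_ * _)]cmodM cmodX -mulrA ler_wpM2l ?exprn_ge0 ?cmod_ge0//.
  have w1 := height_gt0 w.
  rewrite -invfM lef_pV2 ?posrE ?mulr_gt0 ?exprn_gt0 ?cmod_gt0//.
  rewrite (_ : c ^+ 2 * d * height w ^+ 3 = (c * height w) ^+ 2 * (d * height w)); last by ring.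
  by rewrite ler_pM ?exprn_ge0 ?mulr_ge0 ?(ltW c0) ?(ltW w1) ?(ltW dp)// lerXn2r ?Hc// nnegrE ?cmod_ge0// mulr_ge0 ?(ltW c0) ?(ltW w1).
have [->|m0] := eqVneq m 0.
  rewrite /r eqxx /eistau1 /eistau2 eqxx.
  have h1 := hsum_inv_sub 0 hz; have h2 := hsumZ z (sum_inv_sq (R := R)).
  have := hsumB (hsumD h1 h2) (hsum_delta 0 z^-1).
  rewrite mulr0z mul0r subr0 (_ : _ - z^-1 = rowsum (- 0) z + 0 + z * 0 + (- z^-1 + z * (piC ^+ 2 / 3))); last first.
    have -> : rowsum (- 0) z = eis1 z by rewrite /rowsum oppr0 mulr0z mul0r addr0 /sgC sgz0 mulr0 addr0.
    by ring.
  apply: hsum_eq => n; rewrite ext0_row0 /term1 /lattice_pt /= mul0r add0r rmorphN /=.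
  case: eqP => [->|_]; last by rewrite subr0 invrN opprK !mul1r.
  by rewrite !(mulr0z, oppr0, invr0, mulr0, subr0, addr0) subrr.
rewrite /r (negPf m0) addr0.
have := hsumD (hsumD (hsum_inv_sub m hz) (hsum_inv_tau m0)) (hsumZ z (hsum_inv_sq_tau m0)).
rewrite rowsum_opp (_ : eis1 (m%:~R * tau) = eistau1 m - piC * iC * sgC m); last first.
  by rewrite /eistau1 (negPf m0) /rowsum add0r addrK.
rewrite (_ : _ + _ + z * _ = rowsum (- m) z + eistau1 m + z * eistau2 m); last by ring.
apply: hsum_eq => n; rewrite ext0_row// /term1 /lattice_pt /= rmorphN /= invrN !mul1r.
rewrite (_ : z - m%:~R * tau - n%:~R = z - (m%:~R * tau + n%:~R)); last by ring.
by ring.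
Qed.

(** In a row, the sums of [(z - g)^-2] and [g^-2] are [eis2 (z - m tau)] and
    [eis2 (m tau)]. *)
Theorem wp_wpsum z : ~ lat z -> wp z tau = wpsum z - G2.
Proof.
move=> hz; have z0 := nlat_neq0 hz.
have [c c0 Hc] := lat_far0; have [d dp Hd] := lat_far hz.
pose r (m : int) : C := eis2 (z + (- m)%:~R * tau) - eistau2 m + (if m == 0 then - (z ^+ 2)^-1 - piC ^+ 2 / 3 else 0).
have hr : hsum r (wpsum z - ssum eistau2 + (- (z ^+ 2)^-1 - piC ^+ 2 / 3)).
  exact: (hsumD (hsumB (hsum_opp (hsum_wpsum Htau z)) (hsum_ssum rapid_eistau2)) (hsum_delta 0 _)).
have := @lattice_sumE (fun g => 1 / (z - g) ^+ 2 - 1 / g ^+ 2) (cmod z * (c * d ^+ 2)^-1 + cmod z * (c ^+ 2 * d)^-1) _ r _ _ hr.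
move=> H; rewrite /wp /lattice_sum (hsum_sum (H _ _)) => [|w w0|m].
- by rewrite /G2; field.
- have g0 := gg_neq0 w0; have zg := nlat_sub w hz.
  have w1 := height_gt0 w.
  rewrite (_ : _ - _ = z / (gg w * (z - gg w) ^+ 2) - z / (gg w ^+ 2 * (z - gg w))); last by field; rewrite zg g0.
  apply: le_trans (cmodB _ _) _; rewrite [leRHS]mulrDl; apply: lerD.
    rewrite cmodM cmodV cmodM cmodX -mulrA ler_wpM2l ?cmod_ge0//.
    rewrite -invfM lef_pV2 ?posrE ?mulr_gt0 ?exprn_gt0 ?cmod_gt0//.
    rewrite (_ : c * d ^+ 2 * height w ^+ 3 = (c * height w) * (d * height w) ^+ 2); last by ring.
    by rewrite ler_pM ?exprn_ge0 ?mulr_ge0 ?(ltW c0) ?(ltW w1) ?(ltW dp) ?Hc// lerXn2r ?Hd// nnegrE ?cmod_ge0// mulr_ge0 ?(ltW dp) ?(ltW w1).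
  rewrite cmodM cmodV cmodM cmodX -mulrA ler_wpM2l ?cmod_ge0//.
  rewrite -invfM lef_pV2 ?posrE ?mulr_gt0 ?exprn_gt0 ?cmod_gt0//.
  rewrite (_ : c ^+ 2 * d * height w ^+ 3 = (c * height w) ^+ 2 * (d * height w)); last by ring.
  by rewrite ler_pM ?exprn_ge0 ?mulr_ge0 ?(ltW c0) ?(ltW w1) ?(ltW dp)// lerXn2r ?Hc// nnegrE ?cmod_ge0// mulr_ge0 ?(ltW c0) ?(ltW w1).
have sqz k : hsum (fun n : int => ((z - k%:~R * tau - n%:~R) ^+ 2)^-1) (eis2 (z - k%:~R * tau)).
  have hk := lat_intB (m := k) hz; rewrite -eis2_sum//.
  by apply: hsum_eq (hsum_opp (hsum_sumk (k := 2) isT hk)) => n; rewrite rmorphN.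
have [->|m0] := eqVneq m 0.
  rewrite /r eqxx /eistau2 eqxx oppr0 mulr0z mul0r addr0.
  have := hsumB (hsumB (sqz 0) (sum_inv_sq (R := R))) (hsum_delta 0 (z ^+ 2)^-1).
  rewrite mulr0z mul0r subr0 (_ : _ - (z ^+ 2)^-1 = eis2 z - 0 + (- (z ^+ 2)^-1 - piC ^+ 2 / 3)); last by ring.
  apply: hsum_eq => n; rewrite ext0_row0 /lattice_pt /= mul0r add0r.
  case: eqP => [->|_]; last by rewrite subr0 !mul1r.
  by rewrite !(mulr0z, subr0) subrr.
rewrite /r (negPf m0) addr0.
have := hsumB (sqz m) (hsum_inv_sq_tau m0).
rewrite rmorphN /= mulNr; apply: hsum_eq => n; rewrite ext0_row// /lattice_pt /= !mul1r.
by rewrite (_ : z - m%:~R * tau - n%:~R = z - (m%:~R * tau + n%:~R)); last by ring.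
Qed.

(** The summands are the logarithmic tau-derivatives of the factors of sigma. The
    partial fractions [z^3 / (g^3 (g - z)) = 1 / (g - z) - 1 / g - z / g^2 - z^2 / g^3] lead
    to sums over rows. *)
Theorem dlog_sum z : ~ lat z ->
  hsum (fun w : nzpair => (val w).1%:~R * z ^+ 3 / (gg (val w) ^+ 3 * (gg (val w) - z)))
    (qmom z - smom eistau1 - z ^+ 2 * smom eistau3).
Proof.
move=> hz; have z0 := nlat_neq0 hz.
have [c c0 Hc] := lat_far0; have [d dp Hd] := lat_far hz.
have hz' : ~ lat (- z) by move=> /lat_opp.
pose r (m : int) : C := m%:~R * rowsum m (- z) - m%:~R * eistau1 m - z * (m%:~R * eistau2 m) - z ^+ 2 * (m%:~R * eistau3 m).
have hr : hsum r (qmom z - smom eistau1 - z ^+ 2 * smom eistau3).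
  have := hsumB (hsumB (hsumB (hsum_qmom Htau (- z)) (hsum_smom rapid_eistau1)) (hsumZ z (hsum_smom rapid_eistau2))) (hsumZ (z ^+ 2) (hsum_smom rapid_eistau3)).
  by rewrite smom_eistau2 mulr0 subr0 qmomN.
apply: (pair_sumE (f := fun w => w.1%:~R * z ^+ 3 / (gg w ^+ 3 * (gg w - z))) (B := cmod z ^+ 3 * (c ^+ 3 * d)^-1) _ _ hr) => [w w0|m].
  have g0 := gg_neq0 w0; have zg := nlat_sub w hz; have w1 := height_gt0 w.
  have -> : cmod (w.1%:~R * z ^+ 3 / (gg w ^+ 3 * (gg w - z))) = cmod z ^+ 3 * (absR w.1 * (cmod (gg w) ^+ 3 * cmod (z - gg w))^-1).
    by rewrite cmodM cmodM cmodV [cmod (_ ^+ 3 * _)]cmodM !cmodX cmod_int (cmod_distC _ z); ring.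
  rewrite -[leRHS]mulrA ler_wpM2l ?exprn_ge0 ?cmod_ge0//.
  apply: le_trans (_ : height w * ((c * height w) ^+ 3 * (d * height w))^-1 <= _).
    apply: ler_pM; rewrite ?absR_ge0 ?invr_ge0 ?mulr_ge0 ?exprn_ge0 ?cmod_ge0//.
      by rewrite /height; have := @absR_ge0 R w.2; lra.
    rewrite lef_pV2 ?posrE ?mulr_gt0 ?exprn_gt0 ?cmod_gt0 ?mulr_gt0//.
    by rewrite ler_pM ?exprn_ge0 ?mulr_ge0 ?(ltW c0) ?(ltW w1) ?(ltW dp)// lerXn2r ?Hc// nnegrE ?cmod_ge0// mulr_ge0 ?(ltW c0) ?(ltW w1).
  by rewrite le_eqVlt; apply/orP; left; apply/eqP; field; rewrite !gt_eqF.
have [->|m0] := eqVneq m 0.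
  rewrite /r !mulr0z !mul0r !mulr0 !subr0; apply: hsum_eq (hsum0 _) => n.
  by rewrite ext0_row0; case: eqP => // _; rewrite mulr0z !mul0r.
have e1 : hsum (term1 (m%:~R * tau - z)) (eis1 (m%:~R * tau - z)).
  have h : ~ isint (m%:~R * tau - z) by rewrite addrC; exact: lat_int.
  by rewrite -eis1_sum//; exact: hsum_term1.
have := hsumZ m%:~R (hsumB (hsumB (hsumB e1 (hsum_inv_tau m0)) (hsumZ z (hsum_inv_sq_tau m0))) (hsumZ (z ^+ 2) (hsum_inv_cube_tau m0))).
rewrite (_ : eis1 (m%:~R * tau - z) = rowsum m (- z) - piC * iC * sgC m); last by rewrite /rowsum addrK addrC.
rewrite (_ : eis1 (m%:~R * tau) = eistau1 m - piC * iC * sgC m); last by rewrite /eistau1 (negPf m0) /rowsum add0r addrK.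
rewrite [X in hsum _ X -> _](_ : _ = r m); last by rewrite /r; ring.
apply: hsum_eq => n; rewrite ext0_row// /term1 /=.
have g0 : gg (m, n) != 0 by apply: gg_neq0; rewrite xpair_eqE (negPf m0).
have zg : gg (m, n) - z != 0 by have := nlat_sub (m, n) hz; rewrite -oppr_eq0 opprB.
rewrite (_ : m%:~R * tau - z + n%:~R = gg (m, n) - z); last by rewrite /lattice_pt /=; ring.
rewrite -[m%:~R * tau + n%:~R]/(gg (m, n)).
move: (gg (m, n)) (m%:~R : C) ((n%:~R : C)^-1) g0 zg => g M N g0 zg.
by field; rewrite zg g0.
Qed.

End WeierstrassSeries.

(** * Derivatives of infinite products *)

Section InfiniteProducts.
Context {R : realType}.
Local Notation C := (Cplx R).
Implicit Types (z u v : C) (x y : R).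

Lemma derive1_quad (f : C -> C) (a D : C) (K d : R) : 0 < d ->
  (forall h : C, cmod h <= d -> cmod (f (h + a) - f a - h * D) <= K * cmod h ^+ 2) ->
  derive1 f a = D.
Proof.
move=> d0 H; rewrite /derive1; apply: cvg_lim; first exact: norm_hausdorff.
apply/cvgrPdist_le => e /posCE[r r0 ->].
have K0 : 0 <= `|K| + 1 by rewrite addr_ge0.
pose s := Num.min d (r / (`|K| + 1)).
have s0 : 0 < s by rewrite lt_min d0 divr_gt0// ltr_wpDl.
have sC : 0 < ofR s :> C by rewrite -[0]/(ofR 0) ltCE.
near=> h.
have h0 : h != 0 by near: h; exact: nbhs_dnbhs_neq.
have hs : cmod h <= s.
  rewrite -leCE -normCE; near: h; exact: dnbhs0_le.
have hn : 0 < cmod h by rewrite cmod_gt0.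
have hd : cmod h <= d by apply: le_trans hs _; rewrite ge_min lexx.
have hr : cmod h <= r / (`|K| + 1) by apply: le_trans hs _; rewrite ge_min lexx orbT.
rewrite normCE leCE.
rewrite (_ : _ - _ = - (h^-1 * (f (h + a) - f a - h * D))); last first.
  by rewrite /GRing.scale /=; field.
rewrite cmodN cmodM cmodV mulrC ler_pdivrMr//; apply: le_trans (H h hd) _.
rewrite expr2 mulrA ler_pM2r//; apply: le_trans (_ : (`|K| + 1) * cmod h <= _).
  by rewrite ler_pM2r//; have := ler_norm K; lra.
by rewrite mulrC -ler_pdivlMr// ltr_wpDl.
Unshelve. all: by end_near.
Qed.

Section Products.
Variable I : choiceType.
Implicit Types (xi : I -> C) (s : seq I).

(** Expanding the product, each term is dominated by the corresponding term of the
    product of the [1 + cmod (xi i)], and this product by the exponential. *)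
Lemma prod_sub1 xi s : cmod (\prod_(i <- s) (1 + xi i) - 1) <= expR (\sum_(i <- s) cmod (xi i)) - 1.
Proof.
elim: s => [|i s IH]; first by rewrite !big_nil expR0 !subrr cmod0.
rewrite !big_cons expRD.
set P := \prod_(_ <- _) _ in IH *; set S := \sum_(_ <- _) _ in IH *.
rewrite (_ : (1 + xi i) * P - 1 = (1 + xi i) * (P - 1) + xi i); last by ring.
apply: le_trans (cmodD _ _) _; rewrite cmodM.
have h1 := cmodD 1 (xi i); rewrite cmod1 in h1.
have h2 := expR_ge1Dx (cmod (xi i)).
have h3 := cmod_ge0 (xi i); have h4 := cmod_ge0 (P - 1); have h5 := expR_gt0 S.
have h6 : cmod (1 + xi i) * cmod (P - 1) <= (1 + cmod (xi i)) * (expR S - 1).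
  by rewrite ler_pM ?cmod_ge0.
have h7 : (1 + cmod (xi i)) * expR S <= expR (cmod (xi i)) * expR S by rewrite ler_pM2r.
lra.
Qed.

Lemma prod_sub2 xi s : cmod (\prod_(i <- s) (1 + xi i) - 1 - \sum_(i <- s) xi i) <=
  expR (\sum_(i <- s) cmod (xi i)) - 1 - \sum_(i <- s) cmod (xi i).
Proof.
elim: s => [|i s IH]; first by rewrite !big_nil expR0 !subrr cmod0.
rewrite !big_cons expRD; have := prod_sub1 xi s.
set P := \prod_(_ <- _) _ in IH *; set S := \sum_(_ <- _) cmod _ in IH *; set T := \sum_(_ <- _) xi _ in IH *.
move=> h0.
rewrite (_ : (1 + xi i) * P - 1 - (xi i + T) = (P - 1 - T) + xi i * (P - 1)); last by ring.
apply: le_trans (cmodD _ _) _; rewrite cmodM.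
have h2 := expR_ge1Dx (cmod (xi i)).
have h3 := cmod_ge0 (xi i); have h5 := expR_gt0 S.
have h6 : cmod (xi i) * cmod (P - 1) <= cmod (xi i) * (expR S - 1) by rewrite ler_wpM2l.
have h7 : (1 + cmod (xi i)) * expR S <= expR (cmod (xi i)) * expR S by rewrite ler_pM2r.
lra.
Qed.

Lemma fprod_split (f : I -> C) (A0 A : {fset I}) : (A0 `<=` A)%fset ->
  \prod_(i <- A) f i = \prod_(i <- A0) f i * \prod_(i <- (A `\` A0)%fset) f i.
Proof.
move=> A0A; rewrite (big_fsetID _ (mem A0)) /=; congr (_ * _).
  by apply: eq_fbigl => i; rewrite !inE /= andb_idl// => /(fsubsetP A0A).
by apply: eq_fbigl => i; rewrite !inE /= andbC.
Qed.

Lemma bsum_cmod_le xi (B : R) : (forall A : {fset I}, \sum_(i <- A) `|cmod (xi i)| <= B) ->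
  forall A : {fset I}, \sum_(i <- A) cmod (xi i) <= B.
Proof.
by move=> H A; apply: le_trans (H A); apply: ler_sum => i _; exact: ler_norm.
Qed.

(** Beyond the finite set [A0] of [bsum_tail] the product changes by a factor close to
    1. *)
Lemma prod_cvg xi : bsum (fun i => cmod (xi i)) ->
  exists l, nlim (fun A : {fset I} => \prod_(i <- A) (1 + xi i)) l.
Proof.
move=> bx; have [B HB] := bx; apply: nlim_cauchy => e e0.
have E0 := expR_gt0 B.
pose e' := Num.min 1 (e / (4 * expR B)).
have e'0 : 0 < e' by rewrite lt_min ltr01 divr_gt0// mulr_gt0.
have [A0 HA] := bsum_tail bx e'0; exists A0 => A A0A.
rewrite (fprod_split _ A0A) -[X in _ - X]mulr1 -mulrBr cmodM.
have h1 : cmod (\prod_(i <- A0) (1 + xi i)) <= expR B.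
  have := prod_sub1 xi A0; have := cmodD (\prod_(i <- A0) (1 + xi i) - 1) 1.
  rewrite subrK cmod1; have : expR (\sum_(i <- A0) cmod (xi i)) <= expR B.
    by rewrite ler_expR; exact: bsum_cmod_le.
  by lra.
have h2 : \sum_(i <- (A `\` A0)%fset) cmod (xi i) <= e'.
  by apply: le_trans (HA A A0A); apply: ler_sum => i _; exact: ler_norm.
have h3 := prod_sub1 xi (A `\` A0)%fset.
set s := \sum_(i <- _) cmod _ in h2 h3.
have s0 : 0 <= s by rewrite sumr_ge0// => i _; exact: cmod_ge0.
have e'1 : e' <= 1 by rewrite ge_min lexx.
have e'2 : e' <= e / (4 * expR B) by rewrite ge_min lexx orbT.
have h4 := expR_taylor1 (x := s); rewrite ger0_norm// in h4.
have {}h4 : expR s - 1 <= 4 * s.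
  by apply: le_trans (ler_norm _) (h4 _); lra.
apply: le_trans (_ : expR B * (4 * e') <= _); first by rewrite ler_pM ?cmod_ge0//; lra.
by move: e'2; rewrite ler_pdivlMr ?mulr_gt0//; lra.
Qed.

(** The product of the inverses of the factors converges too, and the two limits have
    product 1. *)
Lemma prod_neq0 xi l : bsum (fun i => cmod (xi i)) -> (forall i, cmod (xi i) <= 2^-1) ->
  nlim (fun A : {fset I} => \prod_(i <- A) (1 + xi i)) l -> l != 0.
Proof.
move=> bx x2 hl.
have x1 i : 2^-1 <= cmod (1 + xi i).
  by have := cmodBge 1 (- xi i); rewrite cmod1 cmodN opprK; have := x2 i; lra.
have x0 i : 1 + xi i != 0 by rewrite -cmod_gt0; apply: lt_le_trans (x1 i); rewrite invr_gt0.
pose yi i := (1 + xi i)^-1 - 1.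
have [l' hl'] : exists l, nlim (fun A : {fset I} => \prod_(i <- A) (1 + yi i)) l.
  apply: prod_cvg; apply: bsum_le (bsumZ 2 bx) => i; rewrite ger0_norm ?cmod_ge0//.
  rewrite /yi (_ : _ - 1 = - xi i / (1 + xi i)); last by field.
  rewrite cmodM cmodN cmodV ler_pdivrMr ?cmod_gt0//.
  by have := x1 i; have := cmod_ge0 (xi i); nra.
have : l * l' = 1.
  apply: nlim_unique (nlimM hl hl') _; apply: nlim_eq (nlim_cst _ 1) => A /=.
  rewrite -big_split /= big1// => i _; by rewrite /yi addrCA subrr addr0 divff.
by move=> E; apply/eqP => l0; move/eqP: E; rewrite l0 mul0r eq_sym oner_eq0.
Qed.

(** After division by the product at [a0], the product at [h + a0] is that of the
    [1 + phi h i]. It differs from [1 + h * \sum a i] by [O(h^2)], uniformly over the finite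
    subsets: [prod_sub2] bounds the nonlinear part, and [B] the deviation of [phi h i] from
    [h * a i]. *)
Theorem prod_deriv (f : I -> C -> C) (a0 : C) (d : R) (xi : I -> C) (phi : C -> I -> C) (a : I -> C) (D : C) (B : I -> R) :
  0 < d -> (forall i, f i a0 = 1 + xi i) -> bsum (fun i => cmod (xi i)) -> (forall i, cmod (xi i) <= 2^-1) ->
  (forall h i, cmod h <= d -> f i (h + a0) = f i a0 * (1 + phi h i)) ->
  (forall h i, cmod h <= d -> cmod (phi h i - h * a i) <= cmod h ^+ 2 * B i) ->
  bsum B -> bsum (fun i => cmod (a i)) -> hsum a D ->
  let P t := lim ((fun A : {fset I} => \prod_(i <- A) f i t) @ summability.totally) in
  P a0 != 0 /\ forall c, derive1 (fun t => c * P t) a0 = c * (P a0 * D).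
Proof.
move=> d0 fa bx x2 fh phB [SB HSB] [SA HSA] hD P.
have [l hl] := prod_cvg bx.
have hl0 : nlim (fun A : {fset I} => \prod_(i <- A) f i a0) l.
  by apply: nlim_eq hl => A; apply: eq_bigr => i _; rewrite fa.
have PE : P a0 = l by rewrite /P (nlim_lim hl0).
have l0 := prod_neq0 bx x2 hl.
rewrite PE; split => // c.
have SB0 : 0 <= SB by have := HSB fset0; rewrite big_seq_fset0.
have SA0 : 0 <= SA by have := HSA fset0; rewrite big_seq_fset0.
pose K := SA + d * SB + 1.
have K0 : 0 < K by rewrite /K; have := mulr_ge0 (ltW d0) SB0; lra.
apply: (@derive1_quad _ _ _ (cmod c * (cmod l * (4 * K ^+ 2 + SB))) (Num.min d K^-1)).
  by rewrite lt_min d0 invr_gt0.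
move=> h; rewrite le_min => /andP[hd hK].
have h0 := cmod_ge0 h.
have hB (A : {fset I}) : \sum_(i <- A) cmod (phi h i - h * a i) <= cmod h ^+ 2 * SB.
  apply: le_trans (_ : \sum_(i <- A) cmod h ^+ 2 * `|B i| <= _).
    apply: ler_sum => i _; apply: le_trans (phB h i hd) _.
    by rewrite ler_wpM2l ?exprn_ge0// ler_norm.
  by rewrite -mulr_sumr ler_wpM2l ?exprn_ge0.
have hS (A : {fset I}) : \sum_(i <- A) cmod (phi h i) <= cmod h * K.
  apply: le_trans (_ : \sum_(i <- A) (cmod (phi h i - h * a i) + cmod h * cmod (a i)) <= _).
    apply: ler_sum => i _; rewrite -cmodM; apply: le_trans (cmodD _ _).
    by rewrite subrK.
  rewrite big_split /= -mulr_sumr; have := hB A.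
  have := bsum_cmod_le HSA A; rewrite /K => h1 h2.
  have h3 : cmod h * \sum_(i <- A) cmod (a i) <= cmod h * SA by rewrite ler_wpM2l.
  have h4 : cmod h ^+ 2 * SB <= cmod h * (d * SB).
    by rewrite expr2 -mulrA ler_wpM2l// ler_wpM2r.
  by lra.
have bph : bsum (fun i => cmod (phi h i)).
  exists (cmod h * K) => A; under eq_bigr do rewrite ger0_norm ?cmod_ge0//.
  exact: hS.
have [G hG] := prod_cvg bph.
have PhE : P (h + a0) = l * G.
  rewrite /P; apply: nlim_lim; apply: nlim_eq (nlimM hl0 hG) => A.
  by rewrite -big_split /=; apply: eq_bigr => i _; rewrite fh.
rewrite PhE PE (_ : _ - _ = c * (l * (G - 1 - h * D))); last by ring.
rewrite 2!cmodM -!mulrA; do 2! [rewrite ler_wpM2l ?cmod_ge0//].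
have hE : nlim (fun A : {fset I} => (\prod_(i <- A) (1 + phi h i) - 1) + - (h * \sum_(i <- A) a i)) (G - 1 + - (h * D)).
  apply: nlimD; first by apply: nlimD hG (nlim_cst _ _).
  rewrite -mulNr; apply: nlim_eq (nlimM (nlim_cst _ (- h)) hD) => A.
  by rewrite mulNr.
apply: (nlim_bounded hE) => A.
rewrite (_ : _ + _ = (\prod_(i <- A) (1 + phi h i) - 1 - \sum_(i <- A) phi h i) + \sum_(i <- A) (phi h i - h * a i)); last first.
  by rewrite sumrB -mulr_sumr; ring.
apply: le_trans (cmodD _ _) _; rewrite mulrDl; apply: lerD; last first.
  by apply: le_trans (cmod_sum _ _ _) _; rewrite mulrC.
apply: le_trans (prod_sub2 _ _) _; have := hS A; set S := \sum_(i <- A) _ => hS'.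
have S0 : 0 <= S by rewrite sumr_ge0// => i _; exact: cmod_ge0.
have hK1 : cmod h * K <= 1 by rewrite -ler_pdivlMr// div1r.
have := expR_taylor2 (x := S); rewrite ger0_norm// => T.
apply: le_trans (ler_norm _) _; apply: le_trans (T _) _; first by lra.
rewrite -mulrA ler_pM2l// mulrC -exprMn lerXn2r// nnegrE//.
by rewrite mulr_ge0// ltW.
Qed.

End Products.

End InfiniteProducts.

(** * The factors of the sigma product *)

Section SigmaFactor.
Context {R : realType}.
Local Notation C := (Cplx R).
Implicit Types (z u v : C) (x y : R).

(** The factor of the sigma product at the lattice point [g], with [v = z / g]. *)
Definition sigma_factor v : C := (1 - v) * cexp (v + 1 / 2 * v ^+ 2).

(** The exponent [v + v^2 / 2] cancels the terms of [log (1 - v)] of degree 1 and 2. *)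
Lemma sigma_factor_base v : cmod v <= 8^-1 -> cmod (sigma_factor v - 1) <= 40 * cmod v ^+ 3.
Proof.
move=> v1; have v0 := cmod_ge0 v.
pose s := v + 1 / 2 * v ^+ 2.
have hs : cmod s <= 2 * cmod v.
  apply: le_trans (cmodD _ _) _; rewrite [cmod (_ * _)]cmodM [cmod (v ^+ 2)]cmodX cmodM cmodV cmod1 cmod_nat; nra.
have hs1 : cmod s <= 1 by lra.
have hr := cexp_taylor hs1; rewrite /sigma_factor -/s; set r := cexp s - 1 - s - s ^+ 2 / 2 in hr.
have hs' : cmod s <= 9 / 8 * cmod v.
  apply: le_trans (cmodD _ _) _; rewrite [cmod (_ * _)]cmodM [cmod (v ^+ 2)]cmodX cmodM cmodV cmod1 cmod_nat; nra.
have -> : cexp s = 1 + s + s ^+ 2 / 2 + r by rewrite /r; ring.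
rewrite (_ : _ - 1 = - (v ^+ 3 * (1 / 2 + 3 / 8 * v + v ^+ 2 / 8)) + (1 - v) * r); last by rewrite /s; field.
apply: le_trans (cmodD _ _) _; rewrite cmodN [cmod (v ^+ 3 * _)]cmodM [cmod (v ^+ 3)]cmodX.
have e1 : cmod (1 / 2 + 3 / 8 * v + v ^+ 2 / 8) <= 1.
  apply: le_trans (cmodD _ _) _; apply: le_trans (lerD (cmodD _ _) (lexx _)) _.
  by rewrite [cmod (1 / 2)]cmodM [cmod (3 / 8 * v)]cmodM [cmod (3 / 8)]cmodM [cmod (v ^+ 2 / 8)]cmodM cmodX !cmodV cmod1 !cmod_nat; nra.
have e2 : cmod (1 - v) <= 9 / 8 by apply: le_trans (cmodB _ _) _; rewrite cmod1; lra.
have e3 : cmod s ^+ 3 <= (9 / 8 * cmod v) ^+ 3.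
  by rewrite lerXn2r// ?nnegrE ?cmod_ge0 ?mulr_ge0//.
have e4 : cmod ((1 - v) * r) <= 9 / 8 * (20 * cmod s ^+ 3) by rewrite cmodM ler_pM ?cmod_ge0.
have e5 : cmod v ^+ 3 * cmod (1 / 2 + 3 / 8 * v + v ^+ 2 / 8) <= cmod v ^+ 3 by rewrite ler_piMr// exprn_ge0.
have e6 : (9 / 8 * cmod v) ^+ 3 = 729 / 512 * cmod v ^+ 3 by field.
have e7 : 0 <= cmod v ^+ 3 by rewrite exprn_ge0.
lra.
Qed.

(** The logarithmic derivative of [sigma_factor] is [- v^2 / (1 - v)]. The error is
    quadratic in the relative displacement [de / v] and keeps the factor [v^3], which is
    summable over the lattice. *)
Lemma sigma_factor_step v de (k : R) : cmod v <= 8^-1 -> 0 <= k -> k <= 1 -> cmod de <= k * cmod v ->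
  exists2 x : C, sigma_factor (v + de) = sigma_factor v * (1 + x) &
    cmod (x + de * v ^+ 2 / (1 - v)) <= 400 * k ^+ 2 * cmod v ^+ 3.
Proof.
move=> v1 k0 k1 hd; have v0 := cmod_ge0 v; have d0 := cmod_ge0 de.
have w1 : 7 / 8 <= cmod (1 - v) by have := cmodBge 1 v; rewrite cmod1; lra.
have w0 : 1 - v != 0 by rewrite -cmod_gt0; apply: lt_le_trans w1; lra.
pose w := (1 - v)^-1.
have hw : cmod w <= 2.
  by rewrite /w cmodV -[leLHS]mul1r ler_pdivrMr ?cmod_gt0//; lra.
(* The exponent of [sigma_factor] increases by exactly [y]. *)
pose eta := v + de / 2; pose y := de * (1 + eta).
have hdv : cmod de <= cmod v by apply: le_trans hd _; rewrite ler_piMl.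
have he : cmod eta <= 2 * cmod v.
  by apply: le_trans (cmodD _ _) _; rewrite cmodM cmodV cmod_nat; lra.
have he1 : cmod (1 + eta) <= 5 / 4 by apply: le_trans (cmodD _ _) _; rewrite cmod1; lra.
have hy : cmod y <= 2 * cmod de by rewrite cmodM; have := cmod_ge0 (1 + eta); nra.
have hy1 : cmod y <= 1 by lra.
have hr := cexp_taylor hy1; set r := cexp y - 1 - y - y ^+ 2 / 2 in hr.
have eyE : cexp y = 1 + y + y ^+ 2 / 2 + r by rewrite /r; ring.
exists ((1 - de * w) * cexp y - 1).
  rewrite addrCA subrr addr0 /sigma_factor.
  rewrite (_ : v + de + 1 / 2 * (v + de) ^+ 2 = (v + 1 / 2 * v ^+ 2) + y); last by rewrite /y /eta; field.
  by rewrite cexpD /w; field.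
rewrite -/w eyE.
have wE : w = 1 + v * w by rewrite /w; field.
have -> : (1 - de * w) * (1 + y + y ^+ 2 / 2 + r) - 1 + de * v ^+ 2 * w =
   de ^+ 2 / 2 * (eta ^+ 2 - 2 * (v * w) * (1 + eta)) - de * w * y ^+ 2 / 2 + r * (1 - de * w).
  rewrite /y /eta /w; field; exact: w0.
have kv0 : 0 <= k * cmod v by rewrite mulr_ge0.
have k2 : 0 <= k ^+ 2 by rewrite exprn_ge0.
have v3 : 0 <= cmod v ^+ 3 by rewrite exprn_ge0.
have v2 : cmod v ^+ 2 <= cmod v / 8 by nra.
have D2 : cmod de ^+ 2 <= k ^+ 2 * cmod v ^+ 2.
  by rewrite -exprMn lerXn2r// nnegrE.
have D3 : cmod de ^+ 3 <= k ^+ 2 * cmod v ^+ 3.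
  apply: le_trans (_ : (k * cmod v) ^+ 3 <= _); first by rewrite lerXn2r// nnegrE.
  rewrite exprMn; apply: ler_wpM2r => //.
  by rewrite exprSr ler_piMr.
have t1 : cmod (de ^+ 2 / 2 * (eta ^+ 2 - 2 * (v * w) * (1 + eta))) <= 3 * k ^+ 2 * cmod v ^+ 3.
  rewrite cmodM [cmod (de ^+ 2 / 2)]cmodM cmodX cmodV cmod_nat.
  have b : cmod (eta ^+ 2 - 2 * (v * w) * (1 + eta)) <= 6 * cmod v.
    apply: le_trans (cmodB _ _) _; rewrite cmodX [cmod (2 * _ * _)]cmodM [cmod (2 * (v * w))]cmodM [cmod (v * w)]cmodM cmod_nat.
    have b1 : cmod eta ^+ 2 <= 4 * cmod v ^+ 2.
      by rewrite (_ : 4 * cmod v ^+ 2 = (2 * cmod v) ^+ 2) ?lerXn2r ?nnegrE ?cmod_ge0 ?mulr_ge0//; ring.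
    have b2 : cmod v * cmod w <= cmod v * 2 by rewrite ler_wpM2l.
    have b3 : 2 * (cmod v * cmod w) * cmod (1 + eta) <= 2 * (cmod v * 2) * (5 / 4).
      by rewrite ler_pM ?cmod_ge0 ?mulr_ge0 ?cmod_ge0// ler_pM2l.
    lra.
  apply: le_trans (_ : (k ^+ 2 * cmod v ^+ 2 / 2) * (6 * cmod v) <= _).
    by rewrite ler_pM ?cmod_ge0 ?mulr_ge0 ?exprn_ge0// ler_pM2r.
  by rewrite le_eqVlt; apply/orP; left; apply/eqP; field.
have t2 : cmod (de * w * y ^+ 2 / 2) <= 4 * k ^+ 2 * cmod v ^+ 3.
  rewrite [cmod (_ / 2)]cmodM [cmod (de * w * _)]cmodM [cmod (de * w)]cmodM cmodX cmodV cmod_nat.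
  have b1 : cmod y ^+ 2 <= 4 * cmod de ^+ 2.
    by rewrite (_ : 4 * cmod de ^+ 2 = (2 * cmod de) ^+ 2) ?lerXn2r ?nnegrE ?cmod_ge0 ?mulr_ge0//; ring.
  have b2 : cmod de * cmod w <= cmod de * 2 by rewrite ler_wpM2l.
  have b3 : cmod de * cmod w * cmod y ^+ 2 <= cmod de * 2 * (4 * cmod de ^+ 2).
    by rewrite ler_pM ?mulr_ge0 ?cmod_ge0 ?exprn_ge0 ?cmod_ge0.
  have -> : 4 * k ^+ 2 * cmod v ^+ 3 = 4 * (k ^+ 2 * cmod v ^+ 3) by ring.
  have : cmod de * 2 * (4 * cmod de ^+ 2) = 8 * cmod de ^+ 3 by ring.
  lra.
have t3 : cmod (r * (1 - de * w)) <= 320 * k ^+ 2 * cmod v ^+ 3.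
  rewrite cmodM; have b1 : cmod (1 - de * w) <= 2.
    apply: le_trans (cmodB _ _) _; rewrite cmod1 cmodM.
    have : cmod de * cmod w <= cmod de * 2 by rewrite ler_wpM2l.
    lra.
  have b2 : cmod y ^+ 3 <= 8 * cmod de ^+ 3.
    by rewrite (_ : 8 * cmod de ^+ 3 = (2 * cmod de) ^+ 3) ?lerXn2r ?nnegrE ?cmod_ge0 ?mulr_ge0//; ring.
  have b3 : cmod r * cmod (1 - de * w) <= (20 * cmod y ^+ 3) * 2 by rewrite ler_pM ?cmod_ge0.
  have -> : 320 * k ^+ 2 * cmod v ^+ 3 = 320 * (k ^+ 2 * cmod v ^+ 3) by ring.
  lra.
apply: le_trans (cmodD _ _) _; apply: le_trans (lerD (cmodB _ _) (lexx _)) _.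
have kk : 0 <= k ^+ 2 * cmod v ^+ 3 by rewrite mulr_ge0.
rewrite -!mulrA in t1 t2 t3 *; lra.
Qed.

End SigmaFactor.

(** * The derivative of log sigma in tau *)

Section SigmaDerivative.
Context {R : realType}.
Local Notation C := (Cplx R).
Implicit Types (z u v : C) (x y : R).
Variable tau : C.
Hypothesis Htau : 0 < complex.Im tau.
Local Notation lat := (lattice tau).
Local Notation gg := (lattice_pt tau).

Lemma nzP (w : nzpair) : val w != (0, 0). Proof. exact: (valP w). Qed.

(** [prod_deriv] applies to the factors as functions of [tau]: if [z] is small against
    the shortest lattice vector, [sigma_factor_step] applies to every [v = z / g], and a
    displacement [h] of [tau] changes [v] by a relative amount [O(h)], uniformly in [g]. The
    logarithmic derivatives are summed by [dlog_sum]. *)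
Theorem dtau_log : exists2 eps : R, 0 < eps & forall z, ~ lat z -> cmod z <= eps ->
  dtau_log_sigma z tau = qmom tau z - smom (eistau1 tau) - z ^+ 2 * smom (eistau3 tau).
Proof.
have [c c0 Hc] := lat_far0 Htau.
exists (c / 16); first by rewrite divr_gt0.
move=> z hz zc; have z0 := nlat_neq0 hz.
pose v (w : nzpair) := z / gg (val w).
have g0 (w : nzpair) : gg (val w) != 0 := gg_neq0 Htau (nzP w).
have w1 (w : nzpair) := height_gt0 (R := R) (val w).
have hv w : cmod (v w) <= 16^-1 / height (val w).
  rewrite cmodM cmodV ler_pdivrMr ?cmod_gt0//.
  apply: le_trans zc _; have := Hc _ (nzP w); rewrite -ler_pdivlMr// => h.
  by rewrite mulrAC; have := h; lra.
have hv1 w : cmod (v w) <= 16^-1.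
  apply: le_trans (hv w) _; rewrite ler_pdivrMr// ler_peMr//.
  exact: height_ge1.
have hv8 w : cmod (v w) <= 8^-1 by apply: le_trans (hv1 w) _; lra.
have bv : bsum (fun w : nzpair => cmod (v w) ^+ 3).
  apply: bsum_le (bsum_inj (h := val) val_inj (bsum_height (R := R))) => w.
  rewrite ger0_norm ?exprn_ge0 ?cmod_ge0// -exprVn lerXn2r ?nnegrE ?cmod_ge0 ?invr_ge0 ?(ltW (w1 w))//.
  apply: le_trans (hv w) _; rewrite ler_piMl ?invr_ge0 ?(ltW (w1 w))//; lra.
have hb w := sigma_factor_base (hv8 w).
have hb2 w : cmod (sigma_factor (v w) - 1) <= 2^-1.
  apply: le_trans (hb w) _.
  have : cmod (v w) ^+ 3 <= (16^-1) ^+ 3 by rewrite lerXn2r// nnegrE ?cmod_ge0.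
  rewrite !exprS expr0; lra.
have ph0 w : sigma_factor (v w) != 0.
  rewrite -cmod_gt0; have := cmodBge 1 (1 - sigma_factor (v w)).
  rewrite (_ : 1 - (1 - sigma_factor (v w)) = sigma_factor (v w)); last by ring.
  by rewrite cmod1 (cmod_distC 1 (sigma_factor _)); have := hb2 w; lra.
pose f (w : nzpair) (t : C) := sigma_factor (z / lattice_pt t (val w)).
pose a (w : nzpair) : C := (val w).1%:~R * z ^+ 3 / (gg (val w) ^+ 3 * (gg (val w) - z)).
pose x (h : C) (w : nzpair) := f w (h + tau) / sigma_factor (v w) - 1.
have v1 w : 1 - v w != 0.
  rewrite -cmod_gt0; have := cmodBge 1 (v w); rewrite cmod1; have := hv8 w; lra.
have hw w : cmod ((1 - v w)^-1) <= 2.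
  have := cmodBge 1 (v w); rewrite cmod1 => h.
  by rewrite cmodV -[leLHS]mul1r ler_pdivrMr ?cmod_gt0//; have := hv8 w; lra.
have aE w : a w = (v w * ((val w).1%:~R / gg (val w))) * (v w ^+ 2 / (1 - v w)).
  have zg : gg (val w) - z != 0 by rewrite -oppr_eq0 opprB; exact: nlat_sub.
  have h1 := v1 w; have gn0 := g0 w.
  have hh : 1 - v w = (gg (val w) - z) / gg (val w) by rewrite /v; field.
  by rewrite hh /a /v; field; rewrite zg gn0.
have haz (w : nzpair) : absR (val w).1 <= height (val w) :> R.
  by rewrite /height; have := @absR_ge0 R (val w).2; lra.
have hmg (w : nzpair) : cmod ((val w).1%:~R / gg (val w)) <= c^-1.
  rewrite cmodM cmodV cmod_int ler_pdivrMr; last by rewrite cmod_gt0; exact: g0.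
  rewrite mulrC ler_pdivlMr// mulrC.
  by apply: le_trans (Hc _ (nzP w)); rewrite ler_pM2l.
have hv2 w : cmod (v w ^+ 2 / (1 - v w)) <= 2 * cmod (v w) ^+ 2.
  by rewrite cmodM cmodX mulrC ler_wpM2r ?exprn_ge0 ?cmod_ge0.
have ba : bsum (fun w => cmod (a w)).
  apply: bsum_le (bsumZ (2 / c) bv) => w; rewrite ger0_norm ?cmod_ge0// aE cmodM cmodM.
  have -> : 2 / c * cmod (v w) ^+ 3 = (cmod (v w) * c^-1) * (2 * cmod (v w) ^+ 2) by ring.
  by rewrite ler_pM ?mulr_ge0 ?cmod_ge0// ler_wpM2l ?cmod_ge0.
have step (h : C) w : cmod h <= c / 2 ->
   f w (h + tau) = f w tau * (1 + x h w) /\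
   cmod (x h w - h * a w) <= cmod h ^+ 2 * (402 * 4 / c ^+ 2 * cmod (v w) ^+ 3).
  move=> hh; split.
    by rewrite /x addrCA subrr addr0 mulrC divfK// ph0.
  pose m : C := (val w).1%:~R; pose g := gg (val w).
  have h0 := cmod_ge0 h.
  pose k := 2 * cmod h / c.
  have k0 : 0 <= k by rewrite divr_ge0 ?mulr_ge0// ltW.
  have k1 : k <= 1 by rewrite /k ler_pdivrMr//; lra.
  have hg : c * height (val w) <= cmod g := Hc _ (nzP w).
  have g'E : lattice_pt (h + tau) (val w) = g + m * h by rewrite /lattice_pt /g /m /lattice_pt; ring.
  have hmh : cmod (m * h) <= height (val w) * cmod h.
    by rewrite cmodM /m cmod_int ler_wpM2r.
  have hg' : c * height (val w) / 2 <= cmod (g + m * h).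
    have := cmodBge g (- (m * h)); rewrite cmodN opprK.
    have : height (val w) * cmod h <= height (val w) * (c / 2) by rewrite ler_pM2l.
    lra.
  have gn0 : g != 0 := g0 w.
  have g'0 : g + m * h != 0.
    by rewrite -cmod_gt0; apply: lt_le_trans hg'; rewrite divr_gt0 ?mulr_gt0.
  pose de := - (v w * (m * h / (g + m * h))).
  have deE : z / (g + m * h) = v w + de by rewrite /de /v -/g; field; rewrite g'0 gn0.
  have hmg' : cmod (m * h / (g + m * h)) <= k.
    rewrite cmodM cmodV ler_pdivrMr ?cmod_gt0//; apply: le_trans hmh _.
    apply: le_trans (_ : k * (c * height (val w) / 2) <= _); last by rewrite ler_wpM2l.
    by rewrite le_eqVlt; apply/orP; left; apply/eqP; rewrite /k; field; rewrite gt_eqF.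
  have hde : cmod de <= k * cmod (v w).
    by rewrite /de cmodN cmodM mulrC ler_wpM2r ?cmod_ge0.
  have [y yE yB] := sigma_factor_step (hv8 w) k0 k1 hde.
  have xy : x h w = y.
    by rewrite /x /f g'E deE yE mulrC mulKf ?ph0// addrC addKr.
  rewrite xy (_ : y - h * a w = (y + de * v w ^+ 2 / (1 - v w)) - (de + v w * (m * h / g)) * (v w ^+ 2 / (1 - v w))); last first.
    by rewrite aE -/m -/g; field; rewrite gn0 v1.
  have e1 : de + v w * (m * h / g) = v w * ((m * h / g) * (m * h / (g + m * h))).
    by rewrite /de; field; rewrite g'0 gn0.
  have hmg2 : cmod (m * h / g) <= k.
    rewrite mulrAC cmodM; apply: le_trans (ler_wpM2r h0 (hmg w)) _.
    by rewrite /k mulrC ler_wpM2r ?invr_ge0 ?(ltW c0)//; lra.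
  apply: le_trans (cmodB _ _) _.
  have e2 : cmod ((de + v w * (m * h / g)) * (v w ^+ 2 / (1 - v w))) <= (cmod (v w) * (k * k)) * (2 * cmod (v w) ^+ 2).
    rewrite cmodM ler_pM ?cmod_ge0// e1 cmodM ler_wpM2l ?cmod_ge0//.
    by rewrite cmodM ler_pM ?cmod_ge0.
  apply: le_trans (lerD yB e2) _.
  rewrite le_eqVlt; apply/orP; left; apply/eqP; rewrite /k; field.
  by rewrite gt_eqF.
have bB : bsum (fun w => 402 * 4 / c ^+ 2 * cmod (v w) ^+ 3) by exact: bsumZ.
have bx : bsum (fun w => cmod (sigma_factor (v w) - 1)).
  by apply: bsum_le (bsumZ 40 bv) => w; rewrite ger0_norm ?cmod_ge0.
have hD := dlog_sum Htau hz.
have := @prod_deriv R _ f tau (c / 2) (fun w => sigma_factor (v w) - 1) x a _ _ _ _ bx hb2 _ _ bB ba hD.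
move=> /(_ _ _ _ _) [||h w hh|h w hh|P0 PD].
- by rewrite divr_gt0.
- by move=> w; rewrite addrC subrK.
- by have [] := step h w hh.
- by have [] := step h w hh.
rewrite /dtau_log_sigma (_ : (fun t : C => wsigma z t) = (fun t => z * lim ((fun A : {fset nzpair} => \prod_(i <- A) f i t) @ summability.totally)))//.
rewrite PD /wsigma.
set P := lim _ in P0 PD *.
rewrite [lattice_prod _ _](_ : _ = P)//.
by rewrite mulrA mulrC mulKf// mulf_neq0.
Qed.

End SigmaDerivative.

(** * The Eisenstein series E2 and its derivative *)

Section EisensteinSeries.
Context {R : realType}.
Local Notation C := (Cplx R).
Local Notation piC := (@piC R).
Local Notation iC := (@iC R).
Implicit Types (z u v : C) (x y : R).

Lemma bsum_poly_exp (c : R) j : 0 < c ->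
  bsum (fun k : nat => (1 + k%:R) ^+ j * expR (- (c * k%:R)) : R).
Proof.
move=> c0; have [K HK] := poly_mul_expR_bd j.+2 c0.
have b : bsum (fun k : nat => ((1 + k%:R) ^+ 2 : R)^-1).
  by apply: bsum_eq (bsum_inj (h := Posz) _ (bsum_int_2 (R := R))) => // ? ? [].
apply: bsum_le (bsumZ K b) => k.
have k0 : 0 < 1 + k%:R :> R by rewrite ltr_pwDl.
rewrite ger0_norm ?mulr_ge0 ?expR_ge0 ?exprn_ge0 ?(ltW k0)//.
rewrite ler_pdivlMr ?exprn_gt0//; apply: le_trans (HK k).
by rewrite mulrAC -exprD addn2.
Qed.

Lemma hsum_nat_shift (f : nat -> C) l : hsum f l -> hsum (fun d => f d.+1) (l - f 0%N).
Proof.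
move=> H; have h0 := hsum_delta (0%N : nat) (f 0%N).
have hi : injective S by move=> ? ? [].
have nE (i : nat) : ~ (exists j, j.+1 = i) -> f i - (if i == 0%N then f 0%N else 0) = 0.
  by case: i => [|i nE]; [rewrite subrr|case: nE; exists i].
have := (hsum_inj (f := fun i => f i - (if i == 0%N then f 0%N else 0)) _ hi nE).1 (hsumB H h0).
by apply: hsum_eq => d; rewrite subr0.
Qed.

Section Geom.
Variable u : C.
Hypothesis u1 : cmod u < 1.

Lemma geom_neq : 1 - u != 0.
Proof.
rewrite subr_eq0; apply/eqP => h; move: u1; rewrite -h cmod1 ltxx //.
Qed.

Lemma bsum_geom j : u != 0 -> bsum (fun k : nat => cmod ((1 + k%:R) ^+ j * u ^+ k)).
Proof.
rewrite -cmod_gt0 => u0; have [c cE] := expR_total u0.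
have c0 : 0 < - c by rewrite oppr_gt0 -expR_lt1 cE.
apply: bsum_eq (bsum_poly_exp j c0) => k.
have -> : cmod ((1 + k%:R) ^+ j * u ^+ k) = (1 + k%:R) ^+ j * cmod u ^+ k.
  rewrite cmodM !cmodX; congr (_ ^+ _ * _).
  by rewrite (_ : 1 + k%:R = k.+1%:R :> C) ?cmod_nat -natr1 addrC.
by rewrite -cE -expRM_natl; congr (_ * expR _); ring.
Qed.

(** The shift of the index by one gives linear equations for the three sums. *)
Lemma geom_sums : u != 0 -> exists A0 A1 A2 : C,
  [/\ hsum (fun d : nat => u ^+ d) A0, hsum (fun d : nat => d%:R * u ^+ d) A1
   & hsum (fun d : nat => d%:R ^+ 2 * u ^+ d) A2] /\
  [/\ A0 = (1 - u)^-1, A1 = u / (1 - u) ^+ 2 & A2 = u * (1 + u) / (1 - u) ^+ 3].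
Proof.
move=> u0; have hu := geom_neq.
have b j (e : nat -> C) : (forall k, cmod (e k) <= cmod ((1 + k%:R) ^+ j)) ->
    bsum (fun k => cmod (e k * u ^+ k)).
  move=> he; apply: bsum_le (bsum_geom j u0) => k; rewrite ger0_norm ?cmod_ge0//.
  by rewrite !cmodM ler_wpM2r ?cmod_ge0.
have n1 k : (1 + k%:R : C) = k.+1%:R by rewrite -natr1 addrC.
have [A0 h0] : exists A0, hsum (fun d : nat => u ^+ d) A0.
  apply: bsum_hsum; apply: bsum_eq (b 0%N (fun=> 1) _) => k; first by rewrite mul1r.
  by rewrite expr0.
have [A1 h1] : exists A1, hsum (fun d : nat => d%:R * u ^+ d) A1.
  apply: bsum_hsum; apply: (b 1%N (fun d => d%:R)) => k.
  by rewrite expr1 n1 !cmod_nat ler_nat.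
have [A2 h2] : exists A2, hsum (fun d : nat => d%:R ^+ 2 * u ^+ d) A2.
  apply: bsum_hsum; apply: (b 2%N (fun d => d%:R ^+ 2)) => k.
  by rewrite n1 !cmodX !cmod_nat lerXn2r ?nnegrE// ler_nat.
exists A0, A1, A2; split => //.
have e0 : A0 - 1 = u * A0.
  have := hsum_nat_shift h0; rewrite expr0 => H; apply: hsum_unique H _.
  by apply: hsum_eq (hsumZ u h0) => d; rewrite exprS.
have e1 : A1 = u * (A1 + A0).
  have := hsum_nat_shift h1; rewrite mul0r subr0 => H; apply: hsum_unique H _.
  by apply: hsum_eq (hsumZ u (hsumD h1 h0)) => d; rewrite [u ^+ d.+1]exprS -natr1; ring.
have e2 : A2 = u * (A2 + (2 * A1 + A0)).
  have := hsum_nat_shift h2; rewrite expr0n mul0r subr0 => H; apply: hsum_unique H _.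
  by apply: hsum_eq (hsumZ u (hsumD h2 (hsumD (hsumZ 2 h1) h0))) => d; rewrite [u ^+ d.+1]exprS -natr1; ring.
have E0 : A0 = (1 - u)^-1.
  apply: (mulIf hu); rewrite mulVf//.
  by transitivity (A0 - u * A0); [ring|rewrite -e0; ring].
have E1 : A1 = u / (1 - u) ^+ 2.
  have : A1 * (1 - u) = u * A0 by transitivity (A1 - u * A1); [ring|rewrite {1}e1; ring].
  move=> h; apply: (mulIf hu); rewrite h E0; field; exact: hu.
have E2 : A2 = u * (1 + u) / (1 - u) ^+ 3.
  have : A2 * (1 - u) = u * (2 * A1 + A0) by transitivity (A2 - u * A2); [ring|rewrite {1}e2; ring].
  move=> h; apply: (mulIf hu); rewrite h E0 E1; field; exact: hu.
by split.
Qed.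

End Geom.

Lemma eis2_e2pi z : e2pi z - 1 != 0 -> eis2 z = tpi ^+ 2 * (e2pi z / (1 - e2pi z) ^+ 2).
Proof.
move=> h; have h' : 1 - e2pi z != 0 by rewrite -oppr_eq0 opprB.
rewrite /eis2 -[piC ^+ 2]opprK -piCiC_sqr (_ : tpi = 2 * (piC * iC)); last by rewrite /tpi; ring.
by rewrite /eis1; field; rewrite h h'.
Qed.

Lemma eis3_e2pi z : e2pi z - 1 != 0 -> eis3 z = - (tpi ^+ 3 / 2) * (e2pi z * (1 + e2pi z) / (1 - e2pi z) ^+ 3).
Proof.
move=> h; have h' : 1 - e2pi z != 0 by rewrite -oppr_eq0 opprB.
rewrite /eis3 eis2_e2pi// (_ : tpi = 2 * (piC * iC)); last by rewrite /tpi; ring.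
by rewrite /eis1; field; rewrite h h'.
Qed.

(** With [q = e2pi t], these are the terms [d q^(m d)], the indices [m] and [d] being
    shifted to start from 0. *)
Definition qterm t (p : nat * nat) : C := p.2.+1%:R * e2pi ((p.1.+1 * p.2.+1)%:R * t).

Section Tau.
Variable tau : C.
Hypothesis Htau : 0 < complex.Im tau.

Lemma cmod_e2pi_tau n : cmod (e2pi (n%:R * tau)) = expR (- (2 * pi * complex.Im tau * n%:R)).
Proof.
rewrite cmod_e2pi (_ : n%:R * tau = (n%:Z)%:~R * tau)// Im_mul_int; congr expR.
by rewrite -[n%:Z%:~R]/(n%:R); ring.
Qed.

Lemma q_lt1 n : cmod (e2pi (n.+1%:R * tau)) < 1.
Proof.
rewrite cmod_e2pi_tau expR_lt1 oppr_lt0 !mulr_gt0//; exact: pi_gt0.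
Qed.

Lemma q_neq1 n : e2pi (n.+1%:R * tau) - 1 != 0.
Proof. by rewrite -oppr_eq0 opprB; apply: geom_neq; exact: q_lt1. Qed.

(** The variables separate, as [(m + 1) (d + 1) >= m + d]. *)
Lemma bsum_double (c : R) i j : 0 < c ->
  bsum (fun p : nat * nat => (p.1.+1%:R) ^+ i * (p.2.+1%:R) ^+ j * expR (- (c * (p.1.+1 * p.2.+1)%:R)) : R).
Proof.
move=> c0; apply: bsum_le (bsum_prod (bsum_poly_exp i c0) (bsum_poly_exp j c0)) => -[m d] /=.
have n1 (k : nat) : (1 + k%:R : R) = k.+1%:R by rewrite -natr1 addrC.
rewrite !n1 ger0_norm ?mulr_ge0 ?expR_ge0 ?exprn_ge0//.
rewrite mulrACA -expRD ler_wpM2l ?mulr_ge0 ?exprn_ge0// ler_expR.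
rewrite -opprD lerN2 -mulrDr ler_pM2l// -natrD ler_nat; nia.
Qed.

Lemma bsum_qterm : bsum (fun p => cmod (qterm tau p)).
Proof.
have c0 : 0 < 2 * pi * complex.Im tau by rewrite !mulr_gt0// pi_gt0.
apply: bsum_eq (bsum_double 0 1 c0) => p.
by rewrite /qterm cmodM cmod_nat cmod_e2pi_tau expr0 mul1r expr1.
Qed.

(** By [eis2_e2pi], [eis2 (m tau)] is [tpi ^+ 2] times the sum of the [d q^(m d)] over
    [d]. *)
Lemma qterm_row m : hsum (fun d => qterm tau (m, d)) (eistau2 tau m.+1%:Z / tpi ^+ 2).
Proof.
have [A0 [A1 [A2 [[_ h1 _] [_ e1 _]]]]] := geom_sums (q_lt1 m) (e2pi_neq0 _).
have := hsum_nat_shift h1; rewrite mul0r subr0 e1.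
rewrite /eistau2 /= eis2_e2pi; last exact: q_neq1.
rewrite [tpi ^+ 2 * _]mulrC mulfK ?expf_neq0 ?tpi_neq0//.
by apply: hsum_eq => d; rewrite /qterm /= natrM -mulrA [_ * tau]mulrC mulrA -!e2pi_nat; congr (_ * e2pi _); ring.
Qed.

Definition qsum : C := summability.sum (qterm tau).

Lemma hsum_qsum : hsum (qterm tau) qsum. Proof. by apply: bsum_hsumE; exact: bsum_qterm. Qed.
Lemma eis3N z : eis3 (- z) = - eis3 z. Proof. by rewrite /eis3 eis2N eis1N mulNr. Qed.

(** The rows [m] and [- m] agree. *)
Lemma G2_qsum : G2 tau = 2 * tpi ^+ 2 * qsum + piC ^+ 2 / 3.
Proof.
rewrite /G2; congr (_ + _).
have h1 := hsum_fubini hsum_qsum qterm_row.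
have := hsum_int_pos (hsum_ssum (rapid_eistau2 Htau)); rewrite (_ : eistau2 tau 0 = 0) ?subr0; last by rewrite /eistau2 eqxx.
move=> h2.
apply: hsum_unique h2 _; apply: hsum_eq (hsumZ (2 * tpi ^+ 2) h1) => k.
have -> : eistau2 tau (- k.+1%:Z) = eistau2 tau k.+1%:Z by rewrite /eistau2 oppr_eq0 rmorphN /= mulNr eis2N.
by field; rewrite tpi_neq0.
Qed.

(** The divisors [d] of [k] correspond to the pairs [(m, d)] with [m d = k]. *)
Lemma sigma1_sum (k : nat) : (0 < k)%N -> hsum (fun p : nat * nat => if (p.1.+1 * p.2.+1 == k)%N then qterm tau p else 0)
   ((sigma1 k)%:R * e2pi (k%:R * tau)).
Proof.
move=> k0; pose s := [seq (((k %/ d).-1, d.-1) : nat * nat) | d <- divisors k].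
have sP (p : nat * nat) : (p \in [fset x in s]%fset) = (p.1.+1 * p.2.+1 == k)%N.
  rewrite in_fset_seq; apply/mapP/eqP => [[d dk ->] /=|pk].
    move: dk; rewrite -dvdn_divisors// => dk.
    have d0 := dvdn_gt0 k0 dk; have kd0 : (0 < k %/ d)%N by rewrite divn_gt0// dvdn_leq.
    by rewrite !prednK// divnK.
  exists p.2.+1; first by rewrite -dvdn_divisors// -pk dvdn_mull.
  by rewrite -pk mulnK//; case: (p).
have := @hsum_fin R _ (fun p : nat * nat => if (p.1.+1 * p.2.+1 == k)%N then qterm tau p else 0) [fset x in s]%fset.
have us : uniq s.
  rewrite map_inj_in_uniq ?divisors_uniq// => d e dk ek [_].
    move: dk ek; rewrite -!dvdn_divisors// => /(dvdn_gt0 k0) d0 /(dvdn_gt0 k0) e0 E.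
  by rewrite -(prednK d0) -(prednK e0) E.
have -> : \sum_(p <- [fset x in s]%fset) (if (p.1.+1 * p.2.+1 == k)%N then qterm tau p else 0) =
    \sum_(p <- s) (if (p.1.+1 * p.2.+1 == k)%N then qterm tau p else 0).
  apply: perm_big; apply: uniq_perm; rewrite ?fset_uniq//.
  by move=> p; rewrite in_fset_seq.
rewrite big_map big_seq (eq_bigr (fun d : nat => d%:R * e2pi (k%:R * tau))) => [|d dk]; last first.
  have := sP ((k %/ d).-1, d.-1); rewrite in_fset_seq map_f// => /esym h; rewrite h /qterm (eqP h) /=.
    by move: dk; rewrite -dvdn_divisors// => /(dvdn_gt0 k0) /prednK ->.
rewrite -big_seq -mulr_suml -natr_sum; apply => p; rewrite sP.
by move/negPf => ->.
Qed.

(** The double series of [qterm] is summed by rows in [G2], and along the sets [m d = k]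
    in [E2]. *)
Theorem E2_G2 : E2 tau = G2 tau.
Proof.
have h : hsum (fun k : nat => if k == 0%N then 0 else (sigma1 k)%:R * e2pi (k%:R * tau)) qsum.
  apply: (hsum_fiber (h := fun p : nat * nat => (p.1.+1 * p.2.+1)%N) hsum_qsum) => -[|k].
    by apply: hsum_eq (hsum0 _) => -[m d].
  exact: sigma1_sum.
have c := hsum_nat_cvg h.
rewrite G2_qsum /E2 addrC; congr (_ + _); last first.
  by rewrite /zeta2; field.
congr (_ * _).
apply: cvg_lim; first exact: norm_hausdorff.
rewrite [X in X @ \oo --> _](_ : _ =
   (fun n : nat => \sum_(0 <= k < n) (if k == 0%N then 0 else (sigma1 k)%:R * e2pi (k%:R * tau))))//.
apply/funext => -[|n]; first by rewrite !big_geq.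
rewrite [RHS]big_ltn// eqxx add0r.
apply: eq_big_nat => k /andP[k0 _]; rewrite gtn_eqF//; congr (_ * _).
by rewrite /e2pi /tpi mulrA.
Qed.

Definition dqterm (p : nat * nat) : C := tpi * (p.1.+1 * p.2.+1)%:R * qterm tau p.

Lemma bsum_dqterm : bsum (fun p => cmod (dqterm p)).
Proof.
have c0 : 0 < 2 * pi * complex.Im tau by rewrite !mulr_gt0// pi_gt0.
apply: bsum_eq (bsumZ (2 * pi) (bsum_double 1 2 c0)) => p.
rewrite /dqterm /qterm cmodM [cmod (tpi * _)]cmodM cmod_tpi cmodM !cmod_nat cmod_e2pi_tau natrM; ring.
Qed.

(** By [eis3_e2pi], [eis3 (m tau)] is a multiple of the sum of the [d^2 q^(m d)] over
    [d]. *)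
Lemma dqterm_row m : hsum (fun d => dqterm (m, d)) (- (2 / tpi ^+ 2) * (m.+1%:R * eistau3 tau m.+1%:Z)).
Proof.
have [A0 [A1 [A2 [[_ _ h2] [_ _ e2]]]]] := geom_sums (q_lt1 m) (e2pi_neq0 _).
have := hsumZ (tpi * m.+1%:R) (hsum_nat_shift h2); rewrite expr0n mul0r subr0 e2.
rewrite /eistau3 /= eis3_e2pi; last exact: q_neq1.
move: (e2pi _ * _ / _) => X.
rewrite (_ : tpi * m.+1%:R * X = - (2 / tpi ^+ 2) * (m.+1%:R * (- (tpi ^+ 3 / 2) * X))); last by field; rewrite tpi_neq0.
apply: hsum_eq => d; rewrite /dqterm /qterm /=.
have -> : e2pi (m.+1%:R * tau) ^+ d.+1 = e2pi ((m.+1 * d.+1)%:R * tau).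
  by rewrite -e2pi_nat; congr e2pi; rewrite natrM; ring.
by rewrite natrM; ring.
Qed.

Lemma hsum_dqterm : hsum dqterm (- (smom (eistau3 tau) / tpi ^+ 2)).
Proof.
have [D hD] := bsum_hsum bsum_dqterm; suff <- : D = - (smom (eistau3 tau) / tpi ^+ 2) by [].
have h1 := hsum_fubini hD dqterm_row.
have := hsum_int_pos (hsum_smom (rapid_eistau3 Htau)); rewrite mulr0z mul0r subr0 => h2.
apply: hsum_unique h1 _.
have := hsumZ (- (tpi ^+ 2)^-1) h2; rewrite (_ : - (tpi ^+ 2)^-1 * _ = - (smom (eistau3 tau) / tpi ^+ 2)); last by ring.
apply: hsum_eq => k.
have -> : eistau3 tau (- k.+1%:Z) = - eistau3 tau k.+1%:Z by rewrite /eistau3 oppr_eq0 rmorphN /= mulNr eis3N.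
rewrite rmorphN /= mulrNN -[k.+1%:Z%:~R]/(k.+1%:R); ring.
Qed.

End Tau.

Lemma cexp_taylor2g v : cmod (cexp v - 1 - v) <= 24 * cmod v ^+ 2 * expR (cmod v).
Proof.
have v0 := cmod_ge0 v; have e1 := expR_ge1Dx (cmod v).
have [v1|v1] := leP (cmod v) 1.
  apply: le_trans (cexp_taylor2 v1) _; have := sqr_ge0 (cmod v) => q0.
  apply: le_trans (_ : 24 * cmod v ^+ 2 <= _); first by lra.
  by rewrite ler_peMr//; lra.
have ev : cmod (cexp v) <= expR (cmod v).
  by rewrite cmod_cexp ler_expR; apply: le_trans (ler_norm _) (Re_cmod _).
apply: le_trans (cmodB _ _) _; apply: le_trans (lerD (cmodB _ _) (lexx _)) _; rewrite cmod1.
have q1 : 1 <= cmod v ^+ 2 by rewrite exprn_ege1// ltW.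
have : expR (cmod v) <= cmod v ^+ 2 * expR (cmod v) by rewrite ler_peMl// expR_ge0.
lra.
Qed.

(** Termwise, the increment exceeds its linear part by [d q^(m d) (e^v - 1 - v)] with
    [v = 2 pi i m d h]. If [|h| <= Im tau / 2], half of the decay of [q^(m d)] absorbs the
    growth of [e^v], and the quadratic bounds [cexp_taylor2g] are summable. *)
Theorem derive1_E2 (tau : C) : 0 < complex.Im tau -> derive1 (@E2 R) tau = - 2 * smom (eistau3 tau).
Proof.
move=> Htau; pose y := complex.Im tau.
have c0 : 0 < pi * y by rewrite mulr_gt0// pi_gt0.
have [SB HSB] := bsum_double Htau 2 3 c0.
apply: (@derive1_quad R (@E2 R) tau _ (2 * (2 * pi) ^+ 2 * (24 * (2 * pi) ^+ 2 * SB)) (y / 2)); first by rewrite divr_gt0.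
move=> h hy; have Hh : 0 < complex.Im (h + tau).
  rewrite Im_add; have := le_trans (Im_cmod h) hy; rewrite ler_norml -/y.
  by move: Htau; rewrite -/y; lra.
rewrite !E2_G2// !G2_qsum//.
set D := - (smom (eistau3 tau) / tpi ^+ 2).
rewrite (_ : _ - _ - _ = 2 * tpi ^+ 2 * (qsum (h + tau) - qsum tau - h * D)); last by rewrite /D; field; rewrite tpi_neq0.
rewrite cmodM [cmod (2 * tpi ^+ 2)]cmodM cmodX cmod_tpi cmod_nat -[leRHS]mulrA ler_wpM2l ?mulr_ge0 ?exprn_ge0 ?mulr_ge0 ?pi_ge0//.
have hS := hsumB (hsumB (hsum_qsum Hh) (hsum_qsum Htau)) (hsumZ h (hsum_dqterm Htau)).
apply: (hsum_bounded hS) => A.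
apply: le_trans (_ : \sum_(p <- A) (24 * (2 * pi) ^+ 2 * cmod h ^+ 2) *
    `|p.1.+1%:R ^+ 2 * p.2.+1%:R ^+ 3 * expR (- (pi * y * (p.1.+1 * p.2.+1)%:R))| <= _); last first.
  rewrite -mulr_sumr (_ : 24 * (2 * pi) ^+ 2 * SB * cmod h ^+ 2 = 24 * (2 * pi) ^+ 2 * cmod h ^+ 2 * SB); last by ring.
  by apply: ler_wpM2l; rewrite ?mulr_ge0 ?exprn_ge0 ?mulr_ge0 ?pi_ge0 ?cmod_ge0.
apply: ler_sum => -[m' d'] _ /=; set n := (m'.+1 * d'.+1)%N.
rewrite ger0_norm ?mulr_ge0 ?expR_ge0 ?exprn_ge0//.
pose v : C := tpi * (n%:R * h).
have vE : cmod v = 2 * pi * (n%:R * cmod h) by rewrite cmodM cmod_tpi cmodM cmod_nat.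
have -> : qterm (h + tau) (m', d') - qterm tau (m', d') - h * dqterm tau (m', d') =
    d'.+1%:R * e2pi (n%:R * tau) * (cexp v - 1 - v).
  rewrite /qterm /dqterm /qterm /= -/n mulrDr e2piD [e2pi (n%:R * h)]/e2pi -/v /v; ring.
rewrite cmodM cmodM cmod_nat cmod_e2pi_tau -/y.
apply: le_trans (ler_wpM2l _ (cexp_taylor2g v)) _; first by rewrite mulr_ge0 ?expR_ge0.
have nE : n%:R = m'.+1%:R * d'.+1%:R :> R by rewrite /n natrM.
have hE : expR (cmod v) <= expR (pi * y * n%:R).
  rewrite ler_expR vE; have -> : 2 * pi * (n%:R * cmod h) = pi * n%:R * (2 * cmod h) by ring.
  by rewrite [leRHS]mulrAC ler_wpM2l ?mulr_ge0 ?pi_ge0//; lra.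
have eE : expR (- (2 * pi * y * n%:R)) * expR (pi * y * n%:R) = expR (- (pi * y * n%:R)).
  by rewrite -expRD; congr expR; ring.
rewrite -eE vE.
set E1 := expR (- (2 * pi * y * n%:R)).
apply: le_trans (_ : d'.+1%:R * E1 * (24 * (2 * pi * (n%:R * cmod h)) ^+ 2 * expR (pi * y * n%:R)) <= _).
  apply: ler_wpM2l; first by rewrite mulr_ge0 ?expR_ge0.
  by rewrite -vE; apply: ler_wpM2l => //; rewrite mulr_ge0 ?exprn_ge0 ?cmod_ge0.
by rewrite le_eqVlt; apply/orP; left; apply/eqP; rewrite nE; ring.
Qed.

End EisensteinSeries.

(** * The generalized Dedekind sums *)

Section DedekindSums.
Context {R : realType}.
Local Notation C := (Cplx R).
Local Notation piC := (@piC R).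
Local Notation iC := (@iC R).
Variable tau : C.
Hypothesis Htau : 0 < complex.Im tau.
Local Notation lat := (lattice tau).
Local Notation qzeta := (qzeta tau).
Local Notation qmom := (qmom tau).
Local Notation tp lm := (torsion_pt lm tau).

Lemma wzeta_E2 z : ~ lat z -> wzeta z tau - E2 tau * z = qzeta z.
Proof. by move=> hz; rewrite (wzeta_qzeta Htau hz) E2_G2// addrK. Qed.

Lemma tcoord_tp N (lm : 'I_N * 'I_N) : (0 < N)%N -> tcoord tau (tp lm) = lm.2%:R / N%:R.
Proof. by move=> N0; rewrite -(tcoord_tor Htau N0 lm.1 lm.2). Qed.

(** The summand with the coordinate of the torsion point is the correction that turns
    [qzeta] into the periodic function [ellZ]. *)
Lemma first_bracket N (lm : 'I_N * 'I_N) (x : R) : (0 < N)%N -> ~ lat (tp lm - ofR x) ->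
  wzeta (tp lm - ofR x) tau - E2 tau * (tp lm - ofR x) + 2 * piC * iC * (lm.2%:R / N%:R) =
  ellZ tau (tp lm - ofR x).
Proof.
move=> N0 h; rewrite wzeta_E2// /ellZ; congr (_ + _ * _).
by rewrite tcoordD tcoordN tcoord_real oppr0 addr0 tcoord_tp.
Qed.

Lemma second_bracket N (q : int) (lm : 'I_N * 'I_N) : (0 < N)%N -> gcdz N%:Z q = 1 -> nz_index lm ->
  wzeta (q%:~R * tp lm) tau - E2 tau * (q%:~R * tp lm) + 2 * piC * iC * (q%:~R * lm.2%:R / N%:R) =
  ellZ tau (q%:~R * tp lm).
Proof.
move=> N0 g nz; rewrite wzeta_E2; last by move=> /(tp_coprime Htau N0 g); rewrite nz.
by rewrite /ellZ; congr (_ + _ * _); rewrite tcoord_int tcoord_tp// mulrA.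
Qed.

(** Replacing [q] by [q + p] moves the second argument by a lattice point, and replacing
    [q] by [- q] changes its sign. *)
Lemma Dminus_period (p : nat) (q : int) (x : R) : V p q ->
  Dminus p q tau x = Dminus p (q + p%:Z) tau x /\ Dminus p (- q) tau x = - Dminus p q tau x.
Proof.
move=> [p0 g].
have g1 : gcdz p%:Z (q + p%:Z) = 1 by rewrite gcdzDr.
have g2 : gcdz p%:Z (- q) = 1 by rewrite gcdzN.
rewrite /Dminus -mulrN -sumrN; split; congr (_ * _); apply: eq_bigr => lm nz.
  rewrite (second_bracket p0 g nz) (second_bracket p0 g1 nz); congr (_ * _).
  by rewrite rmorphD mulrDl /= tp_scale// ellZ_lat.
by rewrite (second_bracket p0 g nz) (second_bracket p0 g2 nz) rmorphN /= mulNr ellZN// mulrN.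
Qed.

(** The added term, at the origin, has the factor [ellZ 0 = 0]. *)
Lemma Dminus_full (p q : nat) (x : R) : (0 < p)%N -> gcdn p q = 1%N -> ~ lat (p%:R * ofR x) ->
  Dminus p q%:Z tau x = 1 / (tpi ^+ 2 * p%:R) * \sum_(lm : 'I_p * 'I_p) ellZ tau (tp lm - ofR x) * ellZ tau (q%:R * tp lm).
Proof.
move=> p0 g hx; have gz : gcdz p%:Z q%:Z = 1 by rewrite /gcdz g.
have hx' : ~ lat (p%:R * - ofR x) by rewrite mulrN => /lat_opp.
rewrite /Dminus; congr (_ * _); rewrite big_mkcond; apply: eq_bigr => lm _.
case: ifP => [nz|/negbT/tp0 ->]; last by rewrite mulr0 ellZ0// mulr0.
by rewrite (second_bracket p0 gz nz) first_bracket//; exact: tp_real_nlat.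
Qed.

Lemma ellZ_real (x : R) : ellZ tau (ofR x) = qzeta (ofR x).
Proof. by rewrite /ellZ tcoord_real mulr0 addr0. Qed.

Lemma ellL_real (x : R) : ellL tau (ofR x) = - tpi * qmom (ofR x).
Proof. by rewrite /ellL tcoord_real mul0r addr0 expr0n mulr0 subr0. Qed.

(** This is [reciprocity_sum] divided by [tpi ^+ 2 * p * q]. At real arguments [ellZ] is
    [qzeta] and [ellL] is [- tpi * qmom], and in the brackets of [Rminus] the derivative of
    [E2] cancels the quadratic term of [dtau_log]. *)
Lemma reciprocity (p q : nat) : U p q -> exists c : C, \forall x \near (0 : R)^',
  Dminus p q%:Z tau x + Dminus q p%:Z tau x = Rminus p q tau x + c.
Proof.
move=> [p0 q0 g].
have [c Hc] := reciprocity_sum Htau p0 q0 g.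
have [c0 Hc0] := wpsum_qzeta Htau.
have [eps eps0 Heps] := dtau_log Htau.
have pn : (p%:R : C) != 0 by rewrite pnatr_eq0 -lt0n.
have qn : (q%:R : C) != 0 by rewrite pnatr_eq0 -lt0n.
(* Each bracket of [Rminus] is [2 * qmom] minus this constant. *)
pose k : C := 2 * smom (eistau1 tau) + 1 / (piC * iC) * G2 tau.
exists (c / (tpi ^+ 2 * p%:R * q%:R) + (q%:R / (2 * tpi * p%:R) + p%:R / (2 * tpi * q%:R)) * k
   - c0 / (tpi ^+ 2 * p%:R * q%:R)).
pose d := Num.min (2^-1) eps / (p + q)%:R.
have pq0 : 0 < (p + q)%:R :> R by rewrite ltr0n addn_gt0 p0.
have d0 : 0 < d by rewrite divr_gt0// lt_min eps0 invr_gt0 ltr0n.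
near=> x.
have x0 : x != 0 by near: x; exact: nbhs_dnbhs_neq.
have xd : `|x| <= d by near: x; exact: dnbhs0_le.
have scale (n : nat) : (0 < n <= p + q)%N ->
    [/\ ~ lat (ofR (n%:R * x)), cmod (ofR (n%:R * x)) <= eps & n%:R * ofR x = ofR (n%:R * x) :> C].
  move=> /andP[n0 nle].
  have nx : `|n%:R * x| <= Num.min (2^-1) eps.
    rewrite normrM normr_nat; apply: le_trans (_ : (p + q)%:R * d <= _).
      by rewrite ler_pM// ler_nat.
    by rewrite /d mulrC divfK// gt_eqF.
  split.
  - apply: (real_nlat Htau); rewrite normr_gt0 mulf_neq0 ?pnatr_eq0 -?lt0n//=.
    by apply: le_lt_trans nx _; rewrite gt_min; apply/orP; left; lra.
  - by rewrite cmod_ofR; apply: le_trans nx _; rewrite ge_min lexx orbT.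
  - by rewrite ofRM -ofR_natr.
have [hp pe pE] := scale p ltac:(by rewrite p0 leq_addr).
have [hq qe qE] := scale q ltac:(by rewrite q0 leq_addl).
have [hx _ _] := scale 1%N ltac:(by rewrite addn_gt0 p0).
rewrite mul1r in hx.
have := Hc x; rewrite pE qE => /(_ hp hq); rewrite !ellZ_real !ellL_real => E.
rewrite (Dminus_full p0 g) ?pE// (Dminus_full q0) 1?gcdnC// ?qE//.
rewrite /Rminus pE qE !wzeta_E2// !Heps// derive1_E2// (wp_wpsum Htau hx) E2_G2// subrK (Hc0 _ hx).
move: E; set S := \sum_(t : 'I_p * 'I_p) _; set T := \sum_(s : 'I_q * 'I_q) _ => E.
transitivity (1 / (tpi ^+ 2 * p%:R * q%:R) * (q%:R * S + p%:R * T)).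
  by field; rewrite pn qn tpi_neq0.
rewrite E -pE -qE /k /tpi.
move: (qzeta (p%:R * ofR x)) (qzeta (q%:R * ofR x)) (qmom (p%:R * ofR x)) (qmom (q%:R * ofR x)) => Fp Fq Mp Mq.
field.
by rewrite pn qn piC_neq0 iC_neq0.
Unshelve. all: by end_near.
Qed.

End DedekindSums.

Theorem theorem1p3 (R : realType) (tau : Cplx R)
    (Htau : upper_half_plane tau) :
  (forall (p : nat) (q : int), V p q ->
     forall x : R, Dminus_defined p tau x ->
       Dminus p q tau x = Dminus p (q + p%:Z) tau x /\
       Dminus p (- q) tau x = - Dminus p q tau x) /\
  (forall p q : nat, U p q ->
     exists C : Cplx R, \forall x \near (0 : R)^',
       Dminus p q%:Z tau x + Dminus q p%:Z tau x = Rminus p q tau x + C).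
Proof.
split; first by move=> p q hV x _; exact: (Dminus_period Htau x hV).
by move=> p q; exact: (reciprocity Htau).
Qed.
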